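(* Let $\mu_0\in\mathcal{M}$ be a limit point of the metric space $\mathcal{M}$. The solution to the boundary-value problem $$y^{(r)}(t,\mu)+\sum_{\ell=1}^{r}A_{r-\ell}(t,\mu)\,y^{(r-\ell)}(t,\mu)=f(t,\mu),\quad t\in(a,b),\qquad B(\mu)y(\cdot,\mu)=c(\mu),$$ depends continuously on the parameter $\mu$ at $\mu_0$ if and only if all of the following three conditions hold: Condition (0): the homogeneous problem $L(\mu_0)y=0$ on $(a,b)$, $B(\mu_0)y=0$ has only the trivial solution $y\in (W^{n+r}_p)^m$; Limit Condition (I): $A_{r-\ell}(\cdot,\mu)\to A_{r-\ell}(\cdot,\mu_0)$ in $(W^n_p)^{m\times m}$ as $\mu\to\mu_0$, for every $\ell\in\{1,\ldots,r\}$; Limit Condition (II): $B(\mu)y\to B(\mu_0)y$ in $\mathbb{C}^{rm}$ as $\mu\to\mu_0$, for every $y\in (W^{n+r}_p)^m$.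
   Context: Let $(a,b)\subset\mathbb{R}$ be a finite interval, $n\in\mathbb{N}\cup\{0\}$, $m,r\in\mathbb{N}=\{1,2,\ldots\}$, $1\le p\le\infty$. $W^{k}_p=W^k_p([a,b];\mathbb{C})$ is the complex Sobolev space with norm $\|y\|_{k,p}=\sum_{s=0}^{k}\|y^{(s)}\|_{L_p}$, and $W^0_p=L_p$. $(W^k_p)^m$ and $(W^k_p)^{m\times m}$ denote the spaces of $\mathbb{C}^m$-valued (column) and $\mathbb{C}^{m\times m}$-valued functions with all entries in $W^k_p$; their norms are the sums of the norms of the entries. $\mathcal{M}$ is an arbitrary metric space; $\mathcal{B}(\mu_0,\varepsilon)$ is the open ball in $\mathcal{M}$ with center $\mu_0$ and radius $\varepsilon$. For each $\mu\in\mathcal{M}$ there are given arbitrary matrix-valued functions $A_{r-\ell}(\cdot,\mu)\in(W^n_p)^{m\times m}$, $\ell=1,\ldots,r$, and an arbitrary continuous linear operator $B(\mu)\colon (W^{n+r}_p)^m\to\mathbb{C}^{rm}$; no regularity in $\mu$ is assumed a priori. Put $L(\mu)y:=y^{(r)}+\sum_{\ell=1}^r A_{r-\ell}(\cdot,\mu)y^{(r-\ell)}$, a continuous linear operator $(W^{n+r}_p)^m\to(W^n_p)^m$. The right-hand sides are $f(\cdot,\mu)\in(W^n_p)^m$ and $c(\mu)\in\mathbb{C}^{rm}$. A solution is a function $y(\cdot,\mu)\in(W^{n+r}_p)^m$ satisfying the differential equation (everywhere on $(a,b)$ if $n\ge1$, almost everywhere if $n=0$) and the boundary condition. Definition. The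 solution to the boundary-value problem depends continuously on the parameter $\mu$ at the limit point $\mu_0$ if: ($\ast$) there exists $\varepsilon>0$ such that for every $\mu\in\mathcal{B}(\mu_0,\varepsilon)$ and arbitrary right-hand sides $f(\cdot,\mu)\in(W^n_p)^m$, $c(\mu)\in\mathbb{C}^{rm}$, the problem has a unique solution $y(\cdot,\mu)\in(W^{n+r}_p)^m$; ($\ast\ast$) whenever the right-hand sides satisfy $f(\cdot,\mu)\to f(\cdot,\mu_0)$ in $(W^n_p)^m$ and $c(\mu)\to c(\mu_0)$ in $\mathbb{C}^{rm}$ as $\mu\to\mu_0$, the corresponding solutions satisfy $y(\cdot,\mu)\to y(\cdot,\mu_0)$ in $(W^{n+r}_p)^m$ as $\mu\to\mu_0$. *)

(* Defs.v *)
From HB Require Import structures.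
From mathcomp Require Import all_boot all_order all_algebra.
From mathcomp Require Import all_classical all_reals all_analysis.
From mathcomp Require Import complex.
Set Implicit Arguments.
Unset Strict Implicit.
Unset Printing Implicit Defensive.
Import Order.TTheory GRing.Theory Num.Theory.
Import numFieldNormedType.Exports.
Local Open Scope classical_set_scope.
Local Open Scope ring_scope.

(* Functions on [a, b] are represented by total functions on R whose values
   outside [a, b] are never used.  A function in L_p is represented by any Borel
   measurable function of its class, so that || f - g ||_p = 0, and not f = g,
   expresses equality in L_p. *)

Section Sobolev.
Context {R : realType}.
Implicit Types (a b : R) (p : \bar R) (k : nat) (f : R -> R[i]).

(* s-th classical derivative of f, taken separately on the real and imaginary
   parts; at a point where it does not exist it has a dummy value. *)
Definition cderiv (s : nat) f (t : R) : R[i] :=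
  Complex (derive1n s (fun u => complex.Re (f u)) t)
          (derive1n s (fun u => complex.Im (f u)) t).

Definition cderivable f (t : R) : Prop :=
  derivable (fun u => complex.Re (f u)) t 1 /\
  derivable (fun u => complex.Im (f u)) t 1.

(* The exponent p ranges over the extended reals; p = +oo gives the essential
   supremum norm. *)
Definition Lp_norm a b p f : \bar R :=
  Lnorm (@lebesgue_measure R) p
    ((fun t => (ComplexField.Normc.normc (f t))%:E) \_ `]a, b[).

Definition in_Lp a b p f : Prop :=
  [/\ measurable_fun `]a, b[ (fun t => complex.Re (f t)),
      measurable_fun `]a, b[ (fun t => complex.Im (f t)) &
      (Lp_norm a b p f < +oo)%E].

(* The sequence s lists the intervals [i.1, i.2], which may only overlap at
   their endpoints. *)
Definition absolutely_continuous_on (I : set R) f : Prop :=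
  forall eps : R, 0 < eps -> exists2 delta : R, 0 < delta &
    forall s : seq (R * R),
      (forall i, i \in s -> [/\ i.1 <= i.2, I i.1 & I i.2]) ->
      pairwise (fun i j => (i.2 <= j.1) || (j.2 <= i.1)) s ->
      \sum_(i <- s) (i.2 - i.1) < delta ->
      \sum_(i <- s) ComplexField.Normc.normc (f i.2 - f i.1) < eps.

(* W^0_p = L_p, and for k >= 1 the space W^k_p consists of the f in C^(k-1)[a, b]
   with f^(k-1) absolutely continuous and f^(k) in L_p.  Derivatives are taken
   on ]a, b[, where they do not depend on the values of f outside [a, b]:
   absolute continuity of f^(k-1) on the bounded interval ]a, b[ is what makes
   the derivatives of order < k extend continuously to [a, b], and the
   continuity of f on [a, b] says that f itself takes the limit values at a, b. *)
Definition in_W a b k p f : Prop :=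
  if k is k'.+1 then
    [/\ {within `[a, b], continuous (fun t => complex.Re (f t))},
        {within `[a, b], continuous (fun t => complex.Im (f t))},
        (forall s, (s < k')%N -> forall t, t \in `]a, b[ ->
           cderivable (cderiv s f) t),
        absolutely_continuous_on `]a, b[ (cderiv k' f) &
        in_Lp a b p (cderiv k f)]
  else in_Lp a b p f.

Definition W_norm a b k p f : \bar R :=
  (\sum_(s < k.+1) Lp_norm a b p (cderiv s f))%E.

Definition mx_deriv {m q : nat} (s : nat) (F : R -> 'M[R[i]]_(m, q)) (t : R) :
    'M[R[i]]_(m, q) :=
  \matrix_(i, j) cderiv s (fun u => F u i j) t.

Definition mx_in_W {m q : nat} a b k p (F : R -> 'M[R[i]]_(m, q)) : Prop :=
  forall i j, in_W a b k p (fun t => F t i j).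

Definition mx_W_norm {m q : nat} a b k p (F : R -> 'M[R[i]]_(m, q)) : \bar R :=
  (\sum_(i < m) \sum_(j < q) W_norm a b k p (fun t => F t i j))%E.

Definition cv_norm {q : nat} (c : 'cV[R[i]]_q) : R :=
  \sum_(i < q) ComplexField.Normc.normc (c i 0).

(* B is only constrained on (W^k_p)^m; continuity with respect to the norm
   makes B y depend only on the element of (W^k_p)^m that y represents. *)
Definition continuous_linear_on_W {m q : nat} a b k p
    (B : (R -> 'cV[R[i]]_m) -> 'cV[R[i]]_q) : Prop :=
  (forall (x : R[i]) (y z : R -> 'cV[R[i]]_m),
     mx_in_W a b k p y -> mx_in_W a b k p z ->
     B (x *: y + z) = x *: B y + B z) /\
  (forall y : R -> 'cV[R[i]]_m, mx_in_W a b k p y ->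
     forall eps : R, 0 < eps -> exists2 delta : R, 0 < delta &
     forall z : R -> 'cV[R[i]]_m, mx_in_W a b k p z ->
       (mx_W_norm a b k p (z - y)%R < delta%:E)%E -> cv_norm (B z - B y) < eps).

End Sobolev.

Section BoundaryValueProblem.
Context {R : realType} (a b : R) (n m r : nat) (p : \bar R).

(* L y = y^(r) + sum_(j < r) A_j y^(j), with j = r - l. *)
Definition diff_op (A : 'I_r -> R -> 'M[R[i]]_m) (y : R -> 'cV[R[i]]_m) (t : R) :
    'cV[R[i]]_m :=
  mx_deriv r y t + \sum_(j < r) A j t *m mx_deriv j y t.

Definition diff_eq (A : 'I_r -> R -> 'M[R[i]]_m) (f y : R -> 'cV[R[i]]_m) : Prop :=
  if n is 0 then
    {ae @lebesgue_measure R, forall t, t \in `]a, b[ -> diff_op A y t = f t}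
  else forall t, t \in `]a, b[ -> diff_op A y t = f t.

Definition bvp_solution (A : 'I_r -> R -> 'M[R[i]]_m)
    (B : (R -> 'cV[R[i]]_m) -> 'cV[R[i]]_(r * m))
    (f : R -> 'cV[R[i]]_m) (c : 'cV[R[i]]_(r * m)) (y : R -> 'cV[R[i]]_m) : Prop :=
  [/\ mx_in_W a b (n + r) p y, diff_eq A f y & B y = c].

Definition bvp_uniquely_solvable (A : 'I_r -> R -> 'M[R[i]]_m)
    (B : (R -> 'cV[R[i]]_m) -> 'cV[R[i]]_(r * m))
    (f : R -> 'cV[R[i]]_m) (c : 'cV[R[i]]_(r * m)) : Prop :=
  (exists y, bvp_solution A B f c y) /\
  (forall y z, bvp_solution A B f c y -> bvp_solution A B f c z ->
     forall t, t \in `[a, b] -> y t = z t).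

Definition W_cvg {M : metricType R} {q1 q2 : nat} (k : nat)
    (F : M -> R -> 'M[R[i]]_(q1, q2)) (mu0 : M) : Prop :=
  mx_W_norm a b k p (F mu - F mu0) @[mu --> mu0] --> (0 : \bar R)%E.

Definition cv_cvg {M : metricType R} {q : nat}
    (c : M -> 'cV[R[i]]_q) (mu0 : M) : Prop :=
  cv_norm (c mu - c mu0) @[mu --> mu0] --> (0 : R).

Definition solution_continuous_at {M : metricType R}
    (A : 'I_r -> M -> R -> 'M[R[i]]_m)
    (B : M -> (R -> 'cV[R[i]]_m) -> 'cV[R[i]]_(r * m)) (mu0 : M) : Prop :=
  exists eps : R, [/\ 0 < eps,
    (forall mu, ball mu0 eps mu ->
     forall (f : R -> 'cV[R[i]]_m) (c : 'cV[R[i]]_(r * m)), mx_in_W a b n p f ->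
       bvp_uniquely_solvable (fun j => A j mu) (B mu) f c) &
    (forall (f : M -> R -> 'cV[R[i]]_m) (c : M -> 'cV[R[i]]_(r * m))
            (y : M -> R -> 'cV[R[i]]_m),
       (forall mu, mx_in_W a b n p (f mu)) ->
       (forall mu, ball mu0 eps mu ->
          bvp_solution (fun j => A j mu) (B mu) (f mu) (c mu) (y mu)) ->
       W_cvg n f mu0 -> cv_cvg c mu0 -> W_cvg (n + r) y mu0)].

End BoundaryValueProblem.

(* Main.v *)
Require Import Defs.
From HB Require Import structures.
From mathcomp Require Import all_boot all_order all_algebra.
From mathcomp Require Import all_classical all_reals all_analysis.
From mathcomp Require Import complex.
From mathcomp Require Import measurable_realfun ess_sup_inf ring lra.
Set Implicit Arguments.
Unset Strict Implicit.
Unset Printing Implicit Defensive.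
Import Order.TTheory GRing.Theory Num.Theory.
Import numFieldNormedType.Exports.
Local Open Scope classical_set_scope.
Local Open Scope ring_scope.

(* By the fundamental theorem of calculus for absolutely continuous functions, obtained from
   the Radon-Nikodym derivative of Stieltjes measures, the functions in W^(k+1)_p are the
   constants plus integrals of functions in W^k_p; completeness, the bound on the supremum
   and the boundedness of products follow by induction on k.  The differential equation is a
   first-order Volterra system, solved by Picard iteration: its solutions depend boundedly on
   f, up to the r m-dimensional space of homogeneous solutions, so that (L(mu), B(mu)) has a
   bounded inverse as soon as it is injective.

   Sufficiency: by (II) and a gliding hump the operators B(mu) are uniformly bounded near mu0,
   whence |w| <= C (|L(mu) w| + |B(mu) w|) with C independent of mu near mu0; this is applied
   to w = y(mu) - y(mu0).

   Necessity: let v(mu) solve the problem with data L(mu0) z and B(mu0) z, so that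
   w = z - v(mu) -> 0.  Then L(mu) z - L(mu0) z = L(mu) w, and for the z = (t - a)^s / s! with
   s < r this bounds A(mu) - A(mu0) by o(1) (1 + |A(mu) - A(mu0)|).  Likewise
   d = B(mu) z - B(mu0) z equals B(mu) w; after subtracting from w the solution u with data
   L(mu) w and 0, it is the combination with coefficients d of the solutions e_i(mu) whose
   boundary values are the unit vectors, and e_i(mu) -> e_i(mu0). *)

(** * Absolutely continuous functions *)

(** Functions are total, norms vanish on whole classes of functions, and the classical derivative
    has dummy values where it does not exist. Therefore y^(s) is always replaced by a representative
    that lies in the right Sobolev class on all of [a, b], and L y = f is a relation in which f is
    such a representative. Abstract Banach space theorems are replaced by explicit constructions,
    for which completeness is needed only along sequences with geometrically small increments.

    The obstacle in both directions is that B(mu) - B(mu0) can at best be controlled on fixed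
    functions, never on one that varies with mu. The solutions e_i of the homogeneous equation at
    mu0 with unit boundary values are fixed functions: finitely many of them carry the boundary
    values of a varying function, and the rest solves a problem with zero boundary values. In the
    necessity not even a bound on B(mu) is at hand, so d is measured by B(mu0) alone. Condition (I)
    has to precede (II) there, because the bound on L(mu) w requires bounded coefficients. Errors
    that contain the unknown quantity itself carry a vanishing factor and are absorbed. *)

Section real_absolute_continuity.
Context {R : realType}.
Implicit Types (I : set R) (f g : R -> R).

Definition real_ac I f : Prop :=
  forall eps : R, 0 < eps -> exists2 delta : R, 0 < delta &
    forall s : seq (R * R),
      (forall i, i \in s -> [/\ i.1 <= i.2, I i.1 & I i.2]) ->
      pairwise (fun i j => (i.2 <= j.1) || (j.2 <= i.1)) s ->
      \sum_(i <- s) (i.2 - i.1) < delta ->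
      \sum_(i <- s) `|f i.2 - f i.1| < eps.

Local Notation apart := (fun i j : R * R => (i.2 <= j.1) || (j.2 <= i.1)).

Fixpoint itv_pieces (x : R) (l : seq R) : seq (R * R) :=
  if l is y :: l' then (x, y) :: itv_pieces y l' else [::].

Lemma variation_pieces x y f (l : seq R) :
  variation x y f l = \sum_(i <- itv_pieces x l) `|f i.2 - f i.1|.
Proof.
elim: l x => [|z l IH] x; first by rewrite variation_nil big_nil.
by rewrite /variation /= big_nat_recl//= big_cons -IH.
Qed.

Lemma itv_pieces_sub x y l : itv_partition x y l ->
  forall i, i \in itv_pieces x l -> [/\ x <= i.1, i.1 <= i.2 & i.2 <= y].
Proof.
elim: l x => [//|z l IH] x /[dup] /itv_partition_cons pzy [/= /andP[xz _] _] i.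
have zy := itv_partition_le pzy.
rewrite inE => /predU1P[->/=|/(IH _ pzy)[zi i12 iy]].
  by split=> //; exact: ltW.
by split=> //; rewrite (le_trans _ zi)// ltW.
Qed.

Lemma itv_pieces_apart x y l : itv_partition x y l ->
  pairwise apart (itv_pieces x l).
Proof.
elim: l x => [//|z l IH] x /itv_partition_cons pzy /=.
rewrite IH// andbT; apply/allP => i /(itv_pieces_sub pzy)[zi _ _] /=.
by rewrite zi.
Qed.

Lemma itv_pieces_length x y l : itv_partition x y l ->
  \sum_(i <- itv_pieces x l) (i.2 - i.1) = y - x.
Proof.
elim: l x => [|z l IH] x.
  by move=> /itv_partition_nil ->; rewrite big_nil subrr.
by move=> /itv_partition_cons pzy; rewrite big_cons IH//=; lra.
Qed.

(** The intervals of [s] are subdivided one at a time and moved to [s']; subdividing keeps the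
    family non-overlapping and its total length unchanged. The supremum over the subdivisions of the
    current interval can be taken because the remaining sum is finite. *)
Lemma real_ac_total_variation_sum f (eps delta : R) :
  (forall s : seq (R * R), (forall i, i \in s -> i.1 <= i.2) ->
      pairwise apart s -> \sum_(i <- s) (i.2 - i.1) < delta ->
      \sum_(i <- s) `|f i.2 - f i.1| < eps) ->
  forall s s' : seq (R * R), (forall i, i \in s' ++ s -> i.1 <= i.2) ->
      pairwise apart (s' ++ s) ->
      \sum_(i <- s' ++ s) (i.2 - i.1) < delta ->
      ((\sum_(i <- s') `|f i.2 - f i.1|)%:E +
         \sum_(i <- s) total_variation i.1 i.2 f <= eps%:E)%E.
Proof.
move=> H; elim=> [|[x y] s IH] s' les ps ds.
  rewrite cats0 in les ps ds *; rewrite big_nil adde0 lee_fin ltW//.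
  exact: H.
have xy : x <= y by apply: (les (x, y)); rewrite mem_cat mem_head orbT.
have tv0 : (0 <= \sum_(i <- s) total_variation i.1 i.2 f)%E.
  rewrite big_seq sume_ge0// => i si; apply: total_variation_ge0.
  by apply: les; rewrite mem_cat inE si !orbT.
have key l : itv_partition x y l ->
    ((\sum_(i <- s') `|f i.2 - f i.1| + variation x y f l)%:E +
         \sum_(i <- s) total_variation i.1 i.2 f <= eps%:E)%E.
  move=> pl; rewrite variation_pieces -big_cat; apply: IH.
  - move=> i; rewrite !mem_cat -orbA => /or3P[i'|/(itv_pieces_sub pl)[]//|i'].
      by apply: les; rewrite mem_cat i'.
    by apply: les; rewrite mem_cat inE i' !orbT.
  - move: ps; rewrite !pairwise_cat/= => /and3P[/allrelP h1 -> /andP[/allP h2 ->]].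
    rewrite (itv_pieces_apart pl) !andbT; apply/andP; split; apply/allrelP.
      move=> i j; rewrite mem_cat => /orP[i1 j1|].
        by apply: h1 => //; rewrite inE j1 orbT.
      move=> /(itv_pieces_sub pl)[xi i12 iy] /h2 /= /orP[h|h].
        by rewrite (le_trans iy).
      by rewrite (le_trans h)// orbT.
    move=> i j i1 /(itv_pieces_sub pl)[xi i12 iy].
    have /= /orP[h|h] := h1 i (x, y) i1 (mem_head _ _).
      by rewrite (le_trans h).
    by rewrite (le_trans iy)// orbT.
  - move: ds; rewrite !big_cat/= big_cons/= (itv_pieces_length pl); lra.
rewrite big_cons/= addeA addeAC.
have [l0 pl0] : exists l, itv_partition x y l.
  have [<-|xNy] := eqVneq x y; first by exists [::]; split=> /=.
  by exists [:: y]; apply: itv_partition1; rewrite lt_neqAle xNy.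
have fs : (\sum_(i <- s) total_variation i.1 i.2 f)%E \is a fin_num.
  rewrite ge0_fin_numE//; have := key _ pl0.
  rewrite addeC -leeBrDr//; move/le_lt_trans; apply.
  by rewrite -EFinB ltry.
rewrite -leeBrDl ?fin_numD ?fs//; apply: ge_ereal_sup => _ [_ [l pl <-] <-].
by rewrite leeBrDl ?fin_numD ?fs// addeAC -EFinD key.
Qed.

(** With [d] belonging to [eps = 1], every piece of length at most [h = d / 2] has variation at most
    1, and finitely many such pieces cover the interval. *)
Lemma real_ac_total_variation_lty f x y : real_ac setT f -> x <= y ->
  (total_variation x y f < +oo)%E.
Proof.
move=> /(_ 1 ltr01)[d d0 fd] xy.
pose h := d / 2; have h0 : 0 < h by rewrite divr_gt0.
have step z w : z <= w -> w - z < d -> (total_variation z w f <= 1%:E)%E.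
  move=> zw wzd; have := @real_ac_total_variation_sum f 1 d _ [:: (z, w)] [::].
  rewrite !big_seq1 big_nil add0e/=; apply => //.
    by move=> s s1 s2 s3; apply: fd => // i /s1.
  by move=> i; rewrite inE => /eqP ->.
have [n nxy] : exists n : nat, (y - x) / h < n%:R.
  by exists (Num.bound ((y - x) / h)); rewrite archi_boundP// divr_ge0 ?subr_ge0// ltW.
have {nxy} : y <= x + h * n%:R by rewrite -lerBlDl mulrC -ler_pdivrMr// ltW.
have ind : forall n z, (forall w, z <= w -> w <= z + h * n%:R ->
    (total_variation z w f < +oo)%E).
  elim=> [|k IH] z w zw.
    rewrite mulr0 addr0 => wz; have /eqP -> : z == w by rewrite eq_le zw.
    by rewrite total_variationxx.
  move=> wz; have [zhw|zhw] := leP w (z + h).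
    by apply: (le_lt_trans (step _ _ zw _)); [rewrite /h in zhw *; lra|exact: ltry].
  rewrite (@total_variationD _ _ _ (z + h))//; [|rewrite /h; lra|exact: ltW].
  rewrite lte_add_pinfty//; last first.
    apply: IH; first exact: ltW.
    by move: wz; rewrite -natr1; lra.
  by apply: (le_lt_trans (step _ _ _ _)); [rewrite /h; lra..|exact: ltry].
by apply: ind.
Qed.

Lemma max_contraction (c x y : R) : x <= y ->
  0 <= Num.max c y - Num.max c x <= y - x.
Proof.
rewrite /Num.max => xy.
by repeat case: ifPn => //; rewrite -?leNgt => *; apply/andP; split; lra.
Qed.

Lemma min_contraction (c x y : R) : x <= y ->
  0 <= Num.min x c - Num.min y c + (y - x) /\ Num.min x c <= Num.min y c.
Proof.
rewrite /Num.min => xy.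
by repeat case: ifPn => //; rewrite -?leNgt => *; split; lra.
Qed.

(** Clamping to [[c, d]] is nondecreasing and a contraction, so it maps admissible families of
    intervals to admissible ones. The extension is needed because Stieltjes measures live on the
    whole line. *)
Lemma real_ac_clamp c d f : c <= d -> real_ac `[c, d] f ->
  real_ac setT (fun t => f (Num.max c (Num.min t d))).
Proof.
move=> cd acf eps eps0; have [del del0 H] := acf eps eps0.
pose k t : R := Num.max c (Num.min t d).
have kh (x y : R) : x <= y -> 0 <= k y - k x <= y - x.
  move=> /(min_contraction d)[m1 m2].
  have /andP[M1 M2] := max_contraction c m2.
  by rewrite /k M1/=; lra.
exists del => // s sle sap slen.
have := H [seq (k i.1, k i.2) | i <- s]; rewrite !big_map/=; apply.
- move=> i /mapP[j js ->]/=; have [j12 _ _] := sle _ js.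
  split; first by have /andP[] := kh _ _ j12; rewrite subr_ge0.
    by rewrite in_itv/= /k le_max lexx/= ge_max cd/= ge_min lexx orbT.
  by rewrite in_itv/= /k le_max lexx/= ge_max cd/= ge_min lexx orbT.
- rewrite pairwise_map; apply: sub_pairwise sap => i j /= /orP[|] ij.
    by have /andP[] := kh _ _ ij; rewrite subr_ge0 => ->.
  by have /andP[] := kh _ _ ij; rewrite subr_ge0 => -> _; rewrite orbT.
- apply: le_lt_trans slen; rewrite big_seq [leRHS]big_seq; apply: ler_sum => i si.
  by have [i12 _ _] := sle _ si; have /andP[] := kh _ _ i12.
Qed.

(** The variation function with base point [c], continued by 0 to the left of [c]. Where it is used
    [f] is absolutely continuous on the line, so the variation is finite and [fine] loses
    nothing. *)
Definition variation_from c f (t : R) : R :=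
  fine (total_variation c (Num.max c t) f).

Lemma variation_fromB c f x y : real_ac setT f -> x <= y ->
  (variation_from c f y - variation_from c f x)%:E =
  total_variation (Num.max c x) (Num.max c y) f.
Proof.
move=> acf xy; rewrite /variation_from.
have mxy : Num.max c x <= Num.max c y by rewrite ge_max !le_max lexx xy orbT.
have cx : c <= Num.max c x by rewrite le_max lexx.
have fTV (u v : R) : u <= v -> total_variation u v f \is a fin_num.
  by move=> uv; rewrite ge0_fin_numE ?total_variation_ge0// real_ac_total_variation_lty.
rewrite (@total_variationD _ _ _ (Num.max c x) f)// fineD ?fTV//.
by rewrite addrAC subrr add0r fineK// fTV.
Qed.

Lemma real_ac_variation_from c f : real_ac setT f -> real_ac setT (variation_from c f).
Proof.
move=> acf eps eps0.
have e20 : 0 < eps / 2 by rewrite divr_gt0.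
have [d d0 fd] := acf _ e20; exists d => // s s1 s2 s3.
have mle := max_contraction c.
apply: (@le_lt_trans _ _ (eps / 2)); last by lra.
rewrite -lee_fin.
have := @real_ac_total_variation_sum f (eps / 2) d _
  [seq (Num.max c i.1, Num.max c i.2) | i <- s] [::].
have -> : (\sum_(i <- s) `|variation_from c f i.2 - variation_from c f i.1|)%:E =
   (\sum_(i <- [seq (Num.max c i.1, Num.max c i.2) | i <- s]) total_variation i.1 i.2 f)%E.
  rewrite big_map -sumEFin big_seq [RHS]big_seq; apply: eq_bigr => i /s1[i12 _ _].
  rewrite -variation_fromB// ger0_norm// -lee_fin variation_fromB//.
  by apply: total_variation_ge0; have /andP[] := mle _ _ i12; rewrite subr_ge0.
rewrite big_nil add0e; apply.
- by move=> l l1 l2 l3; apply: fd => // i /l1.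
- by move=> i /mapP[j /s1[j12 _ _] ->]/=; have /andP[] := mle _ _ j12; rewrite subr_ge0.
- rewrite pairwise_map; apply: sub_pairwise s2 => i j /= /orP[|] ij.
    by have /andP[] := mle _ _ ij; rewrite subr_ge0 => ->.
  by have /andP[] := mle _ _ ij; rewrite subr_ge0 => -> _; rewrite orbT.
- rewrite big_map/=; apply: le_lt_trans s3; rewrite big_seq [leRHS]big_seq; apply: ler_sum => i si.
  by have [i12 _ _] := s1 _ si; have /andP[] := mle _ _ i12.
Qed.

Lemma variation_from_ge c f x y : real_ac setT f -> x <= y ->
  `|f (Num.max c y) - f (Num.max c x)| <= variation_from c f y - variation_from c f x.
Proof.
move=> acf xy; rewrite -lee_fin variation_fromB//; apply: total_variation_ge.
by rewrite ge_max !le_max lexx xy orbT.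
Qed.

End real_absolute_continuity.

(** * Densities of absolutely continuous functions *)

Section stieltjes_density.
Context {R : realType}.
Notation leb := (@lebesgue_measure R).
Implicit Types (f : R -> R).

Lemma real_ac_continuous f : real_ac setT f -> continuous f.
Proof.
move=> acf x; apply/cvgrPdist_lt => e e0; have [d d0 H] := acf _ e0.
near=> y.
have dxy : `|x - y| < d by near: y; exact: cvgr_dist_lt.
have [xy|/ltW xy] := leP x y.
  have := H [:: (x, y)]; rewrite !big_seq1/= distrC; apply => //.
    by move=> i; rewrite inE => /eqP ->.
  by rewrite (le_lt_trans _ dxy)// distrC ler_norm.
have := H [:: (y, x)]; rewrite !big_seq1/=; apply => //.
  by move=> i; rewrite inE => /eqP ->.
by rewrite (le_lt_trans _ dxy)// ler_norm.
Unshelve. all: by end_near. Qed.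

Lemma open_interval_itv (I : set R) : open I -> is_interval I -> I !=set0 ->
  has_lbound I -> has_ubound I -> I = `]inf I, sup I[%classic /\ inf I < sup I.
Proof.
move=> oI iI [z Iz] lI uI.
have E : I = `]inf I, sup I[%classic.
  by rewrite -interval_bounded_interior//; exact/esym/interior_id.
split=> //; move: Iz; rewrite {1}E/= in_itv/= => /andP[]; exact: lt_trans.
Qed.

Section stieltjes.
Variable G : R -> R.
Hypothesis (Gnd : {homo G : x y / x <= y}) (acG : real_ac setT G).

Let Grc : right_continuous G.
Proof. by apply: right_continuousW; exact: real_ac_continuous. Qed.

HB.instance Definition _ := isCumulative.Build R _ R G Gnd Grc.

Local Notation muG := (lebesgue_stieltjes_measure G).

Lemma stieltjes_itv x y : x <= y -> muG `]x, y] = (G y - G x)%:E.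
Proof.
move=> xy; rewrite /lebesgue_stieltjes_measure /measure_extension/= measurable_mu_extE/=; last first.
  exact: is_ocitv.
by rewrite wlength_itv_bnd.
Qed.

(** By outer regularity a Lebesgue-null set lies in an open set of length less than [del]. The
    components of that set are disjoint intervals, and absolute continuity bounds the sum of the
    increments of [G] over any finitely many of them by [e]. *)
Lemma stieltjes_null (A : set R) (c d : R) : measurable A -> A `<=` `]c, d]%classic ->
  leb A = 0 -> muG A = 0.
Proof.
move=> mA Acd A0; apply/eqP; rewrite eq_le measure_ge0 andbT.
apply/lee_addgt0Pr => e e0; rewrite add0e.
have [del del0 H] := acG e0.
have Ay : (leb A < +oo)%E by rewrite A0 ltry.
have [U [oU AU Udel]] := @lebesgue_regularity_outer R A del mA Ay del0.
(* Cutting [U] down makes its components bounded, so that [inf] and [sup] are their endpoints. *)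
pose V := U `&` `]c - 1, d + 1[%classic.
have oV : open V by apply: openI => //; exact: interval_open.
have mV : measurable (V : set (measurableTypeR R)) by exact: open_measurable.
have Vdel : (leb V < del%:E)%E.
  apply: (@le_lt_trans _ _ (leb (A `|` (U `\` A)))).
    rewrite le_measure ?inE//.
      by apply: measurableU => //; apply: measurableD => //; exact: open_measurable.
    by move=> x [Ux _]; have [Ax|Ax] := pselect (A x); [left|right].
  rewrite (le_lt_trans (measureU2 _ _ _))//; first by apply: measurableD => //; exact: open_measurable.
  by move: A0 Udel => /= ->; rewrite add0e.
pose I := open_disjoint_itv oV.
have oI n : open (I n) by exact: open_disjoint_itv_open.
have iI n : is_interval (I n) by move=> x y Ix Iy z; exact: (open_disjoint_itv_is_interval Ix Iy).
have VE : V = \bigcup_n I n by exact: open_disjoint_itv_bigcup.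
have IV n : I n `<=` V by rewrite VE; exact: bigcup_sup.
have mI n : measurable (I n : set (measurableTypeR R)) by exact: open_measurable.
have IE n : I n !=set0 -> I n = `]inf (I n), sup (I n)[%classic /\ inf (I n) < sup (I n).
  move=> In0; apply: open_interval_itv => //.
    by exists (c - 1) => x /IV[_]/=; rewrite in_itv/= => /andP[/ltW].
  by exists (d + 1) => x /IV[_]/=; rewrite in_itv/= => /andP[_ /ltW].
have sumI (mu : {measure set (measurableTypeR R) -> \bar R}) :
    mu V = (\sum_(0 <= i <oo) mu (I i))%E.
  rewrite VE measure_semi_bigcup//; first exact: open_disjoint_itv_trivIset.
  by rewrite -VE.
apply: (@le_trans _ _ (muG V)).
  rewrite le_measure ?inE// => x Ax; split; first exact: AU.
  by move: (Acd _ Ax); rewrite /= !in_itv/= => /andP[]; lra.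
rewrite sumI; apply: lime_le; first by apply: is_cvg_nneseries => *; exact: measure_ge0.
near=> n.
(* Empty members of the enumeration are dropped, as [inf] and [sup] are meaningless for them. *)
pose s := [seq (inf (I k), sup (I k)) | k <- index_iota 0 n & `[< I k !=set0 >]].
apply: (@le_trans _ _ (\sum_(i <- s) `|G i.2 - G i.1|)%:E); last first.
  rewrite lee_fin ltW//; apply: H.
  - by move=> i /mapP[k]; rewrite mem_filter => /andP[/asboolP /IE[_ /ltW ik] _ ->].
  - rewrite pairwise_map; apply: (@sub_in_pairwise _ (fun k => `[< I k !=set0 >]) (fun k l => k != l)).
    + move=> k l /asboolP Ik0 /asboolP Il0 kl /=; rewrite leNgt leNgt -negb_and; apply/negP => /andP[kl1 kl2].
      have [IkE ik] := IE _ Ik0; have [IlE il] := IE _ Il0.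
      pose m := Num.max (inf (I k)) (inf (I l)); pose M := Num.min (sup (I k)) (sup (I l)).
      have mM : m < M by rewrite lt_min !gt_max ik il kl1 kl2.
      have : I k `&` I l !=set0.
        exists ((m + M) / 2); split.
          rewrite IkE/= in_itv/=.
          have : inf (I k) <= m by rewrite le_max lexx.
          by have : M <= sup (I k); [rewrite ge_min lexx|move=> *; apply/andP; split; lra].
        rewrite IlE/= in_itv/=.
        have : inf (I l) <= m by rewrite le_max lexx orbT.
        by have : M <= sup (I l); [rewrite ge_min lexx orbT|move=> *; apply/andP; split; lra].
      by move=> /(open_disjoint_itv_trivIset Logic.I Logic.I)/eqP; rewrite (negPf kl).
    + by apply/allP => k; rewrite mem_filter => /andP[].
    + by rewrite -uniq_pairwise filter_uniq// iota_uniq.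
  - rewrite -lte_fin; apply: le_lt_trans Vdel; rewrite sumI.
    rewrite big_map big_filter -sumEFin big_mkcond/=.
    apply: le_trans (nneseries_lim_ge n _); last by move=> *; exact: measure_ge0.
    rewrite big_mkord [leRHS]big_mkord; apply: lee_sum => k _.
    case: ifPn => [/asboolP /IE[IkE ik]|_]; last exact: measure_ge0.
    by rewrite [in leRHS]IkE lebesgue_measure_itv/= lte_fin ik EFinB.
rewrite big_map big_filter -sumEFin [leRHS]big_mkcond/=.
rewrite big_mkord [leRHS]big_mkord; apply: lee_sum => k _.
case: ifPn => [/asboolP /IE[IkE ik]|/asboolP Ik0]; last first.
  suff -> : I k = set0 by rewrite measure0.
  by apply/nonemptyPn.
rewrite ger0_norm ?subr_ge0 ?(Gnd (ltW ik))// -(stieltjes_itv (ltW ik)).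
rewrite le_measure ?inE//.
by rewrite {1}IkE => x /=; rewrite !in_itv/= => /andP[-> /ltW].
Unshelve. all: by end_near. Qed.

(** The Stieltjes measure is restricted to []c, d]] to make it finite for Radon-Nikodym; its
    absolute continuity is [stieltjes_null]. *)
Lemma nondecreasing_ac_density c d : c <= d -> exists2 g : R -> R,
  leb.-integrable setT (EFin \o g) &
  forall s t, c <= s -> s <= t -> t <= d -> G t - G s = \int[leb]_(x in `[s, t]) g x.
Proof.
move=> cd.
have mcd : measurable (`]c, d]%classic : set (measurableTypeR R)) by exact: measurable_itv.
have muGcd : (muG `]c, d]%classic < +oo)%E by rewrite stieltjes_itv// ltry.
pose nu := mfrestr mcd muGcd.
have nuleb : nu `<< leb.
  apply/null_content_dominatesP => A mA A0; rewrite /nu /mfrestr /mrestr.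
  apply: (@stieltjes_null _ c d); [exact: measurableI|exact: subIsetr|].
  by apply/eqP; rewrite eq_le measure_ge0 andbT -A0 le_measure ?inE//; exact: measurableI.
pose h := Radon_Nikodym_SigmaFinite.f nu leb.
have ih : leb.-integrable setT h by exact: Radon_Nikodym_SigmaFinite.f_integrable.
have hE : EFin \o (fine \o h) = h.
  apply/funext => x /=; rewrite fineK//.
  exact: Radon_Nikodym_SigmaFinite.f_fin_num.
exists (fine \o h); first by rewrite hE.
move=> s t cs st td; rewrite /Rintegral.
rewrite -integral_itv_obnd_cbnd; last first.
  rewrite -/(EFin \o (fine \o h)) hE.
  by apply: measurable_funS (measurable_int leb ih).
rewrite -/(EFin \o (fine \o h)) hE.
rewrite -Radon_Nikodym_SigmaFinite.f_integral//.
transitivity (fine (muG (`]s, t]%classic `&` `]c, d]%classic))); last by [].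
rewrite setIidl ?stieltjes_itv// => x /=; rewrite !in_itv/= => /andP[sx xt].
by rewrite (le_lt_trans cs sx) (le_trans xt td).
Qed.

End stieltjes.

(* Monotone AC functions have densities by Radon-Nikodym; a general AC function is the
   difference of the two monotone AC functions [V + f] and [V], [V] its variation. *)
Lemma real_ac_density f c d : c <= d -> real_ac `[c, d] f -> exists2 g : R -> R,
  leb.-integrable setT (EFin \o g) &
  forall s t, c <= s -> s <= t -> t <= d -> f t - f s = \int[leb]_(x in `[s, t]) g x.
Proof.
move=> cd acf.
pose k t : R := Num.max c (Num.min t d); pose F := f \o k.
have acF : real_ac setT F by exact: real_ac_clamp.
pose V := variation_from c F.
have acV : real_ac setT V by exact: real_ac_variation_from.
have kE t : c <= t -> t <= d -> k t = t.
  by move=> ct td; rewrite /k (min_idPl td) (max_idPr ct).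
have Fmax t : F (Num.max c t) = F t.
  congr f; rewrite /k /Num.max /Num.min.
  by repeat case: ifPn => //; rewrite -?leNgt => *; lra.
have Vge x y : x <= y -> `|F y - F x| <= V y - V x.
  by move=> xy; have := variation_from_ge c acF xy; rewrite !Fmax.
have ndV : {homo V : x y / x <= y}.
  by move=> x y /Vge h; rewrite -subr_ge0 (le_trans _ h).
have ndVF : {homo (V \+ F) : x y / x <= y}.
  move=> x y /Vge; rewrite -normrN => /(le_trans (ler_norm _)) /=; lra.
have acVF : real_ac setT (V \+ F).
  move=> e e0; have e20 : 0 < e / 2 by rewrite divr_gt0.
  have [d1 d10 H1] := acV _ e20; have [d2 d20 H2] := acF _ e20.
  exists (Num.min d1 d2); first by rewrite lt_min d10.
  move=> s s1 s2; rewrite lt_min => /andP[s3 s4].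
  have := H1 _ s1 s2 s3; have := H2 _ s1 s2 s4 => h2 h1.
  apply: (@le_lt_trans _ _ (\sum_(i <- s) (`|V i.2 - V i.1| + `|F i.2 - F i.1|))).
    apply: ler_sum => i _ /=; rewrite opprD addrACA; exact: ler_normD.
  by rewrite big_split/=; lra.
have [g1 ig1 g1E] := nondecreasing_ac_density ndVF acVF cd.
have [g2 ig2 g2E] := nondecreasing_ac_density ndV acV cd.
exists (g1 \- g2).
  by have := @integrableB _ _ _ leb setT measurableT _ _ ig1 ig2.
move=> s t cs st td.
have int (g : R -> R) : leb.-integrable setT (EFin \o g) -> leb.-integrable `[s, t] (EFin \o g).
  by apply: integrableS.
rewrite RintegralB//; [|exact: int..].
rewrite -g1E// -g2E//= /F /= !kE//; [lra|exact: le_trans td|exact: le_trans st].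
Qed.

End stieltjes_density.

(** * Measurability of the derivative *)

Section derive1_measurable.
Context {R : realType}.
Implicit Types (f : R -> R).

Lemma derivable1E f t :
  derivable f t 1 <-> cvg (h^-1 *: (f (h + t) - f t) @[h --> 0^']).
Proof.
rewrite /derivable; suff -> : (fun h : R => h^-1 *: ((f \o shift t) (h *: 1) - f t)) =
  (fun h : R => h^-1 *: (f (h + t) - f t)) by [].
by apply/funext => h /=; rewrite -[h *: 1]/(h * 1) mulr1.
Qed.

Let quot f (h t : R) : R := h^-1 * (f (h + t) - f t).

Let small (n : nat) (h : R) : Prop := h != 0 /\ `|h| < n.+1%:R^-1.

Let osc f (k n : nat) : set R :=
  [set t | forall h h', small n h -> small n h' -> `|quot f h t - quot f h' t| <= k.+1%:R^-1].

Let quot_cont f h : continuous f -> continuous (quot f h).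
Proof.
move=> cf t; apply: cvgM; first exact: cvg_cst.
apply: cvgB; last exact: cf.
by apply: continuous_comp; [apply: cvgD; [exact: cvg_cst|exact: cvg_id]|exact: cf].
Qed.

Let closed_osc f k n : continuous f -> closed (osc f k n).
Proof.
move=> cf.
have -> : osc f k n = \bigcap_(hh in [set hh : R * R | small n hh.1 /\ small n hh.2])
    ((fun t => `|quot f hh.1 t - quot f hh.2 t|) @^-1` [set x | x <= k.+1%:R^-1]).
  apply/seteqP; split => t /=.
    by move=> H [h h'] /= [sh sh']; exact: H.
  by move=> H h h' sh sh'; exact: (H (h, h')).
apply: closed_bigI => -[h h'] _ /=; apply: preimage_closed; last exact: closed_le.
by move=> t _; apply: cvg_norm; apply: cvgB; exact: quot_cont.
Qed.

(* The set of points of differentiability of a continuous function is an intersection of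
   countable unions of closed sets (Cauchy criterion for the difference quotients). *)
Let derivable_oscE f t :
  derivable f t 1 <-> (\bigcap_k \bigcup_n osc f k n) t.
Proof.
rewrite derivable1E -(cauchy_cvgP (h^-1 *: (f (h + t) - f t) @[h --> 0^'])) cauchyP; split.
  move=> H k _; have [|x] := H (k.+1%:R^-1 / 2); first by rewrite divr_gt0// invr_gt0.
  move=> -[d /= d0 Hd].
  have [n nd] : exists n : nat, n.+1%:R^-1 < d.
    by have [n _ /(_ _ (leqnn n)) hn] := near_infty_natSinv_lt (PosNum d0); exists n.
  exists n => // h h' [h0 hn] [h'0 h'n].
  have Hx z : z != 0 -> `|z| < n.+1%:R^-1 -> `|x - quot f z t| < k.+1%:R^-1 / 2.
    by move=> z0 zn; apply: Hd => //=; rewrite sub0r normrN (lt_trans zn).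
  have := Hx _ h0 hn; have := Hx _ h'0 h'n; rewrite ltr_distlC ltr_distlC.
  have dist3 (y u v e : R) : y - e / 2 < v < y + e / 2 -> y - e / 2 < u < y + e / 2 -> `|u - v| <= e.
    by move=> /andP[A1 A2] /andP[A3 A4]; rewrite ler_norml; apply/andP; split; lra.
  exact: dist3.
move=> H e e0.
have [k _ /(_ _ (leqnn k)) /= ke] := near_infty_natSinv_lt (PosNum e0).
have [n _ Hn] := H k Logic.I.
pose h := n.+1%:R^-1 / 2 : R.
have hS : small n h.
  have n0 : 0 < n.+1%:R^-1 :> R by rewrite invr_gt0.
  have h0 : 0 < h by rewrite divr_gt0.
  split; first by rewrite gt_eqF.
  by rewrite gtr0_norm// ltr_pdivrMr// ltr_pMr// ltr1n.
exists (quot f h t); exists n.+1%:R^-1; rewrite /= ?invr_gt0//.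
move=> z /=; rewrite sub0r normrN => zn z0.
by rewrite /ball/=; apply: le_lt_trans ke; apply: Hn.
Qed.

(** On the measurable set [D] of points of differentiability the derivative is the limit of
    difference quotients; off [D] it is the dummy value [point]. The functions [q n] follow both
    cases, so they converge to [derive1 f] everywhere. *)
Lemma continuous_measurable_derive1 f : continuous f ->
  measurable_fun setT (derive1 f).
Proof.
move=> cf; set D := \bigcap_k \bigcup_n osc f k n.
have mD : measurable D.
  apply: bigcapT_measurable => k; apply: bigcupT_measurable => n.
  by apply: closed_measurable; exact: closed_osc.
pose pt : R := point.
pose q n (t : R) : R := quot f n.+1%:R^-1 t * \1_D t + pt * (1 - \1_D t).
apply: (@measurable_fun_cvg _ _ _ _ q) => [n|t _].
  apply: measurable_funD; apply: measurable_funM => //.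
    by apply: continuous_measurable_fun; exact: quot_cont.
  exact: measurable_funB.
have [Dt|Dt] := pselect (D t); last first.
  have -> : q ^~ t = cst pt.
    by apply/funext => n; rewrite /q indicE memNset// mulr0 add0r subr0 mulr1.
  suff -> : derive1 f t = pt by exact: cvg_cst.
  apply: (@dvgP R) => dt; apply: Dt.
  by apply: (proj1 (derivable_oscE f t)); apply: (proj2 (derivable1E f t)).
have -> : q ^~ t = fun n => quot f n.+1%:R^-1 t.
  by apply/funext => n; rewrite /q indicE mem_set// mulr1 subrr mulr0 addr0.
have dt := proj1 (derivable1E f t) (proj2 (derivable_oscE f t) Dt).
apply: (@cvg_comp _ _ _ (fun n : nat => n.+1%:R^-1 : R) (fun h => quot f h t) _ (0^')) => //.
move=> A -[e /= e0 He].
have [n _ Hn] := near_infty_natSinv_lt (PosNum e0).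
exists n => // k nk; apply: He; rewrite /= ?gt_eqF//.
by rewrite /ball/= sub0r normrN gtr0_norm//; exact: Hn.
Qed.

End derive1_measurable.

(** * Integrals over intervals *)

Lemma near_shift_derive (R : realType) (F f : R -> R) (K t : R) : derivable F t 1 ->
  {near t, (F \+ cst K) =1 f} -> derivable f t 1 /\ derive1 f t = derive1 F t.
Proof.
move=> dF fF.
have dK : derivable (F \+ cst K) t 1.
  exact: (@derivableD R R R F (cst K) t 1 dF (derivable_cst _ _ _)).
split; first exact: near_eq_derivable fF dK.
rewrite !derive1E.
have <- : 'D_1 (F \+ cst K) t = 'D_1 f t by exact: near_eq_derive.
have -> : 'D_1 (F \+ cst K) t = 'D_1 F t + 'D_1 (cst K) t.
  exact: (@deriveD R R R F (cst K) t 1 dF (derivable_cst _ _ _)).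
by rewrite derive_cst addr0.
Qed.

Section interval_integral.
Context {R : realType} (a b : R).
Notation leb := (@lebesgue_measure R).
Implicit Types (f g : R -> R).

Lemma leb_aeS (P Q : R -> Prop) : (forall x, P x -> Q x) ->
  {ae leb, forall x, P x} -> {ae leb, forall x, Q x}.
Proof. by move=> PQ; apply: filterS => //; exact: (ae_filter_ringOfSetsType leb). Qed.

Lemma leb_aeI (P Q : R -> Prop) : {ae leb, forall x, P x} -> {ae leb, forall x, Q x} ->
  {ae leb, forall x, P x /\ Q x}.
Proof. by move=> p q; apply: filterI => //; exact: (ae_filter_ringOfSetsType leb). Qed.

Lemma leb_itvoo (s t : R) : leb `]s, t[%classic = (Num.max 0 (t - s))%:E.
Proof.
have /= -> := @lebesgue_measure_itv R `]s, t[; rewrite lte_fin.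
case: ltP => st; first by rewrite -EFinB max_r// subr_ge0 ltW.
by rewrite max_l// subr_le0.
Qed.

Lemma leb_itvoo_lty (s t : R) : (leb `]s, t[%classic < +oo)%E.
Proof. by rewrite leb_itvoo ltry. Qed.

Definition integ f (s t : R) : R := \int[leb]_(x in `]s, t[) f x.

Lemma integrable_measurable f (s t : R) : leb.-integrable `]s, t[ (EFin \o f) ->
  measurable_fun `]s, t[ f.
Proof. by move=> /(measurable_int leb) /measurable_EFinP. Qed.

Lemma integrable_sub f s t : leb.-integrable `]a, b[ (EFin \o f) ->
  a <= s -> t <= b -> leb.-integrable `]s, t[ (EFin \o f).
Proof.
move=> intf as_ tb; apply: integrableS intf => //.
by move=> x /=; rewrite !in_itv/= => /andP[sx xt]; rewrite (le_lt_trans as_ sx) (lt_le_trans xt tb).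
Qed.

Lemma integrable_integ_cc f s t : leb.-integrable `]s, t[ (EFin \o f) ->
  integ f s t = \int[leb]_(x in `[s, t]) f x.
Proof.
by move=> /(measurable_int leb) mf; rewrite /integ /Rintegral [in RHS]integral_itv_bndoo.
Qed.

Lemma integ_eq f g s t : {in `]s, t[, f =1 g} -> integ f s t = integ g s t.
Proof. by move=> fg; apply: eq_Rintegral => x; rewrite inE => /fg. Qed.

Lemma integ_ge f s t : t <= s -> integ f s t = 0.
Proof.
by move=> ts; rewrite /integ set_itv_ge ?Rintegral_set0// bnd_simp -leNgt.
Qed.

Lemma integ_cat f r s t : leb.-integrable `]r, t[ (EFin \o f) -> r <= s -> s <= t ->
  integ f r t = integ f r s + integ f s t.
Proof.
move=> intf rs st.
have [rE|rNs] := eqVneq r s; first by rewrite rE [X in _ = X + _]integ_ge// add0r.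
have [sE|sNt] := eqVneq s t; first by rewrite -sE [X in _ = _ + X]integ_ge// addr0.
have rs' : r < s by rewrite lt_neqAle rNs.
have st' : s < t by rewrite lt_neqAle sNt.
have int_rs : leb.-integrable `]r, s[ (EFin \o f).
  apply: integrableS intf => // x /=; rewrite !in_itv/= => /andP[-> xs].
  exact: lt_trans st'.
have := @Rintegral_itvB R f (BRight r) (BLeft t) s intf.
rewrite !bnd_simp => /(_ rs st') E.
by rewrite /integ -E (Rintegral_itv_bndo_bndc int_rs) addrC subrK.
Qed.

Lemma integrable_normr f s t : leb.-integrable `]s, t[ (EFin \o f) ->
  leb.-integrable `]s, t[ (EFin \o (fun x => `|f x|)).
Proof. by move=> /integrable_norm. Qed.

Lemma integ_le_norm f s t : leb.-integrable `]s, t[ (EFin \o f) ->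
  `|integ f s t| <= integ (fun x => `|f x|) s t.
Proof. by move=> intf; apply: le_normr_Rintegral. Qed.

Lemma integ_le f g s t : leb.-integrable `]s, t[ (EFin \o f) ->
  leb.-integrable `]s, t[ (EFin \o g) ->
  (forall x, s < x -> x < t -> f x <= g x) -> integ f s t <= integ g s t.
Proof.
move=> intf intg fg; apply: le_Rintegral => // x /=.
by rewrite in_itv/= => /andP[]; exact: fg.
Qed.

Lemma integ_ge0 f s t : (forall x, s < x -> x < t -> 0 <= f x) -> 0 <= integ f s t.
Proof.
by move=> f0; apply: Rintegral_ge0 => x /=; rewrite in_itv/= => /andP[]; exact: f0.
Qed.

Lemma integD f g s t : leb.-integrable `]s, t[ (EFin \o f) ->
  leb.-integrable `]s, t[ (EFin \o g) ->
  integ (fun x => f x + g x) s t = integ f s t + integ g s t.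
Proof. by move=> intf intg; rewrite /integ RintegralD. Qed.

Lemma integB f g s t : leb.-integrable `]s, t[ (EFin \o f) ->
  leb.-integrable `]s, t[ (EFin \o g) ->
  integ (fun x => f x - g x) s t = integ f s t - integ g s t.
Proof. by move=> intf intg; rewrite /integ RintegralB. Qed.

Lemma integZ f s t k : leb.-integrable `]s, t[ (EFin \o f) ->
  integ (fun x => k * f x) s t = k * integ f s t.
Proof. by move=> intf; rewrite /integ RintegralZl. Qed.

Lemma integ_cst s t k : s <= t -> integ (fun=> k) s t = k * (t - s).
Proof.
move=> st; rewrite /integ Rintegral_cst//; congr (_ * _).
have /= -> := @leb_itvoo s t.
by rewrite max_r// subr_ge0.
Qed.

Lemma integ_ae_eq f g (s t : R) : measurable_fun `]s, t[ f -> measurable_fun `]s, t[ g ->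
  {ae leb, forall x, x \in `]s, t[ -> f x = g x} -> integ f s t = integ g s t.
Proof.
move=> mf mg fg; congr fine; apply: ae_eq_integral => //.
- exact/measurable_EFinP.
- exact/measurable_EFinP.
by apply: leb_aeS fg => x /= fgx xst; rewrite fgx.
Qed.

Lemma integrableD' f g s t : leb.-integrable `]s, t[ (EFin \o f) ->
  leb.-integrable `]s, t[ (EFin \o g) ->
  leb.-integrable `]s, t[ (EFin \o (fun x => f x + g x)).
Proof.
move=> intf intg; have := @integrableD _ _ _ leb `]s, t[%classic (measurable_itv _) _ _ intf intg.
by apply: eq_integrable.
Qed.

Lemma integrableZ' f s t k : leb.-integrable `]s, t[ (EFin \o f) ->
  leb.-integrable `]s, t[ (EFin \o (fun x => k * f x)).
Proof.
move=> intf; have := @integrableZl _ _ _ leb `]s, t[%classic (measurable_itv _) k _ intf.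
by apply: eq_integrable.
Qed.

Lemma integrable_bounded f (s t K : R) : measurable_fun `]s, t[ f ->
  (forall x, x \in `]s, t[ -> `|f x| <= K) -> leb.-integrable `]s, t[ (EFin \o f).
Proof.
move=> mf fK; apply: measurable_bounded_integrable => //.
  exact: leb_itvoo_lty.
exists K; split; first exact: num_real.
by move=> x Kx y /= /fK /le_trans; apply; exact: ltW.
Qed.

Let restr f := f \_ `]a, b[.

Let integ_restr f s t : a <= s -> t <= b -> integ (restr f) s t = integ f s t.
Proof.
move=> as_ tb; apply: integ_eq => x; rewrite in_itv/= => /andP[sx xt].
rewrite /restr patchE mem_set//= in_itv/= (le_lt_trans as_ sx).
exact: lt_le_trans tb.
Qed.

Let integrable_restr f : leb.-integrable `]a, b[ (EFin \o f) ->
  leb.-integrable setT (EFin \o restr f).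
Proof.
move=> /integrable_mkcond -/(_ (measurable_itv _)).
by rewrite restrict_EFin.
Qed.

Let near_oo t : t \in `]a, b[ -> \forall x \near t, x \in `]a, b[.
Proof. by move=> tab; apply: near_in_itvoo. Qed.

(** Extended by 0, [g] is integrable on the line and Lebesgue's differentiation theorem applies to
    its primitive, from which [f] differs by a constant near each interior point. *)
Lemma ftc_ae f g K : leb.-integrable `]a, b[ (EFin \o g) ->
  (forall t, t \in `]a, b[ -> f t = K + integ g a t) ->
  {ae leb, forall t, t \in `]a, b[ -> derivable f t 1 /\ derive1 f t = g t}.
Proof.
move=> intg fE; have irg := integrable_restr intg.
have loc : locally_integrable setT (restr g).
  by apply: open_integrable_locally irg; exact: openT.
have i1 y : leb.-integrable [set` Interval (BLeft a) (BRight y)] (EFin \o restr g).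
  by apply: integrableS irg.
apply: leb_aeS (@FTC1 R (restr g) (BLeft a) i1 loc) => t Ft tab; have /andP[ta tb] : a < t < b by move: tab; rewrite in_itv.
have [dF FE] := Ft ta.
set F := fun x => _ in dF FE.
have fF : {near t, (F \+ cst K) =1 f}.
  near=> x; have xab : x \in `]a, b[ by near: x; exact: near_oo.
  have /andP[xa xb] : a < x < b by move: xab; rewrite in_itv.
  rewrite fE//= addrC /F -integrable_integ_cc ?integ_restr//; first exact: ltW.
  by apply: integrableS irg.
have [df dfE] := near_shift_derive dF fF.
by split=> //; rewrite dfE FE /restr patchE mem_set.
Unshelve. all: by end_near. Qed.

(** The pointwise version is indispensable: Sobolev functions of order above 1 must be
    differentiable at every interior point, and for [n >= 1] the equation is required everywhere. *)
Lemma ftc_continuous f g K : leb.-integrable `]a, b[ (EFin \o g) ->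
  (forall t, t \in `]a, b[ -> f t = K + integ g a t) ->
  forall t, t \in `]a, b[ -> {for t, continuous g} -> derivable f t 1 /\ derive1 f t = g t.
Proof.
move=> intg fE t tab ctg; have irg := integrable_restr intg.
have /andP[ta tb] : a < t < b by move: tab; rewrite in_itv.
have tt1 : t < t + 1 by rewrite ltrDl.
have i1 : leb.-integrable [set` Interval (BLeft a) (BRight (t + 1))] (EFin \o restr g).
  by apply: integrableS irg.
have crg : {for t, continuous (restr g)}.
  rewrite /prop_for /continuous_at; have -> : restr g t = g t by rewrite /restr patchE mem_set.
  apply: cvg_trans ctg; apply: near_eq_cvg; near=> x.
  by rewrite /restr patchE mem_set//; near: x; exact: near_oo.
have [dF FE] := @continuous_FTC1 R (restr g) (BLeft a) t (t + 1) tt1 i1 ta crg.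
set F := fun x => _ in dF FE.
have fF : {near t, (F \+ cst K) =1 f}.
  near=> x; have xab : x \in `]a, b[ by near: x; exact: near_oo.
  have /andP[xa xb] : a < x < b by move: xab; rewrite in_itv.
  rewrite fE//= addrC /F -integrable_integ_cc ?integ_restr//; first exact: ltW.
  by apply: integrableS irg.
have [df dfE] := near_shift_derive dF fF.
by split=> //; rewrite dfE FE /restr patchE mem_set.
Unshelve. all: by end_near. Qed.

(** The sum is the integral over the union of the open intervals, whose measure is small; absolute
    continuity of the integral does the rest. With one interval this yields continuity of the
    primitive, with families its absolute continuity. *)
Lemma integ_small f : leb.-integrable `]a, b[ (EFin \o f) ->
  forall eps, 0 < eps -> exists2 delta : R, 0 < delta &
    forall s : seq (R * R),
      (forall i, i \in s -> [/\ i.1 <= i.2, a <= i.1 & i.2 <= b]) ->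
      pairwise (fun i j => (i.2 <= j.1) || (j.2 <= i.1)) s ->
      \sum_(i <- s) (i.2 - i.1) < delta ->
      \sum_(i <- s) integ (fun x => `|f x|) i.1 i.2 < eps.
Proof.
move=> intf eps eps0.
have irf := integrable_restr intf.
have [d [d0 Hd]] := integral_normr_continuous irf eps0.
exists d => // s sab ap sd.
pose U (s : seq (R * R)) : set R := \big[setU/set0]_(i <- s) `]i.1, i.2[%classic.
have mU s' : measurable (U s' : set (measurableTypeR R)) by apply: bigsetU_measurable.
have leU : (leb (U s) < d%:E)%E.
  apply: (@le_lt_trans _ _ (\sum_(i <- s) leb `]i.1, i.2[%classic)%E).
    rewrite /U; elim: (s) => [|i s' IH]; first by rewrite !big_nil measure0.
    rewrite !big_cons; apply: le_trans (leeD2l _ IH).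
    by apply: measureU2 => //; exact: mU.
  rewrite (eq_bigr (fun i => (Num.max 0 (i.2 - i.1))%:E)); last first.
    by move=> i _; exact: leb_itvoo.
  rewrite sumEFin lte_fin; apply: le_lt_trans sd.
  rewrite big_seq [leRHS]big_seq; apply: ler_sum => i /sab[i12 _ _].
  by rewrite max_r// subr_ge0.
apply: le_lt_trans (Hd _ (mU s) leU).
have : forall i, i \in s -> [/\ i.1 <= i.2, a <= i.1 & i.2 <= b] by [].
have : pairwise (fun i j => (i.2 <= j.1) || (j.2 <= i.1)) s by [].
elim: (s) => [|i s' IH] /=.
  by move=> _ _; rewrite /U !big_nil Rintegral_set0.
move=> /andP[/allP ais' aps'] sabs'.
rewrite /U !big_cons Rintegral_setU//=.
- have [i12 ai ib] := sabs' i (mem_head _ _).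
  apply: lerD.
    rewrite -/(integ _ i.1 i.2) le_eqVlt; apply/orP; left; apply/eqP.
    apply: integ_eq => x; rewrite in_itv/= => /andP[sx xt].
    rewrite /restr patchE mem_set//= in_itv/= (le_lt_trans ai sx).
    exact: lt_le_trans ib.
  by apply: IH => // j js; apply: sabs'; rewrite inE js orbT.
- exact: mU.
- have := integrable_norm irf; apply: integrableS => //.
  by apply: measurableU => //; exact: mU.
- apply/disj_setPS => x [/=]; rewrite in_itv/= => /andP[ix xi].
  rewrite big_seq; elim/big_ind : _ => //.
    by move=> A B HA HB [/HA|/HB].
  move=> j js; rewrite /= in_itv/= => /andP[jx xj].
  have /orP[] := ais' _ js; lra.
Qed.

Lemma integ_dist_small f : leb.-integrable `]a, b[ (EFin \o f) ->
  forall eps, 0 < eps -> exists2 delta : R, 0 < delta &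
    forall s t, a <= s -> s <= t -> t <= b -> t - s < delta -> `|integ f s t| < eps.
Proof.
move=> intf eps eps0; have [d d0 Hd] := integ_small intf eps0.
exists d => // s t as_ st tb std.
apply: le_lt_trans (integ_le_norm _) _; first exact: integrable_sub.
have := Hd [:: (s, t)]; rewrite !big_seq1/=; apply => //.
by move=> i; rewrite inE => /eqP ->.
Qed.

Lemma within_itv_continuousP f : {within `[a, b], continuous f} <->
  forall x, x \in `[a, b] -> forall eps, 0 < eps -> exists2 delta : R, 0 < delta &
    forall y, y \in `[a, b] -> `|x - y| < delta -> `|f x - f y| < eps.
Proof.
rewrite subspace_continuousP; split.
  move=> cf x xab eps eps0; have /cvgrPdist_lt/(_ _ eps0)[d /= d0 Hd] := cf x xab.
  by exists d => // y yab xy; apply: Hd.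
move=> cf x xab; apply/cvgrPdist_lt => eps eps0; have [d d0 Hd] := cf x xab eps eps0.
by exists d => //= y xy yab; apply: Hd.
Qed.

Lemma integ_within_continuous f g K : leb.-integrable `]a, b[ (EFin \o g) ->
  (forall t, t \in `[a, b] -> f t = K + integ g a t) -> {within `[a, b], continuous f}.
Proof.
move=> intg fE; apply/within_itv_continuousP => x xab eps eps0.
have [d d0 Hd] := integ_dist_small intg eps0; exists d => // y yab xy.
wlog : x y xab yab xy / x <= y.
  move=> H; have [xley|/ltW ylex] := leP x y; first exact: H.
  by rewrite distrC; apply: H => //; rewrite distrC.
move=> xley; move: xab yab; rewrite !in_itv/= => /andP[ax xb] /andP[ay yb].
rewrite !fE ?in_itv/= ?ax ?ay// distrC.
have -> : integ g a y = integ g a x + integ g x y.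
  by apply: integ_cat => //; apply: integrable_sub intg _ _.
rewrite opprD addrACA subrr add0r addrC addKr; apply: Hd => //.
by apply: le_lt_trans xy; rewrite distrC ler_norm.
Qed.

Lemma real_ac_integ f g K : leb.-integrable `]a, b[ (EFin \o g) ->
  (forall t, t \in `]a, b[ -> f t = K + integ g a t) -> real_ac `]a, b[ f.
Proof.
move=> intg fE eps eps0; have [d d0 Hd] := integ_small intg eps0; exists d => // s s1 s2 s3.
apply: le_lt_trans (Hd s _ s2 s3); last first.
  by move=> i /s1[? /= /[!in_itv]/= /andP[/ltW ? _] /andP[_ /ltW ?]].
rewrite big_seq [leRHS]big_seq; apply: ler_sum => i /s1[i12].
rewrite /= !in_itv/= => /andP[ai ib] /andP[ai2 ib2].
rewrite !fE ?in_itv/= ?ai ?ai2//.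
have -> : integ g a i.2 = integ g a i.1 + integ g i.1 i.2.
  by apply: integ_cat => //; [apply: integrable_sub intg _ _ => //; exact: ltW|exact: ltW].
rewrite opprD addrACA subrr add0r addrAC subrr add0r.
by apply: integ_le_norm; apply: integrable_sub intg _ _; exact: ltW.
Qed.

End interval_integral.

(** * The fundamental theorem of calculus for absolutely continuous functions *)

Section real_ac_ftc.
Context {R : realType}.
Notation leb := (@lebesgue_measure R).
Implicit Types (f g : R -> R).

Lemma real_acS (I J : set R) f : I `<=` J -> real_ac J f -> real_ac I f.
Proof.
move=> IJ acf e e0; have [d d0 Hd] := acf _ e0; exists d => // s s1 s2 s3; apply: Hd => //.
by move=> i /s1[i12 i1 i2]; split => //; exact: IJ.
Qed.

(** Some density [g] of [f] exists on [[s, t]], and almost everywhere [f] is derivable with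
    derivative [g]. Hence [h] may be prescribed only where [f] is derivable, and still agrees with
    [g] almost everywhere. *)
Lemma real_ac_ftc_open a b f h : real_ac `]a, b[ f -> leb.-integrable `]a, b[ (EFin \o h) ->
  {ae leb, forall t, t \in `]a, b[ -> derivable f t 1 -> derive1 f t = h t} ->
  forall s t, a < s -> s <= t -> t < b -> f t - f s = integ h s t.
Proof.
move=> acf ih fh s t as_ st tb.
have [|g ig gE] := @real_ac_density R f s t st.
  apply: real_acS acf => x /=; rewrite !in_itv/= => /andP[cx xd].
  by rewrite (lt_le_trans as_ cx) (le_lt_trans xd tb).
have igo : leb.-integrable `]s, t[ (EFin \o g) by apply: integrableS ig.
have iho : leb.-integrable `]s, t[ (EFin \o h) by apply: integrable_sub ih _ _; exact: ltW.
rewrite gE// -integrable_integ_cc//; apply: integ_ae_eq.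
- exact: integrable_measurable.
- exact: integrable_measurable.
apply: leb_aeS (leb_aeI fh (@ftc_ae R s t f g (f s) igo _)).
  move=> x [H1 H2] xst; have [df <-] := H2 xst; apply: H1 => //.
  move: xst; rewrite !in_itv/= => /andP[sx xt]; by rewrite (lt_trans as_ sx) (lt_trans xt tb).
move=> x; rewrite in_itv/= => /andP[ct td].
rewrite (@integrable_integ_cc R g s x); last by apply: integrableS ig.
by rewrite -gE ?(ltW ct) ?(ltW td)// addrC subrK.
Qed.

Lemma real_ac_ftc a b f h : a < b -> real_ac `]a, b[ f -> {within `[a, b], continuous f} ->
  leb.-integrable `]a, b[ (EFin \o h) ->
  {ae leb, forall t, t \in `]a, b[ -> derivable f t 1 -> derive1 f t = h t} ->
  forall t, t \in `[a, b] -> f t = f a + integ h a t.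
Proof.
move=> ab acf /within_itv_continuousP cf ih fh t tab.
have /andP[at_ tb] : a <= t <= b by move: tab; rewrite in_itv.
have [<-|aNt] := eqVneq a t; first by rewrite integ_ge// addr0.
have at' : a < t by rewrite lt_neqAle aNt.
apply/eqP; rewrite -subr_eq0 -normr_le0; apply/ler_addgt0Pr => e e0; rewrite add0r.
have e40 : 0 < e / 4 by rewrite divr_gt0.
have aab : a \in `[a, b] by rewrite in_itv/= lexx ltW.
have [d1 d10 H1] := cf a aab _ e40; have [d2 d20 H2] := cf t tab _ e40.
have [d3 d30 H3] := integ_dist_small ih e40.
pose d := Num.min (Num.min d1 d2) (Num.min d3 (t - a)).
have d0 : 0 < d by rewrite !lt_min d10 d20 d30 subr_gt0.
have [dd1 dd2 dd3 ddt] : [/\ d <= d1, d <= d2, d <= d3 & d <= t - a].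
  by split; rewrite /d !ge_min lexx ?orbT.
(* The formula holds between interior points; [s] and [u] are close enough to [a] and [t] for four
   errors below [e / 4], and [d <= t - a] ensures [s <= u]. *)
pose s := a + d / 3; pose u := t - d / 3.
have [as' su ut' ud sd] : [/\ a < s, s <= u, u < t, t - u < d & s - a < d].
  by rewrite /s /u; clear -d0 ddt at'; split; lra.
have sE : f u - f s = integ h s u.
  by apply: (real_ac_ftc_open acf ih fh) => //; exact: lt_le_trans tb.
have E1 : integ h a t = integ h a s + integ h s u + integ h u t.
  have iat : leb.-integrable `]a, t[ (EFin \o h) by apply: integrable_sub ih _ _.
  have au : a <= u by rewrite ltW// (lt_le_trans as').
  have iau : leb.-integrable `]a, u[ (EFin \o h) by apply: integrable_sub iat _ _ => //; exact: ltW.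
  rewrite (@integ_cat R h a u t)//; last exact: ltW.
  by rewrite (@integ_cat R h a s u)// ltW.
have b1 : `|f a - f s| < e / 4.
  apply: H1; first by rewrite in_itv/= ltW//= (le_trans su)// (le_trans (ltW ut')).
  by rewrite distrC gtr0_norm ?subr_gt0// (lt_le_trans sd).
have b2 : `|f t - f u| < e / 4.
  apply: H2; first by rewrite in_itv/= (le_trans (ltW as'))//= (le_trans (ltW ut')).
  by rewrite gtr0_norm ?subr_gt0// (lt_le_trans ud).
have b3 : `|integ h a s| < e / 4.
  apply: H3 => //; [exact: ltW|exact: le_trans su (le_trans (ltW ut') tb)|exact: lt_le_trans dd3].
have b4 : `|integ h u t| < e / 4.
  apply: H3 => //; [exact: le_trans (ltW as') su|exact: ltW|exact: lt_le_trans dd3].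
rewrite E1 -sE; clear -b1 b2 b3 b4 e0; move: b1 b2 b3 b4; rewrite !ltr_norml ler_norml.
by move=> /andP[? ?] /andP[? ?] /andP[? ?] /andP[? ?]; apply/andP; split; lra.
Qed.

End real_ac_ftc.

(** * Complex L_p spaces *)

Section powR_cvg.
Context {R : realType}.

Lemma cvg_powR (x_ : nat -> R) (x r : R) : 0 < r -> (forall n, 0 <= x_ n) ->
  x_ n @[n --> \oo] --> x -> x_ n `^ r @[n --> \oo] --> x `^ r.
Proof.
move=> r0 xn0 xx.
have : 0 <= x by apply: (cvgr_to_ge xx); exact: nearW.
rewrite le_eqVlt => /predU1P[x0|x0]; last first.
  have -> : x `^ r = expR (r * ln x) by rewrite /powR gt_eqF.
  apply: (@cvg_trans _ (expR (r * ln (x_ n)) @[n --> \oo])).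
    apply: near_eq_cvg; near=> n.
    have : 0 < x_ n by near: n; apply: (cvgr_gt x).
    by move=> xn; rewrite /powR gt_eqF.
  apply: continuous_cvg; first exact: continuous_expR.
  by apply: cvgMr; apply: continuous_cvg => //; exact: continuous_ln.
rewrite -x0 powR0 ?gt_eqF//.
apply/cvgrPdist_lt => e e0.
have /cvgrPdist_lt/(_ _ e0)[d /= d0 Hd] := powR_cvg0 r0.
near=> n; have [->|xnN0] := eqVneq (x_ n) 0.
  by rewrite powR0 ?gt_eqF// subrr normr0.
have xn : 0 < x_ n by rewrite lt_neqAle eq_sym xnN0 xn0.
apply: Hd => //=; rewrite x0; near: n.
exact: cvgr_dist_lt.
Unshelve. all: by end_near. Qed.

End powR_cvg.

(** * The L_p norm of real functions on an interval *)

Section real_Lp.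
Context {R : realType} (a b : R) (p : \bar R).
Hypothesis hab : a < b.
Hypothesis hp : (1 <= p)%E.
Notation leb := (@lebesgue_measure R).
Local Notation I := (`]a, b[%classic : set (measurableTypeR R)).
Implicit Types (u v : R -> R).

Definition rLp u : \bar R := Lnorm leb p ((EFin \o u) \_ `]a, b[).

Let mI : measurable I. Proof. exact: measurable_itv. Qed.

Lemma rLpE u : rLp u = Lnorm leb p (EFin \o (u \_ I)).
Proof. by rewrite /rLp restrict_EFin. Qed.

Lemma rLp_ge0 u : (0 <= rLp u)%E.
Proof. exact: Lnorm_ge0. Qed.

(** For [p = +oo] the norm is defined by cases and is the essential supremum only if the whole space
    has positive measure. *)
Let lebT_gt0 : (0 < leb setT)%E.
Proof.
apply: (@lt_le_trans _ _ (leb I)); last by rewrite le_measure ?inE.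
have -> := @leb_itvoo R a b.
by rewrite max_r ?lte_fin ?subr_gt0// subr_ge0 ltW.
Qed.

Let measurable_restr u : measurable_fun I u -> measurable_fun setT (u \_ I).
Proof. by move=> mu; apply/(measurable_restrictT _ mI). Qed.

Let measurable_abse_restr u : measurable_fun I u ->
  measurable_fun setT (fun x => `|((u \_ I) x)%:E|%E).
Proof. by move=> /measurable_restr mu; apply: measurableT_comp => //; exact/measurable_EFinP. Qed.

Let measurable_pow u r : measurable_fun I u ->
  measurable_fun setT (fun x => `|((u \_ I) x)%:E| `^ r)%E.
Proof.
move=> mu; apply: (measurableT_comp (measurable_poweR _)).
exact: measurable_abse_restr.
Qed.

Lemma le_rLp u v : measurable_fun I u -> measurable_fun I v ->
  {ae leb, forall x, x \in `]a, b[ -> `|u x| <= `|v x|} -> (rLp u <= rLp v)%E.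
Proof.
move=> mu mv uv; rewrite !rLpE.
have {}uv : {ae leb, forall x, (`|((u \_ I) x)%:E| <= `|((v \_ I) x)%:E|)%E}.
  apply: leb_aeS uv => x uvx; rewrite lee_fin !patchE; case: ifPn => //.
  by rewrite inE => /uvx.
move: hp; rewrite unlock /Lnorm; case: p => [r||//].
- rewrite lee_fin => r1; have r0 : 0 < r by rewrite (lt_le_trans ltr01).
  have r0' : 0 <= r by exact: ltW.
  apply: gt0_ler_poweR.
  + by rewrite invr_ge0.
  + by rewrite in_itv/= leey andbT; apply: integral_ge0 => x _; rewrite ?lee_fin ?poweR_ge0 ?powR_ge0.
  + by rewrite in_itv/= leey andbT; apply: integral_ge0 => x _; rewrite ?lee_fin ?poweR_ge0 ?powR_ge0.
  apply: ae_ge0_le_integral => //.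
  + by move=> x _; rewrite ?lee_fin ?poweR_ge0 ?powR_ge0.
  + exact: measurable_pow.
  + by move=> x _; rewrite ?lee_fin ?poweR_ge0 ?powR_ge0.
  + exact: measurable_pow.
  apply: leb_aeS uv => x uvx _; apply: gt0_ler_poweR => //.
    by rewrite in_itv/= leey andbT.
  by rewrite in_itv/= leey andbT.
- by move=> _; rewrite lebT_gt0; apply: le_ess_sup; exact: uv.
Qed.

Lemma rLp_ae_eq u v : measurable_fun I u -> measurable_fun I v ->
  {ae leb, forall x, x \in `]a, b[ -> u x = v x} -> rLp u = rLp v.
Proof.
move=> mu mv uv; apply/eqP; rewrite eq_le !le_rLp//.
  by apply: leb_aeS uv => x uv /uv ->.
by apply: leb_aeS uv => x uv /uv ->.
Qed.

Lemma rLpD u v : measurable_fun I u -> measurable_fun I v ->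
  (rLp (fun x => (u x + v x)%R) <= rLp u + rLp v)%E.
Proof.
move=> mu mv; rewrite !rLpE.
have := @eminkowski _ _ _ leb (u \_ I) (v \_ I) p (measurable_restr mu) (measurable_restr mv) hp.
apply: le_trans; rewrite le_eqVlt; apply/orP; left; apply/eqP; congr Lnorm.
by apply/funext => x /=; rewrite !patchE; case: ifPn => // _; rewrite addr0.
Qed.

Lemma rLpZ u (k : R) : 0 <= k -> measurable_fun I u ->
  rLp (fun x => k * u x) = (k%:E * rLp u)%E.
Proof.
move=> k0 mu; rewrite !rLpE.
have -> : EFin \o ((fun x => k * u x) \_ I) = (fun x => k%:E * ((u \_ I) x)%:E)%E.
  by apply/funext => x /=; rewrite !patchE; case: ifPn => _; rewrite ?mule0 -?EFinM.
have kE x : (`|k%:E * ((u \_ I) x)%:E| = k%:E * `|((u \_ I) x)%:E|)%E.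
  by rewrite abseM gee0_abs ?lee_fin.
rewrite unlock /Lnorm; move: hp; case: p => [r||//].
- rewrite lee_fin => r1; have r0 : 0 < r by rewrite (lt_le_trans ltr01).
  under eq_integral => x _ do rewrite kE poweRM//.
  rewrite /= ge0_integralZl//.
  + rewrite poweRM; [|by rewrite lee_fin powR_ge0|].
      by congr (_ * _)%E; rewrite /= -powRrM mulfV ?gt_eqF// powRr1.
    by apply: integral_ge0 => x _; rewrite lee_fin powR_ge0.
  + exact: measurable_pow.
  + by rewrite lee_fin powR_ge0.
- move=> _; rewrite lebT_gt0.
  rewrite -ess_supZl//; congr ess_sup; apply/funext => x /=; exact: kE.
Qed.

Lemma rLp_cst_lty (K : R) : (rLp (cst K) < +oo)%E.
Proof.
have H1 : (rLp (cst 1%R) < +oo)%E.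
  rewrite rLpE unlock /Lnorm; move: hp; case: p => [r||//].
  - rewrite lee_fin => r1; have r0 : 0 < r by rewrite (lt_le_trans ltr01).
    apply: poweR_lty; rewrite (_ : (fun x => _) = EFin \o \1_I).
      by rewrite integral_indic//= setIT; exact: leb_itvoo_lty.
    apply/funext => x /=; rewrite patchE indicE; case: ifPn => _ /=.
      by rewrite normr1 powR1.
    by rewrite normr0 powR0 ?gt_eqF.
  - move=> _; rewrite lebT_gt0; apply: (@le_lt_trans _ _ 1%:E); last exact: ltry.
    apply/ess_supP; apply: aeW => x /=; rewrite lee_fin patchE.
    by case: ifPn => _ /=; rewrite ?normr1 ?normr0.
have -> : rLp (cst K) = rLp (fun x => `|K| * cst 1 x).
  apply/eqP; rewrite eq_le !le_rLp//=; apply: aeW => x _;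
  by rewrite mulr1 normr_id.
by rewrite rLpZ// lte_mul_pinfty.
Qed.

(** Hoelder's inequality against the constant 1. The constant is 1 for [p = 1], the length of the
    interval for [p = +oo], and otherwise essentially the norm of 1 for the conjugate exponent. *)
Lemma rLp_L1 : exists2 C : R, 0 < C & forall u, measurable_fun I u ->
  (\int[leb]_(x in I) `|(u x)%:E| <= C%:E * rLp u)%E.
Proof.
have intE u : (\int[leb]_(x in I) `|(u x)%:E| = \int[leb]_x `|((u \_ I) x)%:E|)%E.
  rewrite integral_mkcond; apply: eq_integral => x _.
  by rewrite !patchE; case: ifPn => // _; rewrite abse0.
have [p1|p1] := eqVneq p 1%E.
  exists 1 => // u mu; rewrite mul1e rLpE intE p1 Lnorm1.
  exact: lexx.
have [pE|py] := eqVneq p +oo%E.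
  exists (b - a); first by rewrite subr_gt0.
  move=> u mu; rewrite rLpE pE unlock /Lnorm lebT_gt0.
  set S := ess_sup _ _.
  have S0 : (0 <= S)%E by apply: ess_sup_gee => //; apply: aeW => x /=; rewrite lee_fin.
  have ule : {ae leb, forall x, I x -> (`|(u x)%:E| <= S)%E}.
    apply: leb_aeS (ess_sup_ge leb (abse \o (EFin \o u \_ I))) => x /= ux Ix.
    by apply: le_trans ux; rewrite patchE mem_set.
  apply: (@le_trans _ _ (\int[leb]_(x in I) S)%E).
    apply: ae_ge0_le_integral => //.
    by apply: measurableT_comp => //; exact/measurable_EFinP.
  rewrite integral_cst// muleC; have /= -> := @leb_itvoo R a b.
  by rewrite max_r// subr_ge0 ltW.
move: hp p1 py; rewrite /rLp; case: (p) => [r||//] // r1 rN1 _.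
have {rN1 r1} r1 : 1 < r by rewrite lt_neqAle eq_sym -lee_fin r1 andbT; apply: contra rN1 => /eqP ->.
have r0 : 0 < r by rewrite (lt_trans ltr01).
pose q := (1 - r^-1)^-1; have q0 : 0 < q by rewrite invr_gt0 subr_gt0 invf_lt1.
have pq : r^-1 + q^-1 = 1 by rewrite /q invrK addrC subrK.
pose one : R -> R := cst 1.
have Kfin : (Lnorm leb q%:E (EFin \o one \_ I) < +oo)%E.
  rewrite unlock /Lnorm; apply: poweR_lty; rewrite (_ : (fun x => _) = EFin \o \1_I).
    by rewrite integral_indic//= setIT; exact: leb_itvoo_lty.
  apply/funext => x /=; rewrite patchE indicE; case: ifPn => _ /=.
    by rewrite normr1 powR1.
  by rewrite normr0 powR0 ?gt_eqF.
(* Adding 1 makes the positivity of the constant immediate. *)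
exists (fine (Lnorm leb q%:E (EFin \o one \_ I)) + 1).
  by rewrite ltr_wpDl// fine_ge0// Lnorm_ge0.
move=> u mu; rewrite intE restrict_EFin.
have m1 : measurable_fun setT (one \_ I).
  by apply: measurable_restr; exact: measurable_cst.
have := @hoelder _ _ _ leb (u \_ I) (one \_ I) r q (measurable_restr mu) m1 r0 q0 pq.
rewrite Lnorm1 => H; apply: (le_trans (le_trans _ H)).
  rewrite le_eqVlt; apply/orP; left; apply/eqP; apply: eq_integral => x _ /=.
  by rewrite !patchE; case: ifPn => _; rewrite ?mulr1 ?mulr0.
rewrite muleC; apply: lee_wpmul2r => //; first exact: Lnorm_ge0.
by rewrite EFinD fineK ?ge0_fin_numE ?Lnorm_ge0// leeDl.
Qed.

Lemma rLp_integrable u : measurable_fun I u -> (rLp u < +oo)%E ->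
  leb.-integrable `]a, b[ (EFin \o u).
Proof.
move=> mu uoo; have [C C0 HC] := rLp_L1.
apply/integrableP; split; first exact/measurable_EFinP.
apply: le_lt_trans (HC u mu) _.
by apply: lte_mul_pinfty => //; rewrite lee_fin ltW.
Qed.

(** For finite [p] this is Fatou's lemma for the p-th powers. For [p = +oo] the countably many
    exceptional null sets are united and the bound passes to the limit pointwise. *)
Lemma rLp_fatou (w_ : nat -> R -> R) u (K : \bar R) : (forall n, measurable_fun I (w_ n)) ->
  measurable_fun I u -> {ae leb, forall x, x \in `]a, b[ -> w_ n x @[n --> \oo] --> u x} ->
  (\forall n \near \oo, (rLp (w_ n) <= K)%E) -> (rLp u <= K)%E.
Proof.
move=> mw mu wu wK.
have K0 : (0 <= K)%E by have [n _ /(_ _ (leqnn n)) /=] := wK; apply: le_trans; exact: rLp_ge0.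
have wuE : {ae leb, forall x, `|((w_ n \_ I) x)%:E|%E @[n --> \oo] --> `|((u \_ I) x)%:E|%E}.
  apply: leb_aeS wu => x H /=; apply: cvg_EFin; first exact: nearW.
  rewrite /comp/=; under eq_fun do rewrite patchE; rewrite patchE.
  case: ifPn; last by move=> _; exact: cvg_cst.
  by rewrite inE => /H h; apply: cvg_norm.
move: hp wK; rewrite /rLp; case: p => [r||//]; under eq_near do rewrite restrict_EFin; rewrite restrict_EFin.
- rewrite lee_fin => r1 wK; have r0 : 0 < r by rewrite (lt_le_trans ltr01).
  have {}wK : \forall n \near \oo, (\int[leb]_x (`|((w_ n \_ I) x)%:E| `^ r) <= K `^ r)%E.
    near=> n; rewrite -poweR_Lnorm ?gt_eqF//; apply: gt0_ler_poweR; first exact: ltW.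
    + by rewrite in_itv/= leey andbT Lnorm_ge0.
    + by rewrite in_itv/= leey andbT.
    by near: n.
  have mwr n : measurable_fun setT (fun x => (`|((w_ n \_ I) x)%:E| `^ r)%E).
    exact: measurable_pow.
  suff H : (\int[leb]_x (`|((u \_ I) x)%:E| `^ r) <= K `^ r)%E.
    rewrite unlock /Lnorm; apply: (@le_trans _ _ ((K `^ r) `^ r^-1)%E).
      apply: gt0_ler_poweR H; first by rewrite invr_ge0 ltW.
      + by rewrite in_itv/= leey andbT; apply: integral_ge0 => x _; rewrite ?lee_fin ?poweR_ge0 ?powR_ge0.
      + by rewrite in_itv/= leey andbT poweR_ge0.
    by rewrite -poweRrM mulfV ?gt_eqF// poweRe1.
  pose W n x := (`|((w_ n \_ I) x)%:E| `^ r)%E.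
  have meinf : measurable_fun setT (fun x => limn_einf (W ^~ x)).
    have -> : (fun x => limn_einf (W ^~ x)) = (fun x => - limn_esup (fun n => - W n x))%E.
      by apply/funext => x; rewrite -limn_einfN; congr limn_einf; apply/funext => n; exact/esym/oppeK.
    by apply: measurableT_comp => //; apply: measurable_fun_limn_esup => n; apply: measurableT_comp => //; exact: mwr.
  have WE : {ae leb, forall x, limn_einf (W ^~ x) = (`|((u \_ I) x)%:E| `^ r)%E}.
    apply: leb_aeS wuE => x H; apply: (cvg_limn_einf_sup _).1.
    apply: cvg_EFin; first exact: nearW.
    apply: cvg_powR => //.
    exact: (fine_cvg H).
  have -> : (\int[leb]_x (`|((u \_ I) x)%:E| `^ r) = \int[leb]_x limn_einf (W ^~ x))%E.
    apply: ae_eq_integral => //; first exact: measurable_pow.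
    by apply: leb_aeS WE => x ->.
  have iK : (limn_einf (fun n => \int[leb]_x (W n x)) <= K `^ r)%E.
    have [N _ HN] := wK.
    rewrite limn_einf_lim; apply: lime_le; first exact: is_cvg_einfs.
    apply: nearW => n; rewrite /einfs; apply: le_trans (HN (maxn n N) _); last by rewrite /= leq_maxr.
    by apply: ereal_inf_lbound; exists (maxn n N) => //=; rewrite leq_maxl.
  apply: le_trans iK; apply: (fatou leb measurableT mwr).
  by move=> *; rewrite lee_fin powR_ge0.
- move=> _; rewrite unlock /Lnorm lebT_gt0 => -[N _ HN].
  apply/ess_supP.
  have : {ae leb, forall x, forall n, (N <= n)%N -> (`|((w_ n \_ I) x)%:E| <= K)%E}.
    apply: ae_foralln => n; have [Nn|nN] := leqP N n; last by apply: aeW.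
    apply: leb_aeS (ess_sup_ge leb (abse \o (EFin \o w_ n \_ I))) => x /= xn _.
    by apply: le_trans xn (HN n Nn).
  move=> wle; apply: leb_aeS (leb_aeI wle wuE) => x [wx ux] /=.
  have cv : cvgn (fun n => `|((w_ n \_ I) x)%:E|%E) by apply/cvg_ex; exists (`|((u \_ I) x)%:E|%E).
  have uE : limn (fun n => `|((w_ n \_ I) x)%:E|%E) = `|((u \_ I) x)%:E|%E by exact: cvg_lim.
  have : (limn (fun n => `|((w_ n \_ I) x)%:E|%E) <= K)%E.
    by apply: lime_le => //; exists N => // n Nn; exact: wx.
  by rewrite uE.
Unshelve. all: by end_near. Qed.

End real_Lp.

Section complex_numbers.
Context {R : realType}.
Notation nc := (@ComplexField.Normc.normc R).
Notation Rez := (@complex.Re R).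
Notation Imz := (@complex.Im R).
Implicit Types (z w : R[i]).

Lemma nc_ge0 z : 0 <= nc z.
Proof. by case: z => x y; exact: sqrtr_ge0. Qed.

Lemma ncD z w : nc (z + w) <= nc z + nc w.
Proof. exact: (@le_normcD R). Qed.

Lemma ncN z : nc (- z) = nc z.
Proof. by case: z => x y /=; rewrite !sqrrN. Qed.

Lemma ncB z w : nc (z - w) <= nc z + nc w.
Proof. by apply: le_trans (ncD _ _) _; rewrite ncN. Qed.

Lemma ncM z w : nc (z * w) = nc z * nc w.
Proof. exact: ComplexField.Normc.normcM. Qed.

Lemma nc0 : nc 0 = 0. Proof. exact: ComplexField.Normc.normc0. Qed.

Lemma nc1 : nc 1 = 1. Proof. exact: ComplexField.Normc.normc1. Qed.

Lemma nc_eq0 z : nc z = 0 -> z = 0. Proof. exact: ComplexField.Normc.eq0_normc. Qed.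

Lemma Re_le_nc z : `|Rez z| <= nc z.
Proof. by case: z => x y /=; rewrite -sqrtr_sqr ler_wsqrtr// lerDl sqr_ge0. Qed.

Lemma Im_le_nc z : `|Imz z| <= nc z.
Proof. by case: z => x y /=; rewrite -sqrtr_sqr ler_wsqrtr// lerDr sqr_ge0. Qed.

Lemma nc_le_ReIm z : nc z <= `|Rez z| + `|Imz z|.
Proof.
case: z => x y /=; rewrite -(@ger0_norm _ (`|x| + `|y|)) ?addr_ge0//.
rewrite -sqrtr_sqr ler_wsqrtr// sqrrD !real_normK ?num_real//.
by rewrite lerD2r lerDl mulrn_wge0// mulr_ge0.
Qed.

Lemma nc_sum (J : Type) (s : seq J) (P : pred J) (F : J -> R[i]) :
  nc (\sum_(i <- s | P i) F i) <= \sum_(i <- s | P i) nc (F i).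
Proof.
elim/big_ind2 : _ => //; first by rewrite nc0.
by move=> x1 x2 y1 y2 h1 h2; apply: le_trans (ncD _ _) _; exact: lerD.
Qed.

Lemma nc_real (x : R) : nc (x%:C)%C = `|x|.
Proof. by rewrite /= expr0n addr0 sqrtr_sqr. Qed.

Lemma ReD z w : Rez (z + w) = Rez z + Rez w. Proof. by case: z w => ? ? []. Qed.
Lemma ImD z w : Imz (z + w) = Imz z + Imz w. Proof. by case: z w => ? ? []. Qed.
Lemma ReB z w : Rez (z - w) = Rez z - Rez w. Proof. by case: z w => ? ? []. Qed.
Lemma ImB z w : Imz (z - w) = Imz z - Imz w. Proof. by case: z w => ? ? []. Qed.
Lemma ReM z w : Rez (z * w) = Rez z * Rez w - Imz z * Imz w.
Proof. by case: z w => ? ? []. Qed.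
Lemma ImM z w : Imz (z * w) = Rez z * Imz w + Imz z * Rez w.
Proof. by case: z w => ? ? []. Qed.

Lemma complexP z w : Rez z = Rez w -> Imz z = Imz w -> z = w.
Proof. by case: z w => ? ? [? ?] /= -> ->. Qed.

End complex_numbers.

(** * Norm estimates and completeness of complex L_p *)

Section complex_Lp.
Context {R : realType} (a b : R) (p : \bar R).
Hypothesis hab : a < b.
Hypothesis hp : (1 <= p)%E.
Notation leb := (@lebesgue_measure R).
Notation nc := (@ComplexField.Normc.normc R).
Notation Rez := (@complex.Re R).
Notation Imz := (@complex.Im R).
Local Notation I := (`]a, b[%classic : set (measurableTypeR R)).
Implicit Types (f g : R -> R[i]).

Definition cmeas f : Prop :=
  measurable_fun I (fun t => Rez (f t)) /\ measurable_fun I (fun t => Imz (f t)).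

Lemma cmeas_ext f g : {in `]a, b[, f =1 g} -> cmeas f -> cmeas g.
Proof.
move=> fg [mr mi]; split; [apply: eq_measurable_fun mr|apply: eq_measurable_fun mi];
by move=> x; rewrite inE /= => /fg ->.
Qed.

Lemma meas_eq1 (u v : R -> R) : u =1 v -> measurable_fun I u -> measurable_fun I v.
Proof. by move=> /funext ->. Qed.

Lemma cmeas_cst z : cmeas (fun=> z).
Proof. by split; exact: measurable_cst. Qed.

Lemma cmeasD f g : cmeas f -> cmeas g -> cmeas (fun t => f t + g t).
Proof.
move=> [fr fi] [gr gi]; split.
  by apply: (meas_eq1 (fun t => esym (ReD _ _))); exact: measurable_funD.
by apply: (meas_eq1 (fun t => esym (ImD _ _))); exact: measurable_funD.
Qed.

Lemma cmeasM f g : cmeas f -> cmeas g -> cmeas (fun t => f t * g t).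
Proof.
move=> [fr fi] [gr gi]; split.
  by apply: (meas_eq1 (fun t => esym (ReM _ _))); apply: measurable_funB; exact: measurable_funM.
by apply: (meas_eq1 (fun t => esym (ImM _ _))); apply: measurable_funD; exact: measurable_funM.
Qed.

Lemma cmeasB f g : cmeas f -> cmeas g -> cmeas (fun t => f t - g t).
Proof.
move=> [fr fi] [gr gi]; split.
  by apply: (meas_eq1 (fun t => esym (ReB _ _))); exact: measurable_funB.
by apply: (meas_eq1 (fun t => esym (ImB _ _))); exact: measurable_funB.
Qed.

Lemma cmeas_normc f : cmeas f -> measurable_fun I (fun t => nc (f t)).
Proof.
move=> [fr fi].
have -> : (fun t => nc (f t)) = (fun t => Num.sqrt (Rez (f t) ^+ 2 + Imz (f t) ^+ 2)).
  by apply/funext => t; case: (f t).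
apply: (@measurableT_comp _ _ _ _ _ _ (@Num.sqrt R)).
  by apply: continuous_measurable_fun; exact: sqrt_continuous.
by apply: measurable_funD; exact: measurable_funX.
Qed.

Lemma Lp_normE f : Lp_norm a b p f = rLp a b p (fun t => nc (f t)).
Proof. by []. Qed.

Definition Lpn f : R := fine (Lp_norm a b p f).

Lemma in_Lp_cmeas f : in_Lp a b p f -> cmeas f.
Proof. by case. Qed.

Lemma Lpn_ge0 f : 0 <= Lpn f.
Proof. by rewrite fine_ge0// Lnorm_ge0. Qed.

Lemma LpnE f : in_Lp a b p f -> Lp_norm a b p f = (Lpn f)%:E.
Proof. by move=> [_ _ foo]; rewrite /Lpn fineK// ge0_fin_numE// Lnorm_ge0. Qed.

Lemma in_Lp_dom f (u : R -> R) K : cmeas f -> measurable_fun I u ->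
  {ae leb, forall t, t \in `]a, b[ -> nc (f t) <= u t} -> (rLp a b p u <= K%:E)%E ->
  in_Lp a b p f /\ Lpn f <= K.
Proof.
move=> mf mu fu uK.
have H : (Lp_norm a b p f <= K%:E)%E.
  apply: le_trans uK; rewrite Lp_normE; apply: le_rLp => //; first exact: cmeas_normc.
  apply: leb_aeS fu => t ftu tab; rewrite ger0_norm ?nc_ge0//.
  by apply: le_trans (ftu tab) (ler_norm _).
have iLp : in_Lp a b p f by case: mf => ? ?; split=> //; exact: le_lt_trans H (ltry _).
by split=> //; rewrite -lee_fin -LpnE.
Qed.

Lemma Lpn_ae_eq f g : cmeas f -> cmeas g ->
  {ae leb, forall t, t \in `]a, b[ -> f t = g t} -> Lp_norm a b p f = Lp_norm a b p g.
Proof.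
move=> mf mg fg; rewrite !Lp_normE; apply: rLp_ae_eq; [exact: hab|exact: hp|exact: cmeas_normc..|].
by apply: leb_aeS fg => t H /H ->.
Qed.

Lemma in_Lp_ae_eq f g : in_Lp a b p f -> cmeas g ->
  {ae leb, forall t, t \in `]a, b[ -> f t = g t} -> in_Lp a b p g /\ Lpn g = Lpn f.
Proof.
move=> iLf mg fg; have [mr mi foo] := iLf.
have E := Lpn_ae_eq (in_Lp_cmeas iLf) mg fg.
by split; [case: mg => ? ?; split=> //; rewrite -E|rewrite /Lpn E].
Qed.

Lemma LpnD f g : in_Lp a b p f -> in_Lp a b p g ->
  in_Lp a b p (fun t => f t + g t) /\ Lpn (fun t => f t + g t) <= Lpn f + Lpn g.
Proof.
move=> iLf iLg; have mf := in_Lp_cmeas iLf; have mg := in_Lp_cmeas iLg.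
apply: (@in_Lp_dom _ (fun t => nc (f t) + nc (g t))).
- exact: cmeasD.
- by apply: measurable_funD; exact: cmeas_normc.
- by apply: aeW => t _; exact: ncD.
rewrite EFinD -!LpnE//; by apply: rLpD => //; exact: cmeas_normc.
Qed.

Lemma LpnM f g K : in_Lp a b p f -> cmeas g -> 0 <= K ->
  (forall t, t \in `]a, b[ -> nc (g t) <= K) ->
  in_Lp a b p (fun t => f t * g t) /\ Lpn (fun t => f t * g t) <= K * Lpn f.
Proof.
move=> iLf mg K0 gK; have mf := in_Lp_cmeas iLf.
apply: (@in_Lp_dom _ (fun t => K * nc (f t))).
- exact: cmeasM.
- by apply: measurable_funM => //; exact: cmeas_normc.
- by apply: aeW => t /gK ?; rewrite ncM mulrC ler_wpM2r// nc_ge0.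
by rewrite (rLpZ hab hp K0 (cmeas_normc mf)) -Lp_normE LpnE.
Qed.

Lemma LpnZ f z : in_Lp a b p f ->
  in_Lp a b p (fun t => z * f t) /\ Lpn (fun t => z * f t) = nc z * Lpn f.
Proof.
move=> iLf; have mf := in_Lp_cmeas iLf.
have [iL _] : in_Lp a b p (fun t => z * f t) /\ Lpn (fun t => z * f t) <= nc z * Lpn f.
  have -> : (fun t => z * f t) = (fun t => f t * z) by apply/funext => t; rewrite mulrC.
  by apply: LpnM => //; exact: nc_ge0.
split=> //; rewrite /Lpn Lp_normE.
have -> : (fun t => nc (z * f t)) = (fun t => nc z * nc (f t)) by apply/funext => t; exact: ncM.
by rewrite (rLpZ hab hp (nc_ge0 z) (cmeas_normc mf)) -Lp_normE LpnE.
Qed.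

Lemma LpnB f g : in_Lp a b p f -> in_Lp a b p g ->
  in_Lp a b p (fun t => f t - g t) /\ Lpn (fun t => f t - g t) <= Lpn f + Lpn g.
Proof.
move=> iLf iLg; have [h1 h2] := LpnZ (-1) iLg.
have E : (fun t => f t - g t) = (fun t => f t + -1 * g t) by apply/funext => t; rewrite mulN1r.
rewrite E; have [? H] := LpnD iLf h1; split=> //; apply: le_trans H _.
by rewrite h2 ncN nc1 mul1r.
Qed.

Definition Lpn1 : R := fine (rLp a b p (cst 1)).

Lemma Lpn1_ge0 : 0 <= Lpn1.
Proof. by rewrite fine_ge0// rLp_ge0. Qed.

Lemma Lpn_bounded f K : cmeas f -> 0 <= K -> (forall t, t \in `]a, b[ -> nc (f t) <= K) ->
  in_Lp a b p f /\ Lpn f <= K * Lpn1.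
Proof.
move=> mf K0 fK; apply: (@in_Lp_dom _ (fun=> K * 1)) => //.
  by apply: aeW => t /fK; rewrite mulr1.
rewrite (@rLpZ R a b p hab hp (cst 1) K K0 (measurable_cst _)).
have <- : Lpn1%:E = rLp a b p (cst 1).
  by rewrite fineK// ge0_fin_numE ?rLp_ge0// rLp_cst_lty.
by rewrite -EFinM.
Qed.

Lemma Lpn_L1 : exists2 C : R, 0 < C & forall f, in_Lp a b p f ->
  [/\ leb.-integrable `]a, b[ (EFin \o (fun t => Rez (f t))),
      leb.-integrable `]a, b[ (EFin \o (fun t => Imz (f t))),
      leb.-integrable `]a, b[ (EFin \o (fun t => nc (f t))) &
      integ (fun t => nc (f t)) a b <= C * Lpn f].
Proof.
have [C C0 HC] := rLp_L1 hab hp; exists C => // f iLf; have mf := in_Lp_cmeas iLf.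
have inc : leb.-integrable `]a, b[ (EFin \o (fun t => nc (f t))).
  by apply: (rLp_integrable hab hp); [exact: cmeas_normc|case: iLf].
have [mr mi] := mf; split => //.
- apply: le_integrable inc => //; first exact/measurable_EFinP.
  by move=> t _ /=; rewrite lee_fin (le_trans (Re_le_nc _)) ?ler_norm.
- apply: le_integrable inc => //; first exact/measurable_EFinP.
  by move=> t _ /=; rewrite lee_fin (le_trans (Im_le_nc _)) ?ler_norm.
have := HC _ (cmeas_normc mf); rewrite -Lp_normE LpnE// -EFinM => H.
rewrite -lee_fin; apply: le_trans H.
rewrite /integ /Rintegral fineK; last exact: integrable_fin_num.
apply: ge0_le_integral => //.
- by move=> t _; rewrite lee_fin nc_ge0.
- by apply/measurable_EFinP; exact: cmeas_normc.
- by apply: measurableT_comp => //; apply/measurable_EFinP; exact: cmeas_normc.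
by move=> t _; rewrite lee_fin ler_norm.
Qed.

Lemma geometric_telescope (V : zmodType) (x_ : nat -> V) n k :
  x_ (n + k)%N - x_ n = \sum_(i < k) (x_ (n + i.+1)%N - x_ (n + i)%N).
Proof.
elim: k => [|k IH]; first by rewrite big_ord0 addn0 subrr.
by rewrite big_ord_recr/= -IH addrC addrA subrK.
Qed.

Lemma geometric_sum_le (q : R) k : 0 < q -> q < 1 -> \sum_(i < k) q ^+ i <= (1 - q)^-1.
Proof.
move=> q0 q1; rewrite -(ler_pM2l (_ : 0 < 1 - q)) ?subr_gt0//.
rewrite divff ?gt_eqF ?subr_gt0// -opprB mulNr -subrX1 opprB lerBlDr lerDl.
by rewrite exprn_ge0 // ltW.
Qed.

(* A sequence with geometrically decreasing increments converges almost everywhere by the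
   L_1 bound on the increments, and in norm by Fatou's lemma. *)
Lemma Lp_complete (f_ : nat -> R -> R[i]) (K q : R) : 0 < q -> q < 1 ->
  (forall n, in_Lp a b p (f_ n)) ->
  (forall n, Lpn (fun t => f_ n.+1 t - f_ n t) <= K * q ^+ n) ->
  exists2 f, in_Lp a b p f & forall n, Lpn (fun t => f t - f_ n t) <= K / (1 - q) * q ^+ n.
Proof.
move=> q0 q1 iLf fK.
have K0 : 0 <= K by have := fK 0%N; rewrite expr0 mulr1; apply: le_trans; exact: Lpn_ge0.
have iLd n : in_Lp a b p (fun t => f_ n.+1 t - f_ n t) by exact: (LpnB (iLf _) (iLf _)).1.
have md n := in_Lp_cmeas (iLd n).
have tele n k : Lpn (fun t => f_ (n + k)%N t - f_ n t) <= K / (1 - q) * q ^+ n.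
  have -> : (fun t => f_ (n + k)%N t - f_ n t) =
      (fun t => \sum_(i < k) (f_ (n + i.+1)%N t - f_ (n + i)%N t)).
    by apply/funext => t; rewrite (geometric_telescope (fun n => f_ n t)).
  apply: (@le_trans _ _ (\sum_(i < k) K * q ^+ (n + i))); last first.
    under eq_bigr do rewrite exprD mulrA; rewrite -mulr_sumr -mulrA [X in _ <= X]mulrAC.
    rewrite mulrA ler_wpM2l//; last exact: geometric_sum_le.
    by rewrite mulr_ge0// exprn_ge0// (ltW q0).
  suff : in_Lp a b p (fun t => \sum_(i < k) (f_ (n + i.+1)%N t - f_ (n + i)%N t)) /\
    Lpn (fun t => \sum_(i < k) (f_ (n + i.+1)%N t - f_ (n + i)%N t)) <= \sum_(i < k) K * q ^+ (n + i) by case.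
  elim: k => [|k [IH1 IH2]].
    rewrite big_ord0 (_ : (fun _ => _) = fun=> 0); last by apply/funext => t; rewrite big_ord0.
    have [||? H] := @Lpn_bounded (fun=> 0) 0 (cmeas_cst 0) => //.
      by move=> t _; rewrite nc0.
    by split=> //; rewrite mul0r in H.
  rewrite big_ord_recr/= (_ : (fun _ => _) = fun t => \sum_(i < k) (f_ (n + i.+1)%N t - f_ (n + i)%N t) +
     (f_ (n + k.+1)%N t - f_ (n + k)%N t)); last by apply/funext => t; rewrite big_ord_recr.
  have [? H] := LpnD IH1 (LpnB (iLf (n + k.+1)%N) (iLf (n + k)%N)).1.
  split=> //; apply: le_trans H _; apply: lerD => //.
  by rewrite addnS; exact: fK.
have [C C0 HC] := Lpn_L1.
pose u n t := (nc (f_ n.+1 t - f_ n t))%:E.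
have mu n : measurable_fun I (u n) by apply/measurable_EFinP; exact: cmeas_normc.
have u0 n t : (0 <= u n t)%E by rewrite lee_fin nc_ge0.
pose S t := (\sum_(0 <= n <oo) u n t)%E.
have mS : measurable_fun I S by apply: ge0_emeasurable_sum => // *; exact: u0.
have S_fin : {ae leb, forall t, t \in `]a, b[ -> S t \is a fin_num}.
  have iS : leb.-integrable I S.
    apply/integrableP; split=> //.
    have -> : (\int[leb]_(x in I) `|S x| = \int[leb]_(x in I) S x)%E.
      by apply: eq_integral => x _; rewrite gee0_abs//; apply: nneseries_ge0 => *; exact: u0.
    rewrite integral_nneseries//.
    apply: (@le_lt_trans _ _ (C * (K / (1 - q)))%:E); last exact: ltry.
    apply: lime_le; first by apply: is_cvg_nneseries => n _ _; apply: integral_ge0.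
    apply: nearW => n; apply: (@le_trans _ _ (\sum_(0 <= i < n) (C * (K * q ^+ i))%:E)%E).
      apply: lee_sum => i _; have [_ _ inc ile] := HC _ (iLd i).
      rewrite -[leLHS]fineK ?lee_fin; last exact: integrable_fin_num.
      by apply: le_trans ile _; rewrite ler_wpM2l// ltW.
    rewrite sumEFin lee_fin big_mkord; under eq_bigr do rewrite mulrA.
    rewrite -mulr_sumr mulrA ler_wpM2l//; last exact: geometric_sum_le.
    by rewrite mulr_ge0// ltW.
  exact: integrable_ae iS.
have S0 t : (0 <= S t)%E by apply: nneseries_ge0 => *; exact: u0.
pose D := [set t | I t /\ (S t < +oo)%E].
have mD : measurable (D : set (measurableTypeR R)).
  rewrite (_ : D = I `&` [set t | (S t < +oo)%E])//.
  by apply: emeasurable_fun_infty_o.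
(* Multiplication by the indicator of [D], where the increments are absolutely summable, makes the
   sequence converge at every point, so that its limit is Borel measurable. *)
pose lm (r : R[i] -> R) (n : nat) t : R := r (f_ n t) * \1_D t.
pose f t := Complex (limn (fun n => lm Rez n t)) (limn (fun n => lm Imz n t)).
have cvl (r : R[i] -> R) t : {morph r : x y / x - y} -> (forall z, `|r z| <= nc z) ->
    cvgn (fun n => lm r n t).
  move=> rB rle; rewrite /lm indicE; have [Dt|Dt] := boolP (t \in D); last first.
    by apply/cvg_ex; exists 0; rewrite (_ : (fun _ => _) = cst 0); [exact: cvg_cst|apply/funext => n; rewrite mulr0].
  move: Dt; rewrite inE => -[It Soo]; have Sfin : S t \is a fin_num by rewrite ge0_fin_numE.
  have -> : (fun n => r (f_ n t) * true%:R) = (fun n => r (f_ n t)) by apply/funext => n; rewrite mulr1.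
  have cs : cvgn (series (fun n => r (f_ n.+1 t) - r (f_ n t))).
    apply: normed_cvg.
    suff : cvgn (fun n => \sum_(0 <= k < n) `|r (f_ k.+1 t) - r (f_ k t)|) by [].
    apply: nondecreasing_is_cvgn; first by apply: nondecreasing_series.
    exists (fine (S t)) => _ [n _ <-].
    rewrite -lee_fin fineK// -sumEFin.
    apply: le_trans (nneseries_lim_ge n _); last by move=> *; exact: u0.
    by apply: lee_sum => i _; rewrite lee_fin -rB.
  have -> : (fun n => r (f_ n t)) = (fun n => series (fun n => r (f_ n.+1 t) - r (f_ n t)) n + r (f_ 0%N t)).
    by apply/funext => n; rewrite /series/= telescope_sumr// subrK.
  by apply: is_cvgD => //; exact: is_cvg_cst.
have mlm (r : R[i] -> R) n : measurable_fun I (fun t => r (f_ n t)) -> measurable_fun I (lm r n).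
  by move=> mr; apply: measurable_funM => //; exact: measurable_indic.
have cR t := cvl Rez t (@ReB R) (@Re_le_nc R).
have cI t := cvl Imz t (@ImB R) (@Im_le_nc R).
have mf : cmeas f.
  split; [apply: (@measurable_fun_cvg _ _ _ _ (lm Rez))|apply: (@measurable_fun_cvg _ _ _ _ (lm Imz))].
  - by move=> n; apply: mlm; case: (in_Lp_cmeas (iLf n)).
  - by move=> t _; exact: cR.
  - by move=> n; apply: mlm; case: (in_Lp_cmeas (iLf n)).
  - by move=> t _; exact: cI.
have bound n : in_Lp a b p (fun t => f t - f_ n t) /\ Lpn (fun t => f t - f_ n t) <= K / (1 - q) * q ^+ n.
  have mfn := in_Lp_cmeas (iLf n).
  apply: (@in_Lp_dom _ (fun t => nc (f t - f_ n t))).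
  - exact: cmeasB.
  - by apply: cmeas_normc; exact: cmeasB.
  - exact: aeW.
  apply: (@rLp_fatou R a b p hab hp (fun m t => nc (f_ m t - f_ n t))).
  - by move=> m; apply: cmeas_normc; apply: cmeasB => //; exact: in_Lp_cmeas.
  - by apply: cmeas_normc; exact: cmeasB.
  - apply: leb_aeS S_fin => t H tab; have Dt : D t by split=> //; rewrite -ge0_fin_numE// H.
    have cz : (nc (f_ m t - f_ n t) @[m --> \oo] -->
       Num.sqrt ((Rez (f t) - Rez (f_ n t)) ^+ 2 + (Imz (f t) - Imz (f_ n t)) ^+ 2)).
      have -> : (fun m => nc (f_ m t - f_ n t)) =
          (fun m => Num.sqrt ((lm Rez m t - Rez (f_ n t)) ^+ 2 + (lm Imz m t - Imz (f_ n t)) ^+ 2)).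
        apply/funext => m; rewrite /lm indicE mem_set// !mulr1.
        by case: (f_ m t) (f_ n t) => [? ?] [? ?].
      apply: continuous_cvg; first exact: sqrt_continuous.
      have c2 (v : nat -> R) (l : R) : v m @[m --> \oo] --> l -> v m ^+ 2 @[m --> \oo] --> l ^+ 2.
        by move=> vl; exact: (cvgM vl vl).
      apply: cvgD; apply: c2.
      - by apply: cvgB; [exact: cR|exact: cvg_cst].
      - by apply: cvgB; [exact: cI|exact: cvg_cst].
    move: cz; rewrite -ReB -ImB; case: (f t - f_ n t) => ? ?; exact.
  - exists n => // m /= nm; rewrite -Lp_normE LpnE; last exact: (LpnB (iLf _) (iLf _)).1.
    by rewrite lee_fin -(subnKC nm); exact: tele.
exists f; last by move=> n; exact: (bound n).2.
have [iL _] := LpnD (bound 0%N).1 (iLf 0%N).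
by move: iL; rewrite (_ : (fun _ => _) = f)//; apply/funext => t; rewrite subrK.
Qed.

End complex_Lp.

(** * Sobolev spaces on an interval *)

Section open_interval_extension.
Context {R : realType} (a b : R).
Hypothesis hab : a < b.
Implicit Types (f g h : R -> R).

Lemma real_ac_ucont h : real_ac `]a, b[ h -> forall e, 0 < e -> exists2 d : R, 0 < d &
  forall x y, x \in `]a, b[ -> y \in `]a, b[ -> `|x - y| < d -> `|h x - h y| < e.
Proof.
move=> ach e e0; have [d d0 H] := ach _ e0; exists d => // x y xab yab.
wlog : x y xab yab / x <= y.
  move=> W xy; have [xley|/ltW ylex] := leP x y; first exact: W.
  by rewrite distrC; apply: W => //; rewrite distrC.
move=> xley xy; have := H [:: (x, y)]; rewrite !big_seq1/= distrC; apply => //.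
  by move=> i; rewrite inE => /eqP ->.
by apply: le_lt_trans xy; rewrite distrC ler_norm.
Qed.

Lemma itv_dense y r : y \in `[a, b] -> 0 < r -> exists2 z, z \in `]a, b[ & `|y - z| < r.
Proof.
rewrite in_itv/= => /andP[ay yb] r0; have ba0 : 0 < b - a by rewrite subr_gt0.
have [yltb|bley] := ltP y b.
  exists (y + Num.min r (b - y) / 2).
    have h0 : 0 < Num.min r (b - y) by rewrite lt_min r0 subr_gt0.
    have h2 : Num.min r (b - y) <= b - y by rewrite ge_min lexx orbT.
    by rewrite in_itv/=; apply/andP; split; lra.
  have h0 : 0 < Num.min r (b - y) by rewrite lt_min r0 subr_gt0.
  have h1 : Num.min r (b - y) <= r by rewrite ge_min lexx.
  by rewrite opprD addNKr normrN gtr0_norm ?divr_gt0//; lra.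
exists (y - Num.min r (b - a) / 2).
  have h0 : 0 < Num.min r (b - a) by rewrite lt_min r0.
  have h2 : Num.min r (b - a) <= b - a by rewrite ge_min lexx orbT.
  by rewrite in_itv/=; apply/andP; split; lra.
have h0 : 0 < Num.min r (b - a) by rewrite lt_min r0.
have h1 : Num.min r (b - a) <= r by rewrite ge_min lexx.
by rewrite subKr gtr0_norm ?divr_gt0//; lra.
Qed.

(* The limits at the endpoints exist by the Cauchy criterion. *)
Lemma real_ac_extension h : real_ac `]a, b[ h -> exists2 g, {within `[a, b], continuous g} &
  {in `]a, b[, g =1 h}.
Proof.
move=> /real_ac_ucont uc.
have lim_exists (c : R) : c \in `[a, b] -> exists l : R, forall e, 0 < e -> exists2 d : R, 0 < d &
    forall y, y \in `]a, b[ -> `|c - y| < d -> `|l - h y| < e.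
  move=> cab.
  pose F := within `]a, b[%classic (nbhs c).
  have PF : ProperFilter F.
    apply: Build_ProperFilter_ex => // A [d /= d0 Hd].
    by have [z zab zd] := itv_dense cab d0; exists z; apply: Hd.
  have : cauchy (h @ F).
    apply/cauchyP => e e0; have [d d0 Hd] := uc _ (divr_gt0 e0 (@ltr0n R 2)).
    have [x xab xd] := itv_dense cab (divr_gt0 d0 (@ltr0n R 2)).
    exists (h x); exists (d / 2) => /=; first by rewrite divr_gt0.
    move=> y /= cy yab; rewrite /ball/=.
    apply: lt_le_trans (Hd x y xab yab _) _; last by lra.
    apply: le_lt_trans (ler_distD c _ _) _; rewrite (distrC x c); lra.
  move=> /cauchy_cvgP/cvg_ex[l /cvgrPdist_lt Hl]; exists l => e e0.
  by have [d /= d0 Hd] := Hl e e0; exists d => // y yab cy; apply: Hd.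
pose l c := if pselect (c \in `[a, b]) is left H then sval (cid (lim_exists c H)) else 0.
have lP c : c \in `[a, b] -> forall e, 0 < e -> exists2 d : R, 0 < d &
    forall y, y \in `]a, b[ -> `|c - y| < d -> `|l c - h y| < e.
  by rewrite /l; case: pselect => // H _; case: cid.
have oc x : x \in `]a, b[ -> x \in `[a, b].
  by rewrite !in_itv/= => /andP[/ltW -> /ltW ->].
have lh : {in `]a, b[, l =1 h}.
  move=> x xab; apply/eqP; rewrite -subr_eq0 -normr_le0; apply/ler_addgt0Pr => e e0; rewrite add0r.
  by have [d d0 Hd] := lP x (oc _ xab) e e0; apply/ltW/Hd => //; rewrite subrr normr0.
exists l => //; apply/within_itv_continuousP => x xab e e0.
have [d d0 Hd] := lP x xab (e / 2) (divr_gt0 e0 (@ltr0n R 2)).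
exists d => // y yab xy.
have [d' d'0 Hd'] := lP y yab (e / 2) (divr_gt0 e0 (@ltr0n R 2)).
have [z [zab xz yz]] : exists z, [/\ z \in `]a, b[, `|x - z| < d & `|y - z| < d'].
  have yd : 0 < Num.min d' (d - `|x - y|) by rewrite lt_min d'0 subr_gt0.
  have [z zab zy] := itv_dense yab yd.
  move: zy; rewrite lt_min => /andP[z1 z2]; exists z; split => //.
  by apply: le_lt_trans (ler_distD y _ _) _; rewrite -ltrBrDl.
apply: le_lt_trans (ler_distD (h z) _ _) _.
have := Hd z zab xz; have := Hd' z zab yz; rewrite (distrC (h z)); lra.
Qed.

Lemma within_continuous_bounded h : {within `[a, b], continuous h} ->
  exists2 M : R, 0 <= M & forall t, t \in `[a, b] -> `|h t| <= M.
Proof.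
move=> ch; have [c cab Hc] := EVT_max (ltW hab) ch.
have [d dab Hd] := EVT_min (ltW hab) ch.
exists (`|h c| + `|h d|); first by rewrite addr_ge0.
move=> t tab; have := Hc t tab; have := Hd t tab.
have := ler_norm (h c); have := ler_norm (- h d); rewrite normrN => h1 h2 h3 h4.
by rewrite ler_norml; apply/andP; split; have := normr_ge0 (h c); have := normr_ge0 (h d); lra.
Qed.

Lemma real_ac_bounded h : real_ac `]a, b[ h ->
  exists2 M : R, 0 <= M & forall t, t \in `]a, b[ -> `|h t| <= M.
Proof.
move=> /real_ac_extension[g /within_continuous_bounded[M M0 HM] gh].
exists M => // t tab; rewrite -gh//; apply: HM.
by move: tab; rewrite !in_itv/= => /andP[/ltW -> /ltW ->].
Qed.

(** By the mean value theorem such an [f] is Lipschitz. This provides the absolute continuity of the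
    lower derivatives, as [in_W] postulates it only for the derivative of order one below the
    top. *)
Lemma bounded_derive1_ac f (M : R) : 0 <= M -> (forall t, t \in `]a, b[ -> derivable f t 1) ->
  (forall t, t \in `]a, b[ -> `|derive1 f t| <= M) -> real_ac `]a, b[ f.
Proof.
move=> M0 df fM e e0; exists (e / (M + 1)); first by rewrite divr_gt0// ltr_wpDl.
move=> s s1 s2 s3.
apply: (@le_lt_trans _ _ ((M + 1) * \sum_(i <- s) (i.2 - i.1))); last first.
  by rewrite mulrC -ltr_pdivlMr// ltr_wpDl.
rewrite mulr_sumr big_seq [leRHS]big_seq; apply: ler_sum => i /s1[i12 /= i1 i2].
apply: (@le_trans _ _ (M * (i.2 - i.1))); last by rewrite ler_wpM2r ?subr_ge0// lerDl.
have sub t : t \in `[i.1, i.2] -> t \in `]a, b[.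
  move: i1 i2; rewrite /= !in_itv/= => /andP[? ?] /andP[? ?] /andP[? ?].
  by apply/andP; split; lra.
have [<-|iN] := eqVneq i.1 i.2; first by rewrite !subrr normr0 mulr0.
have ilt : i.1 < i.2 by rewrite lt_neqAle iN.
have oc t : t \in `]i.1, i.2[ -> t \in `[i.1, i.2].
  by rewrite !in_itv/= => /andP[/ltW -> /ltW ->].
have [||c cab ->] := @MVT R f (derive1 f) i.1 i.2 ilt.
- move=> t tab; rewrite derive1E; apply: derivableP; apply: df; apply: sub; exact: oc.
- apply: derivable_within_continuous => t tab; apply: df; exact: sub.
rewrite normrM (ger0_norm (_ : 0 <= i.2 - i.1)) ?subr_ge0//.
by rewrite ler_wpM2r ?subr_ge0// fM// sub// oc.
Qed.

End open_interval_extension.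

(** * Sobolev functions as primitives *)

Section sobolev_recursion.
Context {R : realType} (a b : R) (p : \bar R).
Hypothesis hab : a < b.
Hypothesis hp : (1 <= p)%E.
Notation leb := (@lebesgue_measure R).
Notation nc := (@ComplexField.Normc.normc R).
Notation Rez := (@complex.Re R).
Notation Imz := (@complex.Im R).
Local Notation I := (`]a, b[%classic : set (measurableTypeR R)).
Local Notation in_W k := (in_W a b k p).
Implicit Types (f g : R -> R[i]) (s k : nat).

Definition cint g (s t : R) : R[i] :=
  Complex (integ (fun x => Rez (g x)) s t) (integ (fun x => Imz (g x)) s t).

Lemma itv_oc (x : R) : x \in `]a, b[ -> x \in `[a, b].
Proof. by rewrite !in_itv/= => /andP[/ltW -> /ltW ->]. Qed.

Lemma derive1n_local s (u v : R -> R) : {in `]a, b[, u =1 v} ->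
  {in `]a, b[, derive1n s u =1 derive1n s v}.
Proof.
elim: s u v => [//|s IH] u v uv t tab.
rewrite !derive1nS !derive1E; apply: near_eq_derive.
have : \forall x \near t, x \in `]a, b[ by apply: near_in_itvoo.
by apply: filterS => x xab; exact: IH.
Qed.

Lemma cderiv_local s f g : {in `]a, b[, f =1 g} -> {in `]a, b[, cderiv s f =1 cderiv s g}.
Proof.
move=> fg t tab; rewrite /cderiv; congr Complex;
by apply: derive1n_local => // x xab; rewrite fg.
Qed.

Lemma derive1n_shift s (u : R -> R) : derive1n s.+1 u = derive1n s (derive1 u).
Proof. by rewrite /derive1n iterSr. Qed.

Lemma cderivS_out s f : cderiv s.+1 f = cderiv 1 (cderiv s f).
Proof. by []. Qed.

Lemma cderivS s f : cderiv s.+1 f = cderiv s (cderiv 1 f).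
Proof.
by apply/funext => t; rewrite /cderiv !derive1n_shift.
Qed.

Lemma cderiv0 f : cderiv 0 f = f.
Proof. by apply/funext => t; rewrite /cderiv/=; case: (f t). Qed.

Lemma cderivable_local f g t : {in `]a, b[, f =1 g} -> t \in `]a, b[ ->
  cderivable f t -> cderivable g t.
Proof.
move=> fg tab [dr di].
have near_ab : \forall x \near t, x \in `]a, b[ by apply: near_in_itvoo.
by split; [apply: near_eq_derivable dr|apply: near_eq_derivable di];
  apply: filterS near_ab => x xab; rewrite fg.
Qed.

Lemma cac_real I' f : absolutely_continuous_on I' f <->
  real_ac I' (fun t => Rez (f t)) /\ real_ac I' (fun t => Imz (f t)).
Proof.
split=> [acf|[acr aci] e e0].
  split=> e e0; have [d d0 Hd] := acf e e0; exists d => // s s1 s2 s3;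
  apply: le_lt_trans (Hd s s1 s2 s3); apply: ler_sum => i _.
    by rewrite -ReB Re_le_nc.
  by rewrite -ImB Im_le_nc.
have e20 : 0 < e / 2 by rewrite divr_gt0.
have [d d0 Hd] := acr _ e20; have [d' d'0 Hd'] := aci _ e20.
exists (Num.min d d'); first by rewrite lt_min d0.
move=> s s1 s2; rewrite lt_min => /andP[s3 s3'].
apply: (@le_lt_trans _ _ (\sum_(i <- s) (`|Rez (f i.2) - Rez (f i.1)| + `|Imz (f i.2) - Imz (f i.1)|))).
  by apply: ler_sum => i _; rewrite -ReB -ImB nc_le_ReIm.
by rewrite big_split/=; have := Hd s s1 s2 s3; have := Hd' s s1 s2 s3'; lra.
Qed.

Definition ccont f := {within `[a, b], continuous (fun t => Rez (f t))} /\
  {within `[a, b], continuous (fun t => Imz (f t))}.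

Lemma ccont_bounded f : ccont f ->
  exists2 M : R, 0 <= M & forall t, t \in `[a, b] -> nc (f t) <= M.
Proof.
move=> [/(within_continuous_bounded hab)[M M0 HM] /(within_continuous_bounded hab)[M' M'0 HM']].
exists (M + M'); first exact: addr_ge0.
by move=> t tab; apply: le_trans (nc_le_ReIm _) _; rewrite lerD ?HM ?HM'.
Qed.

Lemma ccont_cmeas f : ccont f -> cmeas a b f.
Proof.
have H (u : R -> R) : {within `[a, b], continuous u} -> measurable_fun I u.
  move=> cu; apply: (@measurable_funS _ _ _ _ `[a, b]%classic) => //.
    by move=> x /= /itv_oc.
  by apply: subspace_continuous_measurable_fun.
by move=> [? ?]; split; exact: H.
Qed.

Lemma ccont_Lp f : ccont f -> in_Lp a b p f.
Proof.
move=> cf; have [M M0 HM] := ccont_bounded cf.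
have [|//] := @Lpn_bounded R a b p hab hp f M (ccont_cmeas cf) M0.
by move=> t /itv_oc; exact: HM.
Qed.

Lemma Lp_int f : in_Lp a b p f ->
  leb.-integrable `]a, b[ (EFin \o (fun t => Rez (f t))) /\
  leb.-integrable `]a, b[ (EFin \o (fun t => Imz (f t))).
Proof. by move=> iLf; have [C _ /(_ f iLf)[]] := Lpn_L1 hab hp. Qed.

Lemma cint_ccont f g z : in_Lp a b p g ->
  (forall t, t \in `[a, b] -> f t = z + cint g a t) -> ccont f.
Proof.
move=> /Lp_int[ir ii] fE; split.
  apply: (integ_within_continuous (K := Rez z) ir) => t tab.
  by rewrite fE// ReD.
apply: (integ_within_continuous (K := Imz z) ii) => t tab.
by rewrite fE// ImD.
Qed.

Lemma cint_ac f g z : in_Lp a b p g ->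
  (forall t, t \in `[a, b] -> f t = z + cint g a t) -> absolutely_continuous_on `]a, b[ f.
Proof.
move=> /Lp_int[ir ii] fE; apply/cac_real; split.
  apply: (real_ac_integ (K := Rez z) ir) => t /itv_oc tab.
  by rewrite fE// ReD.
apply: (real_ac_integ (K := Imz z) ii) => t /itv_oc tab.
by rewrite fE// ImD.
Qed.

Lemma cint_deriv_ae f g z : in_Lp a b p g ->
  (forall t, t \in `[a, b] -> f t = z + cint g a t) ->
  {ae leb, forall t, t \in `]a, b[ -> cderiv 1 f t = g t}.
Proof.
move=> /Lp_int[ir ii] fE.
have Hr := @ftc_ae R a b (fun t => Rez (f t)) _ (Rez z) ir.
have Hi := @ftc_ae R a b (fun t => Imz (f t)) _ (Imz z) ii.
apply: leb_aeS (leb_aeI (Hr _) (Hi _)).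
- move=> t [h1 h2] tab; have [_ e1] := h1 tab; have [_ e2] := h2 tab.
  by rewrite /cderiv/= e1 e2; case: (g t).
- by move=> t /itv_oc tab; rewrite fE// ReD.
- by move=> t /itv_oc tab; rewrite fE// ImD.
Qed.

Lemma within_cont_at (u : R -> R) t : {within `[a, b], continuous u} -> t \in `]a, b[ ->
  {for t, continuous u}.
Proof.
move=> cu tab; have : {within `]a, b[, continuous u}.
  by apply: continuous_subspaceW cu => x /= /itv_oc.
by rewrite continuous_open_subspace// => /(_ t); apply; rewrite inE.
Qed.

Lemma cint_deriv f g z : ccont g ->
  (forall t, t \in `[a, b] -> f t = z + cint g a t) ->
  forall t, t \in `]a, b[ -> cderivable f t /\ cderiv 1 f t = g t.
Proof.
move=> cg fE t tab; have [ir ii] := Lp_int (ccont_Lp cg).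
have [cr ci] := cg.
have [||d1 e1] := @ftc_continuous R a b (fun t => Rez (f t)) _ (Rez z) ir _ t tab.
- by move=> x /itv_oc xab; rewrite fE// ReD.
- exact: within_cont_at.
have [||d2 e2] := @ftc_continuous R a b (fun t => Imz (f t)) _ (Imz z) ii _ t tab.
- by move=> x /itv_oc xab; rewrite fE// ImD.
- exact: within_cont_at.
split; first exact: (conj d1 d2).
by rewrite /cderiv/= e1 e2; case: (g t).
Qed.

(** Membership in L_p asks for Borel measurability of the classical derivative together with its
    dummy values, which does not follow from its being almost everywhere equal to a measurable
    function. Composition with the clamping [k] extends [f] continuously to the line without
    changing it on [[a, b]]. *)
Lemma cderiv1_meas f : ccont f -> cmeas a b (cderiv 1 f).
Proof.
move=> cf.
pose k t : R := Num.max a (Num.min t b).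
have kE t : t \in `[a, b] -> k t = t.
  by rewrite in_itv/= => /andP[at_ tb]; rewrite /k (min_idPl tb) (max_idPr at_).
have kab t : k t \in `[a, b].
  by rewrite in_itv/= /k le_max lexx/= ge_max (ltW hab)/= ge_min lexx orbT.
have H (u : R -> R) : {within `[a, b], continuous u} -> measurable_fun I (derive1 u).
  move=> cu; have ck : continuous (u \o k).
    move=> x; apply/cvgrPdist_lt => e e0.
    have /within_itv_continuousP/(_ _ (kab x) _ e0)[d d0 Hd] := cu.
    near=> y; apply: Hd => //.
    have kc (v w : R) : v <= w -> `|k v - k w| <= w - v.
      move=> vw; have [h1 h2] := min_contraction b vw.
      have /andP[h3 h4] := max_contraction a h2.
      by rewrite distrC ger0_norm//; rewrite /k; lra.
    have : `|x - y| < d by near: y; exact: cvgr_dist_lt.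
    apply: le_lt_trans; have [xy|/ltW yx] := leP x y.
      by apply: le_trans (kc _ _ xy) _; rewrite distrC ler_norm.
    by rewrite distrC; apply: le_trans (kc _ _ yx) _; rewrite ler_norm.
  apply: (@eq_measurable_fun _ _ _ _ _ (derive1 (u \o k))).
    move=> x; rewrite inE /= => xab.
    by apply: (@derive1n_local 1) => // y /itv_oc yab /=; rewrite kE.
  by apply: measurable_funTS; exact: continuous_measurable_derive1.
by case: cf => cr ci; split; exact: H.
Unshelve. all: by end_near. Qed.

Lemma in_Lp_local f g : {in `]a, b[, f =1 g} -> in_Lp a b p f -> in_Lp a b p g.
Proof.
move=> fg iLf; apply: (proj1 (in_Lp_ae_eq hab hp iLf (cmeas_ext fg (in_Lp_cmeas iLf)) _)).
by apply: aeW => t; exact: fg.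
Qed.

Lemma Lpn_local f g : {in `]a, b[, f =1 g} -> in_Lp a b p f -> Lp_norm a b p g = Lp_norm a b p f.
Proof.
move=> fg iLf; apply/esym/(Lpn_ae_eq hab hp (in_Lp_cmeas iLf) (cmeas_ext fg (in_Lp_cmeas iLf))).
by apply: aeW => t; exact: fg.
Qed.

Lemma in_W_ccont k f : in_W k.+1 f -> ccont f.
Proof. by case. Qed.

(** For [k = 0] the primitive has derivative [g] only almost everywhere; for [k >= 1] the function
    [g] is continuous and the derivative is [g] at every interior point. *)
Lemma W_intro k f g z : in_W k g -> (forall t, t \in `[a, b] -> f t = z + cint g a t) ->
  [/\ in_W k.+1 f, (forall s t, (s < k)%N -> t \in `]a, b[ -> cderiv s.+1 f t = cderiv s g t) &
      {ae leb, forall t, t \in `]a, b[ -> cderiv k.+1 f t = cderiv k g t}].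
Proof.
case: k => [|k] Wg fE.
  have iLg : in_Lp a b p g by [].
  have cf := cint_ccont iLg fE; have [cr ci] := cf.
  have dae := cint_deriv_ae iLg fE.
  split; [| by [] |by rewrite cderiv0].
  split; [exact: cr|exact: ci|by []|by rewrite cderiv0; exact: cint_ac iLg fE|].
  apply: (proj1 (in_Lp_ae_eq hab hp iLg (cderiv1_meas cf) _)).
  by apply: leb_aeS dae => t H tab; rewrite H.
have cg := in_W_ccont Wg.
have fder := cint_deriv cg fE.
have eqd : {in `]a, b[, cderiv 1 f =1 g} by move=> t /fder[].
have eqs s : {in `]a, b[, cderiv s.+1 f =1 cderiv s g}.
  by rewrite cderivS; exact: cderiv_local.
split; [|by move=> s t _; exact: eqs|by apply: aeW => t; exact: eqs].
have [_ _ dg acg iLg] := Wg.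
have [cr ci] := cint_ccont (ccont_Lp cg) fE.
split; [exact: cr|exact: ci| | |].
- case=> [_ t tab|s sk t tab]; first by rewrite cderiv0; case: (fder t tab).
  apply: (@cderivable_local (cderiv s g)) => //; last exact: dg.
  by move=> x xab; rewrite eqs.
- move=> e e0; have [d d0 Hd] := acg e e0; exists d => // l l1 l2 l3.
  apply: le_lt_trans (Hd l l1 l2 l3); rewrite big_seq [leRHS]big_seq.
  by apply: ler_sum => i /l1[_ i1 i2]; rewrite !eqs.
- by apply: in_Lp_local iLg => t tab; rewrite eqs.
Qed.

(** For [k = 0] the derivative itself serves as [g]. For [k >= 1] it must be replaced by its
    continuous extension from []a, b[] to [[a, b]], since [in_W] demands continuity up to the
    endpoints. *)
Lemma W_elim k f : in_W k.+1 f -> exists g,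
  [/\ in_W k g, (forall t, t \in `[a, b] -> f t = f a + cint g a t) &
      forall s t, t \in `]a, b[ -> cderiv s.+1 f t = cderiv s g t].
Proof.
case: k => [|k] Wf.
  have [cr ci _ + iLd] := Wf; rewrite cderiv0 => /cac_real[acr aci].
  exists (cderiv 1 f); split=> //; last by move=> s t _; rewrite cderivS.
  have [ir ii] := Lp_int iLd.
  move=> t tab; apply: complexP; rewrite ?ReD ?ImD.
    by apply: (real_ac_ftc hab acr cr ir) => //; apply: aeW.
  by apply: (real_ac_ftc hab aci ci ii) => //; apply: aeW.
have [cr ci df acd iLd] := Wf.
(* Descending induction on the order: an absolutely continuous derivative is bounded, so the
   derivative of one order less is Lipschitz. *)
have ind s : (s <= k)%N -> absolutely_continuous_on `]a, b[ (cderiv (k.+1 - s) f).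
  elim: s => [|s IH] sk; first by rewrite subn0.
  have /IH /cac_real[acr aci] : (s <= k)%N by exact: ltnW.
  have lts : (k.+1 - s.+1 < k.+1)%N by rewrite subSS ltnS leq_subr.
  have Es : (k.+1 - s = (k.+1 - s.+1).+1)%N by rewrite subSS subSn// ltnW.
  have [M M0 HM] := real_ac_bounded hab acr; have [M' M'0 HM'] := real_ac_bounded hab aci.
  apply/cac_real; split.
    apply: (bounded_derive1_ac M0) => t tab; first exact: (df _ lts t tab).1.
    by have := HM t tab; rewrite Es cderivS_out.
  apply: (bounded_derive1_ac M'0) => t tab; first exact: (df _ lts t tab).2.
  by have := HM' t tab; rewrite Es cderivS_out.
have /cac_real[ac1r ac1i] : absolutely_continuous_on `]a, b[ (cderiv 1 f).
  have := ind k (leqnn k); have -> // : (k.+1 - k)%N = 1%N by rewrite subSn// subnn.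
have [gr cgr grE] := real_ac_extension hab ac1r; have [gi cgi giE] := real_ac_extension hab ac1i.
pose g t := Complex (gr t) (gi t).
have gE : {in `]a, b[, cderiv 1 f =1 g}.
  by move=> t tab; rewrite /g grE// giE//; case: (cderiv 1 f t).
have eqs s : {in `]a, b[, cderiv s.+1 f =1 cderiv s g}.
  by rewrite cderivS; exact: cderiv_local.
have cg : ccont g by [].
have df0 t : t \in `]a, b[ -> cderivable f t.
  by move=> tab; have := df 0%N isT t tab; rewrite cderiv0.
exists g; split; last by move=> s t; exact: eqs.
- split; [exact: cgr|exact: cgi| | |].
  + by move=> s sk t tab; apply: (@cderivable_local (cderiv s.+1 f)) => //; exact: df.
  + move=> e e0; have [d d0 Hd] := acd e e0; exists d => // l l1 l2 l3.
    apply: le_lt_trans (Hd l l1 l2 l3); rewrite big_seq [leRHS]big_seq.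
    by apply: ler_sum => i /l1[_ i1 i2]; rewrite !eqs.
  + by apply: in_Lp_local iLd => t tab; rewrite eqs.
- have [ir ii] := Lp_int (ccont_Lp cg).
  have [M M0 HM] := ccont_bounded cg.
  move=> t tab; apply: complexP; rewrite ?ReD ?ImD.
    apply: (real_ac_ftc hab _ cr ir) => //; last first.
      by apply: aeW => x xab _; have := gE x xab; rewrite /cderiv/= => -[->].
    apply: (bounded_derive1_ac M0) => x xab; first exact: (df0 x xab).1.
    have := gE x xab; rewrite /cderiv/= => -[-> _].
    by apply: le_trans (HM x (itv_oc xab)); exact: (Re_le_nc (g x)).
  apply: (real_ac_ftc hab _ ci ii) => //; last first.
    by apply: aeW => x xab _; have := gE x xab; rewrite /cderiv/= => -[_ ->].
  apply: (bounded_derive1_ac M0) => x xab; first exact: (df0 x xab).2.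
  have := gE x xab; rewrite /cderiv/= => -[_ ->].
  by apply: le_trans (HM x (itv_oc xab)); exact: (Im_le_nc (g x)).
Qed.

End sobolev_recursion.

Section sobolev_norm.
Context {R : realType} (a b : R) (p : \bar R).
Hypothesis hab : a < b.
Hypothesis hp : (1 <= p)%E.
Notation leb := (@lebesgue_measure R).
Notation nc := (@ComplexField.Normc.normc R).
Notation Rez := (@complex.Re R).
Notation Imz := (@complex.Im R).
Local Notation Lpn := (Lpn a b p).
Local Notation in_W k := (in_W a b k p).
Local Notation W_norm k := (W_norm a b k p).
Implicit Types (f g : R -> R[i]) (s k : nat).

Definition Wn k f : R := fine (W_norm k f).

Lemma W_Lp k f : in_W k f -> in_Lp a b p f.
Proof. by case: k => [//|k] Wf; apply: (ccont_Lp hab hp (in_W_ccont Wf)). Qed.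

Lemma W_cderiv_Lp k f s : in_W k f -> (s <= k)%N -> in_Lp a b p (cderiv s f).
Proof.
elim: k s f => [|k IH] [|s] f Wf // sk.
- by rewrite cderiv0.
- by rewrite cderiv0; exact: W_Lp Wf.
have [g [Wg _ gE]] := W_elim hab hp Wf.
by apply: (in_Lp_local hab hp _ (IH s g Wg sk)) => t tab; rewrite gE.
Qed.

Lemma W_norm_fin k f : in_W k f -> W_norm k f = (\sum_(s < k.+1) Lpn (cderiv s f))%:E.
Proof.
move=> Wf; rewrite /Defs.W_norm -sumEFin; apply: eq_bigr => s _.
by rewrite LpnE//; apply: W_cderiv_Lp Wf _; rewrite -ltnS.
Qed.

Lemma WnE k f : in_W k f -> W_norm k f = (Wn k f)%:E.
Proof. by move=> Wf; rewrite /Wn W_norm_fin. Qed.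

Lemma Wn_sum k f : in_W k f -> Wn k f = \sum_(s < k.+1) Lpn (cderiv s f).
Proof. by move=> Wf; rewrite /Wn W_norm_fin. Qed.

Lemma Wn_ge0 k f : 0 <= Wn k f.
Proof. by rewrite fine_ge0// sume_ge0// => s _; exact: Lnorm_ge0. Qed.

Lemma Wn0 f : in_W 0 f -> Wn 0 f = Lpn f.
Proof. by move=> Wf; rewrite Wn_sum// big_ord1 cderiv0. Qed.

(** The derivatives of [f] are almost everywhere those of [g] of one order less. Because of this
    splitting of the norm the inductions on [k] deal with primitives rather than with high
    derivatives. *)
Lemma WnS k f g z : in_W k g -> (forall t, t \in `[a, b] -> f t = z + cint g a t) ->
  in_W k.+1 f /\ Wn k.+1 f = Lpn f + Wn k g.
Proof.
move=> Wg fE; have [Wf d1 d2] := W_intro hab hp Wg fE; split=> //.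
rewrite !Wn_sum// big_ord_recl cderiv0; congr (_ + _).
apply: eq_bigr => s _; rewrite /Lpn /=.
have mg : cmeas a b (cderiv s g) by apply/in_Lp_cmeas/(W_cderiv_Lp Wg); rewrite -ltnS.
have mf : cmeas a b (cderiv s.+1 f) by apply/in_Lp_cmeas/(W_cderiv_Lp Wf); exact: ltn_ord.
congr fine; apply: (Lpn_ae_eq hab hp mf mg).
have [sk|] := ltnP s k; first by apply: aeW => t; exact: d1.
move=> ks; have {ks}-> : s = k :> nat by apply/eqP; rewrite eqn_leq ks -ltnS ltn_ord.
exact: d2.
Qed.

Lemma W_elimN k f : in_W k.+1 f -> exists g,
  [/\ in_W k g, (forall t, t \in `[a, b] -> f t = f a + cint g a t),
      (forall s t, t \in `]a, b[ -> cderiv s.+1 f t = cderiv s g t) &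
      Wn k.+1 f = Lpn f + Wn k g].
Proof.
move=> Wf; have [g [Wg gE dE]] := W_elim hab hp Wf; exists g; split=> //.
by have [] := WnS Wg gE.
Qed.

Lemma cint0 g t : cint g t t = 0.
Proof. by rewrite /cint !integ_ge. Qed.

Lemma cint_lin z f g t : in_Lp a b p f -> in_Lp a b p g -> t \in `[a, b] ->
  cint (fun t => z * f t + g t) a t = z * cint f a t + cint g a t.
Proof.
move=> iLf iLg; rewrite in_itv/= => /andP[at_ tb].
have [fr fi] := Lp_int hab hp iLf; have [gr gi] := Lp_int hab hp iLg.
have sub u : leb.-integrable `]a, b[ (EFin \o u) -> leb.-integrable `]a, t[ (EFin \o u).
  by move=> iu; apply: integrable_sub iu _ _.
apply: complexP; rewrite ?ReD ?ImD ?ReM ?ImM /cint/=.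
  rewrite (@integ_eq _ _ (fun x => Rez z * Rez (f x) + - Imz z * Imz (f x) + Rez (g x))); last first.
    by move=> x _; rewrite ReD ReM mulNr.
  rewrite integD; [|apply: integrableD'; apply: integrableZ'; exact: sub|exact: sub].
  rewrite integD; [|apply: integrableZ'; exact: sub..].
  by rewrite !integZ ?mulNr//; exact: sub.
rewrite (@integ_eq _ _ (fun x => Rez z * Imz (f x) + Imz z * Rez (f x) + Imz (g x))); last first.
  by move=> x _; rewrite ImD ImM.
rewrite integD; [|apply: integrableD'; apply: integrableZ'; exact: sub|exact: sub].
rewrite integD; [|apply: integrableZ'; exact: sub..].
by rewrite !integZ//; exact: sub.
Qed.

Lemma W_congr k f g : {in `[a, b], f =1 g} -> in_W k f -> in_W k g /\ Wn k g = Wn k f.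
Proof.
move=> fg; have fgo : {in `]a, b[, f =1 g} by move=> t /itv_oc; exact: fg.
case: k => [|k] Wf.
  have Wg := in_Lp_local hab hp fgo Wf; split=> //.
  by rewrite !Wn0// /Lpn (Lpn_local hab hp fgo Wf).
have [h [Wh fE _ ->]] := W_elimN Wf.
have gE t : t \in `[a, b] -> g t = f a + cint h a t by move=> tab; rewrite -fg// fE.
have [Wg ->] := WnS Wh gE; split=> //.
by rewrite /Lpn (Lpn_local hab hp fgo (W_Lp Wf)).
Qed.

(** The derivative of top order is linear only almost everywhere, because dummy values at points of
    non-differentiability are not additive. *)
Lemma W_lin k z f g : in_W k f -> in_W k g ->
  [/\ in_W k (fun t => z * f t + g t),
      Wn k (fun t => z * f t + g t) <= nc z * Wn k f + Wn k g,
      (forall s t, (s < k)%N -> t \in `]a, b[ ->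
         cderiv s (fun t => z * f t + g t) t = z * cderiv s f t + cderiv s g t) &
      {ae leb, forall t, t \in `]a, b[ ->
         cderiv k (fun t => z * f t + g t) t = z * cderiv k f t + cderiv k g t}].
Proof.
elim: k f g => [|k IH] f g Wf Wg.
  have [i1 i2] := LpnZ hab hp z Wf; have [i3 i4] := LpnD hab hp i1 Wg.
  split=> //; first by rewrite !Wn0// -i2.
  by apply: aeW => t _; rewrite !cderiv0.
have [f1 [Wf1 fE fd fN]] := W_elimN Wf; have [g1 [Wg1 gE gd gN]] := W_elimN Wg.
have [Wh hN hd hae] := IH f1 g1 Wf1 Wg1.
have hE t : t \in `[a, b] -> z * f t + g t = (z * f a + g a) + cint (fun t => z * f1 t + g1 t) a t.
  move=> tab; rewrite cint_lin//; [|exact: W_Lp Wf1|exact: W_Lp Wg1].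
  by rewrite fE// gE// mulrDr addrACA.
have [Whi dh daeh] := W_intro hab hp Wh hE; have [_ hNi] := WnS Wh hE.
have [i1 i2] := LpnZ hab hp z (W_Lp Wf); have [i3 i4] := LpnD hab hp i1 (W_Lp Wg).
split=> //.
- rewrite hNi fN gN mulrDr addrACA lerD// -i2//.
- case=> [t _ tab|s t sk tab]; first by rewrite !cderiv0.
  by rewrite dh// hd// fd// gd.
by apply: leb_aeS (leb_aeI daeh hae) => t [h1 h2] tab; rewrite h1// h2// fd// gd.
Qed.

Lemma cint_zero t : a <= t -> cint (fun=> 0) a t = 0.
Proof. by move=> at_; rewrite /cint/= !integ_cst// mul0r. Qed.

Lemma Lpn_zero : Lpn (fun=> 0) = 0.
Proof.
have iL := (Lpn_bounded hab hp (cmeas_cst a b 1) (nc_ge0 1) (fun t _ => lexx _)).1.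
have [_] := LpnZ hab hp 0 iL; rewrite nc0 mul0r.
by move=> ->; rewrite mul0r.
Qed.

Lemma W_cst k z : in_W k (fun=> z) /\ Wn k (fun=> 0) = 0.
Proof.
elim: k z => [z|k IH z].
  have iL c := (Lpn_bounded hab hp (cmeas_cst a b c) (nc_ge0 c) (fun t _ => lexx _)).1.
  by split; [exact: iL|rewrite Wn0 ?Lpn_zero//; exact: iL].
have E c t : t \in `[a, b] -> c = c + cint (fun=> 0) a t.
  by rewrite in_itv/= => /andP[at_ _]; rewrite cint_zero// addr0.
have [_ H0] := IH 0.
have [Wz _] := WnS (IH 0).1 (E z); split=> //.
by have [_ ->] := WnS (IH 0).1 (E 0); rewrite H0 Lpn_zero addr0.
Qed.

Lemma WD k f g : in_W k f -> in_W k g ->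
  in_W k (fun t => f t + g t) /\ Wn k (fun t => f t + g t) <= Wn k f + Wn k g.
Proof.
move=> Wf Wg; have [] := W_lin 1 Wf Wg; rewrite nc1 mul1r.
by under eq_fun do rewrite mul1r.
Qed.

Lemma WZ k z f : in_W k f ->
  in_W k (fun t => z * f t) /\ Wn k (fun t => z * f t) <= nc z * Wn k f.
Proof.
move=> Wf; have [W0 Wn00] := W_cst k 0.
have [h1 h2 _ _] := W_lin z Wf W0; rewrite Wn00 addr0 in h2.
have E : (fun t => z * f t) = (fun t => z * f t + 0) by apply/funext => t; rewrite addr0.
by rewrite E.
Qed.

Lemma WB k f g : in_W k f -> in_W k g ->
  in_W k (fun t => f t - g t) /\ Wn k (fun t => f t - g t) <= Wn k f + Wn k g.
Proof.
move=> Wf Wg; have [h1 h2 _ _] := W_lin (-1) Wg Wf; rewrite ncN nc1 mul1r addrC in h2.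
by have -> : (fun t => f t - g t) = (fun t => -1 * g t + f t) by
  apply/funext => t; rewrite mulN1r addrC.
Qed.

Lemma W_sum k (J : Type) (s : seq J) (F : J -> R -> R[i]) : (forall j, in_W k (F j)) ->
  in_W k (fun t => \sum_(j <- s) F j t) /\
  Wn k (fun t => \sum_(j <- s) F j t) <= \sum_(j <- s) Wn k (F j).
Proof.
move=> WF; elim: s => [|j s [IH1 IH2]].
  have [W0 Wn00] := W_cst k 0; rewrite big_nil.
  by have -> : (fun t => \sum_(j <- [::]) F j t) = (fun=> 0) by
    [apply/funext => t; rewrite big_nil]; rewrite Wn00.
have -> : (fun t => \sum_(j <- j :: s) F j t) = (fun t => F j t + \sum_(j <- s) F j t).
  by apply/funext => t; rewrite big_cons.
have [h1 h2] := WD (WF j) IH1; split=> //; rewrite big_cons.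
by apply: le_trans h2 _; rewrite lerD2l.
Qed.

Lemma W_le k f : in_W k.+1 f -> in_W k f /\ Wn k f <= Wn k.+1 f.
Proof.
elim: k f => [|k IH] f Wf; have [g [Wg fE _ ->]] := W_elimN Wf.
  by have Lf := W_Lp Wf; split=> //; rewrite Wn0// lerDl Wn_ge0.
have [Wg' gN] := IH g Wg; have [? ->] := WnS Wg' fE.
by split=> //; rewrite lerD2l.
Qed.

Lemma W_leq k l f : (k <= l)%N -> in_W l f -> in_W k f /\ Wn k f <= Wn l f.
Proof.
move=> kl; rewrite -(subnK kl); elim: (l - k)%N => [//|d IH]; rewrite addSn => /W_le[Wf fN].
by have [? H] := IH Wf; split=> //; exact: le_trans fN.
Qed.

(** Real and imaginary parts are estimated separately, whence the factor 2. *)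
Lemma cint_le g (s t : R) : in_Lp a b p g -> a <= s -> s <= t -> t <= b ->
  nc (cint g s t) <= 2 * integ (fun x => nc (g x)) s t.
Proof.
move=> iLg as_ st tb; have [C _ /(_ g iLg)[gr gi gn _]] := Lpn_L1 hab hp.
have sub u : leb.-integrable `]a, b[ (EFin \o u) -> leb.-integrable `]s, t[ (EFin \o u).
  by move=> iu; apply: integrable_sub iu _ _.
apply: le_trans (nc_le_ReIm _) _; rewrite /cint/= mulr_natl mulr2n; apply: lerD.
  apply: le_trans (integ_le_norm (sub _ gr)) _; apply: integ_le => [||x _ _].
  - exact: integrable_normr (sub _ gr).
  - exact: sub.
  - exact: Re_le_nc.
apply: le_trans (integ_le_norm (sub _ gi)) _; apply: integ_le => [||x _ _].
- exact: integrable_normr (sub _ gi).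
- exact: sub.
- exact: Im_le_nc.
Qed.

Lemma integ_nc_le g (s t : R) : in_Lp a b p g -> a <= s -> s <= t -> t <= b ->
  integ (fun x => nc (g x)) s t <= integ (fun x => nc (g x)) a b.
Proof.
move=> iLg as_ st tb; have [C _ /(_ g iLg)[_ _ gn _]] := Lpn_L1 hab hp.
have sub u v : a <= u -> v <= b -> leb.-integrable `]u, v[ (EFin \o (fun x => nc (g x))).
  by move=> au vb; apply: integrable_sub gn _ _.
have ge0 u v : 0 <= integ (fun x => nc (g x)) u v by apply: integ_ge0 => *; exact: nc_ge0.
rewrite (@integ_cat _ _ a s b)//; last exact: le_trans tb.
rewrite (@integ_cat _ _ s t b)//; last exact: sub.
by rewrite addrCA lerDl addr_ge0.
Qed.

(** The bound of [f t] by [f x] plus an integral of the derivative is integrated over all [x]. The 4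
    comes from two integrals starting at [a], each costing the factor 2 of [cint_le]. The constant
    does not depend on [k]. *)
Lemma W_sup : exists2 C : R, 0 <= C & forall k f, in_W k.+1 f ->
  forall t, t \in `[a, b] -> nc (f t) <= C * Wn k.+1 f.
Proof.
have [C C0 HC] := Lpn_L1 hab hp.
have ba0 : 0 < b - a by rewrite subr_gt0.
have ic (c : R) : leb.-integrable `]a, b[ (EFin \o (fun=> c)).
  by apply: (@integrable_bounded R (fun=> c) a b `|c|) => //; exact: measurable_cst.
exists (C / (b - a) + 4 * C); first by rewrite addr_ge0 ?divr_ge0 ?mulr_ge0 ?ltW.
move=> k f Wf t tab; have [g [Wg fE _ ->]] := W_elimN Wf.
have Lg := W_Lp Wg; have Lf := W_Lp Wf.
have [_ _ fn fle] := HC f Lf; have [_ _ gn gle] := HC g Lg.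
have Wg0 := Wn_ge0 k g; have Lf0 := Lpn_ge0 a b p f.
have Lgle : Lpn g <= Wn k g.
  by have [W0 H] := W_leq (leq0n k) Wg; rewrite -Wn0.
have key x : x \in `[a, b] -> nc (f t) <= nc (f x) + 4 * (C * Lpn g).
  move=> xab; have -> : f t = f x + (cint g a t - cint g a x).
    by rewrite [f t]fE// [f x]fE//; ring.
  apply: le_trans (ncD _ _) _; rewrite lerD2l; apply: le_trans (ncB _ _) _.
  have H y : y \in `[a, b] -> nc (cint g a y) <= 2 * (C * Lpn g).
    rewrite in_itv/= => /andP[ay yb]; apply: le_trans (cint_le Lg (lexx _) ay yb) _.
    by rewrite ler_pM2l//; apply: le_trans (integ_nc_le Lg (lexx _) ay yb) _.
  have := H _ tab; have := H _ xab; lra.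
have : nc (f t) * (b - a) <= C * Lpn f + 4 * (C * Lpn g) * (b - a).
  rewrite -(@integ_cst R a b (nc (f t)) (ltW hab)) -(@integ_cst R a b (4 * _) (ltW hab)).
  apply: (@le_trans _ _ (integ (fun x => nc (f x) + 4 * (C * Lpn g)) a b)).
    apply: integ_le => [||x ax xb].
    - exact: ic.
    - exact: integrableD'.
    - by apply: key; rewrite in_itv/= !ltW.
  by rewrite integD// lerD2r.
rewrite -ler_pdivlMr// mulrDl (mulfK (lt0r_neq0 ba0)) => H; apply: le_trans H _.
rewrite [leRHS]mulrDl; apply: lerD.
  by rewrite mulrAC ler_wpM2l ?divr_ge0 ?lerDl// ltW.
rewrite -mulrA ler_pM2l// ler_pM2l//; apply: le_trans Lgle _.
by rewrite lerDr.
Qed.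

End sobolev_norm.

(** * Integration by parts and products of Sobolev functions *)

Section integration_by_parts.
Context {R : realType} (a b : R).
Hypothesis hab : a < b.
Notation leb := (@lebesgue_measure R).
Implicit Types u v : R -> R.

Lemma real_acM (I : set R) u v (K : R) : 0 <= K -> (forall t, I t -> `|u t| <= K) ->
  (forall t, I t -> `|v t| <= K) -> real_ac I u -> real_ac I v -> real_ac I (fun t => u t * v t).
Proof.
move=> K0 uK vK acu acv eps eps0.
have e0 : 0 < eps / (2 * (K + 1)) by rewrite divr_gt0// mulr_gt0// ltr_wpDl.
have [d1 d10 H1] := acu _ e0; have [d2 d20 H2] := acv _ e0.
exists (Num.min d1 d2); first by rewrite lt_min d10.
move=> s s1 s2; rewrite lt_min => /andP[s3 s4].
have h1 := H1 s s1 s2 s3; have h2 := H2 s s1 s2 s4.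
apply: (@le_lt_trans _ _ (\sum_(i <- s) (K * `|u i.2 - u i.1| + K * `|v i.2 - v i.1|))).
  rewrite big_seq_cond [leRHS]big_seq_cond; apply: ler_sum => i; rewrite andbT => /s1[_ i1 i2].
  have -> : u i.2 * v i.2 - u i.1 * v i.1 = (u i.2 - u i.1) * v i.2 + u i.1 * (v i.2 - v i.1).
    by ring.
  apply: le_trans (ler_normD _ _) _; rewrite !normrM; apply: lerD.
    by rewrite mulrC ler_wpM2r// vK.
  by rewrite ler_wpM2r// uK.
rewrite big_split/= -!mulr_sumr.
set S1 := \sum_(_ <- _) _ in h1 *; set S2 := \sum_(_ <- _) _ in h2 *.
have K1 : 0 < K + 1 by rewrite ltr_wpDl.
rewrite invfM mulrA ltr_pdivlMr// in h1.
rewrite invfM mulrA ltr_pdivlMr// in h2.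
have S10 : 0 <= S1 by rewrite sumr_ge0.
have S20 : 0 <= S2 by rewrite sumr_ge0.
clear -h1 h2 S10 S20; nra.
Qed.

Lemma integrableM_bounded u v : leb.-integrable `]a, b[ (EFin \o u) ->
  {within `[a, b], continuous v} -> leb.-integrable `]a, b[ (EFin \o (fun t => u t * v t)).
Proof.
move=> iu cv; have [K K0 HK] := within_continuous_bounded hab cv.
have iKu := integrableZ' K iu.
apply: (le_integrable _ _ _ iKu) => //.
  apply/measurable_EFinP; apply: measurable_funM; first exact: integrable_measurable iu.
  apply: (@measurable_funS _ _ _ _ `[a, b]%classic) => //.
    by move=> x /= /itv_oc.
  by apply: subspace_continuous_measurable_fun.
move=> x /= /itv_oc xab; rewrite lee_fin !normrM mulrC (ger0_norm K0).
by rewrite ler_wpM2r// HK.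
Qed.

(** The product is absolutely continuous and almost everywhere has the derivative given by the
    Leibniz rule, so the fundamental theorem of calculus applies to it. *)
Lemma integ_by_parts u v u1 v1 :
  leb.-integrable `]a, b[ (EFin \o u1) -> leb.-integrable `]a, b[ (EFin \o v1) ->
  (forall t, t \in `[a, b] -> u t = u a + integ u1 a t) ->
  (forall t, t \in `[a, b] -> v t = v a + integ v1 a t) ->
  forall t, t \in `[a, b] -> u t * v t = u a * v a + integ (fun x => u1 x * v x + v1 x * u x) a t.
Proof.
move=> iu iv uE vE.
have cu := integ_within_continuous iu uE; have cv := integ_within_continuous iv vE.
have uE' t : t \in `]a, b[ -> u t = u a + integ u1 a t by move=> /itv_oc; exact: uE.
have vE' t : t \in `]a, b[ -> v t = v a + integ v1 a t by move=> /itv_oc; exact: vE.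
have acu := real_ac_integ iu uE'; have acv := real_ac_integ iv vE'.
have [Ku Ku0 HKu] := within_continuous_bounded hab cu.
have [Kv Kv0 HKv] := within_continuous_bounded hab cv.
apply: (@real_ac_ftc R a b (fun t => u t * v t) _ hab).
- apply: (@real_acM _ _ _ (Ku + Kv)) => //; first exact: addr_ge0.
    by move=> t /itv_oc tab; apply: le_trans (HKu _ tab) _; rewrite lerDl.
  by move=> t /itv_oc tab; apply: le_trans (HKv _ tab) _; rewrite lerDr.
- by move=> x; apply: (@continuousM R (subspace `[a, b])); [exact: cu|exact: cv].
- by apply: integrableD'; exact: integrableM_bounded.
apply: leb_aeS (leb_aeI (ftc_ae iu uE') (ftc_ae iv vE')) => t [h1 h2] tab _.
have [d1 e1] := h1 tab; have [d2 e2] := h2 tab.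
rewrite derive1E (deriveM d1 d2) -!derive1E e1 e2 addrC; congr (_ + _); exact: mulrC.
Qed.

End integration_by_parts.

Section sobolev_product.
Context {R : realType} (a b : R) (p : \bar R).
Hypothesis hab : a < b.
Hypothesis hp : (1 <= p)%E.
Notation leb := (@lebesgue_measure R).
Notation Rez := (@complex.Re R).
Notation Imz := (@complex.Im R).
Local Notation Wn := (Wn a b p).
Local Notation in_W k := (in_W a b k p).
Implicit Types (f g : R -> R[i]) (k : nat).

Lemma cint_by_parts f g f1 g1 : in_Lp a b p f1 -> in_Lp a b p g1 ->
  (forall t, t \in `[a, b] -> f t = f a + cint f1 a t) ->
  (forall t, t \in `[a, b] -> g t = g a + cint g1 a t) ->
  forall t, t \in `[a, b] -> f t * g t = f a * g a + cint (fun x => f1 x * g x + g1 x * f x) a t.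
Proof.
move=> Lf Lg fE gE t tab.
have [fr fi] := Lp_int hab hp Lf; have [gr gi] := Lp_int hab hp Lg.
have fEr s : s \in `[a, b] -> Rez (f s) = Rez (f a) + integ (Rez \o f1) a s.
  by move=> sab; rewrite fE// ReD.
have fEi s : s \in `[a, b] -> Imz (f s) = Imz (f a) + integ (Imz \o f1) a s.
  by move=> sab; rewrite fE// ImD.
have gEr s : s \in `[a, b] -> Rez (g s) = Rez (g a) + integ (Rez \o g1) a s.
  by move=> sab; rewrite gE// ReD.
have gEi s : s \in `[a, b] -> Imz (g s) = Imz (g a) + integ (Imz \o g1) a s.
  by move=> sab; rewrite gE// ImD.
have cfr := integ_within_continuous fr fEr; have cfi := integ_within_continuous fi fEi.
have cgr := integ_within_continuous gr gEr; have cgi := integ_within_continuous gi gEi.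
have tb : t <= b by move: tab; rewrite in_itv/= => /andP[].
have M u v : leb.-integrable `]a, b[ (EFin \o u) -> {within `[a, b], continuous v} ->
    leb.-integrable `]a, t[ (EFin \o (fun t => u t * v t)).
  by move=> iu cv; apply: (integrable_sub (integrableM_bounded hab iu cv)).
have D u u' v v' : leb.-integrable `]a, b[ (EFin \o u) -> {within `[a, b], continuous v} ->
   leb.-integrable `]a, b[ (EFin \o u') -> {within `[a, b], continuous v'} ->
   leb.-integrable `]a, t[ (EFin \o (fun t => u t * v t + u' t * v' t)).
  by move=> *; apply: integrableD'; exact: M.
apply: complexP; rewrite ?ReD ?ImD ?ReM ?ImM /cint/=.
  rewrite (integ_by_parts hab fr gr fEr gEr tab) (integ_by_parts hab fi gi fEi gEi tab).
  rewrite opprD addrACA; congr (_ + _).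
  rewrite -integB ?D//; congr (integ _ _ _).
  by apply/funext => x; rewrite ReD !ReM/=; ring.
rewrite (integ_by_parts hab fr gi fEr gEi tab) (integ_by_parts hab fi gr fEi gEr tab).
rewrite addrACA; congr (_ + _).
rewrite -integD ?D//; congr (integ _ _ _).
by apply/funext => x; rewrite ImD !ImM/=; ring.
Qed.

(** L_p is not closed under products, so for [k = 0] the second factor must be bounded; [maxn k 1]
    covers this case uniformly. In the equation it is always available: the coefficients lie in W^n
    and the derivatives of order below r lie at least in W^(n+1). *)
Lemma WM k : exists2 C : R, 0 <= C & forall f g, in_W k f -> in_W (maxn k 1) g ->
  in_W k (fun t => f t * g t) /\ Wn k (fun t => f t * g t) <= C * (Wn k f * Wn (maxn k 1) g).
Proof.
have [C C0 supC] := W_sup hab hp.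
elim: k => [|k [C' C'0 IH]].
  exists C => // f g Wf; rewrite (_ : maxn 0 1 = 1%N)// => Wg.
  have [] := @LpnM R a b p hab hp f g (C * Wn 1 g) Wf (ccont_cmeas (in_W_ccont Wg)) _ _.
  - by rewrite mulr_ge0// Wn_ge0.
  - by move=> t /itv_oc tab; apply: supC.
  move=> W1 W2; split=> //; rewrite !Wn0//; apply: le_trans W2 _.
  by rewrite mulrAC mulrA.
exists (C + C' + C'); first by rewrite !addr_ge0.
move=> f g Wf; rewrite (maxn_idPl (ltn0Sn k)) => Wg.
have [f1 [Wf1 fE _ fN]] := W_elimN hab hp Wf.
have [g1 [Wg1 gE _ gN]] := W_elimN hab hp Wg.
have km : (maxn k 1 <= k.+1)%N by rewrite geq_max leqnSn.
have [Wgm gm] := W_leq hab hp km Wg; have [Wfm fm] := W_leq hab hp km Wf.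
have [P1 P2] := IH f1 g Wf1 Wgm; have [Q1 Q2] := IH g1 f Wg1 Wfm.
have [S1 S2] := WD hab hp P1 Q1.
have [T1 ->] := WnS hab hp S1 (cint_by_parts (W_Lp hab hp Wf1) (W_Lp hab hp Wg1) fE gE).
split=> //.
have [_ U] := @LpnM R a b p hab hp f g (C * Wn k.+1 g) (W_Lp hab hp Wf)
   (ccont_cmeas (in_W_ccont Wg)) (mulr_ge0 C0 (Wn_ge0 _ _ _ _ _)) (fun t tab => supC k g Wg t (itv_oc tab)).
have f0 := Wn_ge0 a b p k.+1 f; have g0 := Wn_ge0 a b p k.+1 g.
have f10 := Wn_ge0 a b p k f1; have g10 := Wn_ge0 a b p k g1.
have gm0 := Wn_ge0 a b p (maxn k 1) g; have fm0 := Wn_ge0 a b p (maxn k 1) f.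
have Lf0 := Lpn_ge0 a b p f; have Lg0 := Lpn_ge0 a b p g.
rewrite [leRHS]mulrDl [X in _ <= X + _]mulrDl -addrA; apply: lerD.
  apply: le_trans U _; rewrite -mulrA ler_wpM2l// mulrC ler_wpM2r//.
  by rewrite fN lerDl.
apply: le_trans S2 _; apply: lerD.
  apply: le_trans P2 _; rewrite ler_wpM2l// ler_pM// fN lerDr//.
apply: le_trans Q2 _; rewrite ler_wpM2l// mulrC ler_pM// gN lerDr//.
Qed.

End sobolev_product.

(** * Geometric convergence and completeness of Sobolev spaces *)

Section geometric_sequences.
Context {R : realType}.
Notation nc := (@ComplexField.Normc.normc R).
Variables (K q : R).
Hypotheses (q0 : 0 < q) (q1 : q < 1) (K0 : 0 <= K).

Lemma geometric_chain (e : nat -> R) n : e 0%N <= 0 ->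
  (forall k, e k.+1 <= e k + K * q ^+ (n + k)) -> forall k, e k <= K / (1 - q) * q ^+ n.
Proof.
move=> e0 eS k; apply: (@le_trans _ _ (\sum_(i < k) K * q ^+ (n + i))).
  elim: k => [|k IH]; first by rewrite big_ord0.
  by apply: le_trans (eS k) _; rewrite big_ord_recr/= lerD2r.
under eq_bigr do rewrite exprD mulrA; rewrite -mulr_sumr -mulrA [X in _ <= X]mulrAC.
rewrite mulrA ler_wpM2l//; last exact: geometric_sum_le.
by rewrite mulr_ge0// exprn_ge0// (ltW q0).
Qed.

(** The interval of radius [K / (1 - q) * q ^+ n] about [u_ n] contains all later terms, so any two
    of these intervals meet; the supremum of their left ends lies in all of them. *)
Lemma normr_geometric_cvg (u_ : nat -> R) : (forall n, `|u_ n.+1 - u_ n| <= K * q ^+ n) ->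
  exists l, forall n, `|l - u_ n| <= K / (1 - q) * q ^+ n.
Proof.
move=> uK; pose S := [set y | exists n, y = u_ n - K / (1 - q) * q ^+ n].
have chain n k : `|u_ (n + k)%N - u_ n| <= K / (1 - q) * q ^+ n.
  apply: (@geometric_chain (fun k => `|u_ (n + k)%N - u_ n|)) => [|{}k].
    by rewrite addn0 subrr normr0.
  rewrite addnS [leRHS]addrC (_ : u_ _ - u_ n = (u_ (n + k).+1 - u_ (n + k)%N) + (u_ (n + k)%N - u_ n)).
    by apply: le_trans (ler_normD _ _) _; rewrite lerD2r.
  by ring.
have ubS n : ubound S (u_ n + K / (1 - q) * q ^+ n).
  move=> _ [m ->]; case: (leqP n m) => [nm|/ltnW mn].
    have := chain n (m - n)%N; rewrite subnKC// ler_norml => /andP[_ h].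
    have : 0 <= K / (1 - q) * q ^+ m.
      by rewrite mulr_ge0 ?exprn_ge0 ?divr_ge0 ?subr_ge0// ltW.
    lra.
  have := chain m (n - m)%N; rewrite subnKC// ler_norml => /andP[h _].
  have : 0 <= K / (1 - q) * q ^+ n.
    by rewrite mulr_ge0 ?exprn_ge0 ?divr_ge0 ?subr_ge0// ltW.
  lra.
have S0 : S !=set0 by exists (u_ 0%N - K / (1 - q) * q ^+ 0); exists 0%N.
exists (sup S) => n; rewrite ler_distl; apply/andP; split.
  by apply: ub_le_sup; [exists (u_ 0%N + K / (1 - q) * q ^+ 0); exact: ubS|exists n].
by apply: ge_sup => // _ y; exact: ubS.
Qed.

Lemma nc_geometric_cvg (z_ : nat -> R[i]) : (forall n, nc (z_ n.+1 - z_ n) <= K * q ^+ n) ->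
  exists z, forall n, nc (z - z_ n) <= 2 * (K / (1 - q)) * q ^+ n.
Proof.
move=> zK.
have [|x Hx] := @normr_geometric_cvg (fun n => complex.Re (z_ n)).
  by move=> n; rewrite -ReB; apply: le_trans (Re_le_nc _) _.
have [|y Hy] := @normr_geometric_cvg (fun n => complex.Im (z_ n)).
  by move=> n; rewrite -ImB; apply: le_trans (Im_le_nc _) _.
exists (Complex x y) => n; apply: le_trans (nc_le_ReIm _) _; rewrite ReB ImB/=.
by rewrite -mulrA mulr_natl mulr2n lerD.
Qed.

End geometric_sequences.

Section sobolev_complete.
Context {R : realType} (a b : R) (p : \bar R).
Hypothesis hab : a < b.
Hypothesis hp : (1 <= p)%E.
Notation nc := (@ComplexField.Normc.normc R).
Local Notation Lpn := (Lpn a b p).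
Local Notation Wn := (Wn a b p).
Local Notation in_W k := (in_W a b k p).
Implicit Types (f g : R -> R[i]) (k : nat).

Lemma cint_sup : exists2 C : R, 0 <= C & forall g, in_Lp a b p g ->
  forall t, t \in `[a, b] -> nc (cint g a t) <= C * Lpn g.
Proof.
have [C C0 HC] := Lpn_L1 hab hp; exists (2 * C); first by rewrite mulr_ge0// ltW.
move=> g Lg t; rewrite in_itv/= => /andP[at_ tb]; have [_ _ _ gle] := HC g Lg.
apply: le_trans (cint_le hab hp Lg (lexx _) at_ tb) _; rewrite -mulrA ler_pM2l//.
exact: le_trans (integ_nc_le hab hp Lg (lexx _) at_ tb) _.
Qed.

Lemma le0_geometric (q x C : R) : 0 < q -> q < 1 -> (forall n, x <= C * q ^+ n) -> x <= 0.
Proof.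
move=> q0 q1 xC; have [//|x0] := leP x 0.
have C0 : 0 < C by have := xC 0%N; rewrite expr0 mulr1; apply: lt_le_trans.
have : (fun n => q ^+ n) @ \oo --> (0 : R) by apply: cvg_expr; rewrite ger0_norm ?ltW.
move=> /cvgrPdist_lt/(_ (x / C) (divr_gt0 x0 C0))[N _ /(_ N (leqnn N))].
rewrite /= sub0r normrN ger0_norm ?exprn_ge0 ?ltW// ltr_pdivlMr// => h.
by have := lt_le_trans h (xC N); rewrite mulrC ltxx.
Qed.

(** A function of W^(k+1) is determined by its value at [a] and its derivative in W^k. Both converge
    geometrically, and the primitive of the limit derivative with the limit value at [a] is the
    limit. *)
Lemma W_complete k (f_ : nat -> R -> R[i]) (K q : R) : 0 < q -> q < 1 ->
  (forall n, in_W k (f_ n)) ->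
  (forall n, Wn k (fun t => f_ n.+1 t - f_ n t) <= K * q ^+ n) ->
  exists2 f, in_W k f & forall n, Wn k (fun t => f t - f_ n t) <= K / (1 - q) * q ^+ n.
Proof.
move=> q0 q1 Wf fK.
have K0 : 0 <= K by have := fK 0%N; rewrite expr0 mulr1; apply: le_trans; exact: Wn_ge0.
have WBf g n : in_W k g -> in_W k (fun t => g t - f_ n t) by move=> Wg; exact: (WB hab hp Wg (Wf n)).1.
(* An unspecified geometric constant is enough: comparing [f_ n] with [f_ (n + m)] and letting [m]
   grow restores the sharp one. The induction on [k] thus need not keep track of constants. *)
suff [f W1 [C W2]] : exists2 f, in_W k f & exists C, forall n,
    Wn k (fun t => f t - f_ n t) <= C * q ^+ n.
  exists f => // n; rewrite -subr_le0.
  apply: (@le0_geometric q _ (C * q ^+ n)) => // m.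
  rewrite lerBlDr -mulrA -exprD; apply: (@le_trans _ _
    (Wn k (fun t => f t - f_ (n + m)%N t) + Wn k (fun t => f_ (n + m)%N t - f_ n t))).
    rewrite (_ : (fun t => f t - f_ n t) =
      fun t => (f t - f_ (n + m)%N t) + (f_ (n + m)%N t - f_ n t)).
      by have [] := WD hab hp (WBf _ (n + m)%N W1) (WBf _ n (Wf (n + m)%N)).
    by apply/funext => t; rewrite addrA subrK.
  apply: lerD => //.
  apply: (@geometric_chain _ K q q0 q1 K0 (fun m => Wn k (fun t => f_ (n + m)%N t - f_ n t))).
    rewrite addn0 (_ : (fun t => _) = fun=> 0); last by apply/funext => t; rewrite subrr.
    by rewrite (W_cst hab hp k 0).2.
  move=> j; rewrite addnS [leRHS]addrC.
  rewrite (_ : (fun t => f_ (n + j).+1 t - f_ n t) =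
    fun t => (f_ (n + j).+1 t - f_ (n + j)%N t) + (f_ (n + j)%N t - f_ n t)).
    have [_ H] := WD hab hp (WBf _ (n + j)%N (Wf (n + j).+1)) (WBf _ n (Wf (n + j)%N)).
    by apply: le_trans H _; rewrite lerD2r.
  by apply/funext => t; rewrite addrA subrK.
elim: k f_ K {K0 WBf} Wf fK => [|k IH] f_ K Wf fK.
  have Lf n : in_Lp a b p (f_ n) := Wf n.
  have Lpf n : Lpn (fun t => f_ n.+1 t - f_ n t) <= K * q ^+ n.
    by rewrite -Wn0//; exact: (WB hab hp (Wf _) (Wf _)).1.
  have [f Lf0 HC] := Lp_complete hab hp q0 q1 Lf Lpf.
  exists f => //; exists (K / (1 - q)) => n; rewrite Wn0//; exact: (WB hab hp (Lf0 : in_W 0 f) (Wf _)).1.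
have [g_ Hg] := choice (fun n => W_elimN hab hp (Wf n)).
have K0 : 0 <= K by have := fK 0%N; rewrite expr0 mulr1; apply: le_trans; exact: Wn_ge0.
have Wg n : in_W k (g_ n) by case: (Hg n).
have fE n t : t \in `[a, b] -> f_ n t = f_ n a + cint (g_ n) a t by case: (Hg n) => _ H _ _; exact: H.
have aab : a \in `[a, b] by rewrite in_itv/= lexx ltW.
have dE g g' z z' f f' : in_W k g -> in_W k g' -> 
    (forall t, t \in `[a, b] -> f t = z + cint g a t) ->
    (forall t, t \in `[a, b] -> f' t = z' + cint g' a t) ->
    Wn k.+1 (fun t => f t - f' t) = Lpn (fun t => f t - f' t) + Wn k (fun t => g t - g' t).
  move=> W1 W2 E1 E2; have [W3 _] := WB hab hp W1 W2.
  have [|_ //] := @WnS R a b p hab hp k (fun t => f t - f' t) _ (z - z') W3.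
  move=> t tab; rewrite E1// E2//.
  have := @cint_lin R a b p hab hp (-1) g' g t (W_Lp hab hp W2) (W_Lp hab hp W1) tab.
  rewrite (_ : (fun x => -1 * g' x + g x) = (fun x => g x - g' x)).
    by move=> ->; ring.
  by apply/funext => x; rewrite mulN1r addrC.
have gK n : Wn k (fun t => g_ n.+1 t - g_ n t) <= K * q ^+ n.
  apply: le_trans (fK n); rewrite (dE _ _ _ _ _ _ (Wg _) (Wg _) (fE _) (fE _)).
  by rewrite lerDr Lpn_ge0.
have [g W1 [C HC]] := IH g_ K Wg gK.
have [S S0 HS] := W_sup hab hp.
have SK n : nc (f_ n.+1 a - f_ n a) <= S * K * q ^+ n.
  rewrite -mulrA; apply: le_trans (HS k (fun t => f_ n.+1 t - f_ n t) (WB hab hp (Wf _) (Wf _)).1 a aab) _.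
  by rewrite ler_wpM2l.
have [z Hz] := @nc_geometric_cvg R (S * K) q q0 q1 (mulr_ge0 S0 K0) (fun n => f_ n a) SK.
have fE' t : t \in `[a, b] -> z + cint g a t = z + cint g a t by [].
have [W2 _] := WnS hab hp W1 fE'.
exists (fun t => z + cint g a t) => //.
(* [D * q ^+ n] bounds the supremum of the n-th error: the first term stems from the values at [a],
   the second from the integrated error of the derivatives. *)
have [T T0 HT] := cint_sup; pose D := 2 * (S * K / (1 - q)) + T * C.
exists (D * Lpn1 a b p + C) => n; rewrite (dE _ _ _ _ _ _ W1 (Wg n) fE' (fE n)).
have C0 : 0 <= C by have := HC 0%N; rewrite expr0 mulr1; apply: le_trans; exact: Wn_ge0.
rewrite mulrDl; apply: lerD => //; rewrite mulrAC.
have [Wd _] := WB hab hp W2 (Wf n); have [W3 _] := WB hab hp W1 (Wg n).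
apply: (@Lpn_bounded R a b p hab hp _ _ (ccont_cmeas (in_W_ccont Wd)) _ _).2.
  apply: mulr_ge0; last exact: exprn_ge0 (ltW q0).
  by rewrite addr_ge0 ?mulr_ge0 ?invr_ge0 ?subr_ge0// ltW.
move=> t /itv_oc tab; rewrite fE// opprD addrACA mulrDl.
apply: le_trans (ncD _ _) _; apply: lerD; first exact: Hz.
have := @cint_lin R a b p hab hp (-1) (g_ n) g t (W_Lp hab hp (Wg n)) (W_Lp hab hp W1) tab.
rewrite (_ : (fun x => -1 * g_ n x + g x) = (fun x => g x - g_ n x)); last first.
  by apply/funext => x; rewrite mulN1r addrC.
rewrite mulN1r addrC => <-; apply: le_trans (HT _ (W_Lp hab hp W3) t tab) _.
rewrite -mulrA ler_wpM2l//; apply: le_trans (HC n).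
by have [W0 H] := W_leq hab hp (leq0n k) W3; rewrite -Wn0.
Qed.

End sobolev_complete.

(** * Volterra systems and linear differential equations *)

Section exponential_weight.
Context {R : realType} (a b : R).
Hypothesis hab : a < b.
Notation leb := (@lebesgue_measure R).
Implicit Types u v : R -> R.

Lemma real_ac_lipschitz (I : set R) u v (K : R) : 0 <= K ->
  (forall x y, I x -> I y -> `|v x - v y| <= K * `|u x - u y|) -> real_ac I u -> real_ac I v.
Proof.
move=> K0 vu acu eps eps0; have K1 : 0 < K + 1 by rewrite ltr_wpDl.
have [d d0 H] := acu _ (divr_gt0 eps0 K1); exists d => // s s1 s2 s3.
have := H s s1 s2 s3; rewrite ltr_pdivlMr// => h; apply: le_lt_trans h.
rewrite mulr_suml big_seq_cond [leRHS]big_seq_cond; apply: ler_sum => i; rewrite andbT => /s1[_ i1 i2].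
by apply: le_trans (vu _ _ i2 i1) _; rewrite mulrC ler_wpM2l// lerDl.
Qed.

Lemma expR_lipschitz (M x y : R) : x <= M -> y <= M -> `|expR x - expR y| <= expR M * `|x - y|.
Proof.
wlog xy : x y / x <= y.
  by move=> W xM yM; have [/W|/ltW/W] := leP x y; [exact|rewrite distrC (distrC x); apply].
move=> xM yM; rewrite distrC ger0_norm ?subr_ge0 ?ler_expR// distrC ger0_norm ?subr_ge0//.
apply: (@le_trans _ _ (expR y * (y - x))); last by rewrite ler_wpM2r ?subr_ge0 ?ler_expR.
have -> : expR x = expR y * expR (x - y) by rewrite -expRD addrC subrK.
have := expR_ge1Dx (x - y); have := expR_gt0 y; nra.
Qed.

(** The weight is the exponential of K times the primitive of [h]; then w' = K h w almost everywhere
    and the integral equals w(t) - w(a). As [h] is merely integrable, [w] is only absolutely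
    continuous, and its Lipschitz dependence on the primitive is used to see this. *)
Lemma exp_weight (h : R -> R) (K : R) : 0 <= K -> leb.-integrable `]a, b[ (EFin \o h) ->
  (forall t, t \in `]a, b[ -> 0 <= h t) ->
  exists w : R -> R, [/\ {within `[a, b], continuous w}, forall t, t \in `[a, b] -> 1 <= w t &
    forall t, t \in `[a, b] -> K * integ (fun s => h s * w s) a t <= w t].
Proof.
move=> K0 ih h0; pose u t := K * integ h a t; pose w t := expR (u t).
have iKh := integrableZ' K ih.
have uE t : t \in `[a, b] -> u t = 0 + integ (fun s => K * h s) a t.
  rewrite in_itv/= => /andP[at_ tb]; rewrite add0r integZ//.
  exact: integrable_sub ih (lexx _) tb.
have uE' t : t \in `]a, b[ -> u t = 0 + integ (fun s => K * h s) a t by move=> /itv_oc; exact: uE.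
have cu := integ_within_continuous iKh uE.
have cw : {within `[a, b], continuous w}.
  by move=> x; apply: (@continuous_comp (subspace `[a, b])); [exact: cu|exact: continuous_expR].
have u0 t : t \in `[a, b] -> 0 <= u t.
  rewrite in_itv/= => /andP[at_ tb]; rewrite mulr_ge0// integ_ge0// => s as_ st.
  by apply: h0; rewrite in_itv/= as_ (lt_le_trans st).
have [M M0 HM] := within_continuous_bounded hab cu.
have acw : real_ac `]a, b[ w.
  apply: real_ac_lipschitz (expR_ge0 M) _ (real_ac_integ iKh uE') => x y /itv_oc xab /itv_oc yab.
  by apply: expR_lipschitz; apply: le_trans (ler_norm _) _; exact: HM.
have ihw := integrableM_bounded hab ih cw.
exists w; split=> // [t tab|t tab]; first by rewrite -expR0 ler_expR u0.
have aab : a \in `[a, b] by rewrite in_itv/= lexx ltW.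
have := @real_ac_ftc R a b w (fun s => K * (h s * w s)) hab acw cw (integrableZ' K ihw) _ t tab.
have tb : t <= b by move: tab; rewrite in_itv/= => /andP[].
rewrite integZ; last exact: integrable_sub ihw (lexx _) tb.
move=> ->; first by rewrite lerDr expR_ge0.
apply: leb_aeS (ftc_ae iKh uE') => x xd xab _; have [du d1u] := xd xab.
have Du : is_derive x 1 u (K * h x) by apply: (DeriveDef du); rewrite -derive1E d1u.
rewrite derive1E.
have Dw := is_derive1_comp (is_derive_expR (u x)) Du; rewrite (@derive_val _ _ _ _ _ _ _ Dw).
by rewrite mulrC mulrA.
Qed.

End exponential_weight.

Section volterra.
Context {R : realType} (a b : R) (p : \bar R) (J : finType).
Hypothesis hab : a < b.
Hypothesis hp : (1 <= p)%E.
Notation leb := (@lebesgue_measure R).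
Notation nc := (@ComplexField.Normc.normc R).
Local Notation Lpn := (Lpn a b p).
Local Notation in_Lp := (in_Lp a b p).
Local Notation ccont := (ccont a b).
Implicit Types (g x : J -> R -> R[i]) (q : J -> R[i]).

Lemma Lp_sum (s : seq J) (F : J -> R -> R[i]) : (forall j, in_Lp (F j)) ->
  in_Lp (fun t => \sum_(j <- s) F j t).
Proof. by move=> LF; have [] := @W_sum R a b p hab hp 0 J s F LF. Qed.

Variable A : J -> J -> R -> R[i].
Hypothesis LA : forall i j, in_Lp (A i j).

Lemma Lp_row x i : (forall j, ccont (x j)) -> in_Lp (fun t => \sum_j A i j t * x j t).
Proof.
move=> cx; apply: Lp_sum => j; have [M M0 HM] := ccont_bounded hab (cx j).
apply: (LpnM hab hp (LA i j) (ccont_cmeas (cx j)) M0 _).1 => t /itv_oc; exact: HM.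
Qed.

(* In the norm weighted by w = exp (4 int sum |A i j|) the Volterra operator contracts with
   factor 1/2, which gives both Gronwall's bound and the convergence of Picard's iteration. *)
Lemma volterra_weight : exists w : R -> R, [/\ {within `[a, b], continuous w},
  forall t, t \in `[a, b] -> 1 <= w t &
  forall x M, 0 <= M -> (forall j, ccont (x j)) ->
   (forall j t, t \in `[a, b] -> nc (x j t) <= M * w t) ->
   forall i t, t \in `[a, b] -> nc (cint (fun s => \sum_j A i j s * x j s) a t) <= M / 2 * w t].
Proof.
have [C _ HC] := Lpn_L1 hab hp.
pose h t := \sum_(e : J * J) nc (A e.1 e.2 t).
have ih : leb.-integrable `]a, b[ (EFin \o h).
  rewrite /h; elim: (index_enum _) => [|e s IH].
    rewrite (_ : _ \o _ = (EFin \o (fun=> 0))); last by apply/funext => t /=; rewrite big_nil.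
    by apply: (@integrable_bounded R (fun=> 0) a b 0) => [|x _]; [exact: measurable_cst|rewrite normr0].
  rewrite (_ : _ \o _ = (EFin \o (fun t => nc (A e.1 e.2 t) + \sum_(e <- s) nc (A e.1 e.2 t)))); last first.
    by apply/funext => t /=; rewrite big_cons.
  by apply: integrableD' => //; have [] := HC _ (LA e.1 e.2).
have h0 t : t \in `]a, b[ -> 0 <= h t by move=> _; apply: sumr_ge0 => *; exact: nc_ge0.
(* One factor 2 of the 4 compensates [cint_le], the other produces the contraction by one half. *)
have [w [cw w1 Hw]] := exp_weight hab (ler0n R 4) ih h0.
exists w; split=> // x M M0 cx xM i t tab.
have Lx := Lp_row i cx; have [_ _ nx _] := HC _ Lx.
have [at_ tb] : a <= t /\ t <= b by move: tab; rewrite in_itv/= => /andP[].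
have ihw := integrableM_bounded hab ih cw.
apply: le_trans (cint_le hab hp Lx (lexx _) at_ tb) _.
apply: (@le_trans _ _ (2 * (M * integ (fun s => h s * w s) a t))); last first.
  have := Hw t tab; have := w1 t tab; set S := integ _ _ _; clear -M0 => h1 h2; nra.
rewrite ler_pM2l// -integZ; last exact: integrable_sub ihw (lexx _) tb.
apply: integ_le => [||s as_ st].
- exact: integrable_sub nx (lexx _) tb.
- by apply: integrableZ'; exact: integrable_sub ihw (lexx _) tb.
have sab : s \in `[a, b] by rewrite in_itv/= !ltW// (lt_le_trans st).
have Mw0 : 0 <= M * w s by rewrite mulr_ge0// (le_trans ler01)// w1.
rewrite mulrCA; apply: le_trans (nc_sum _ _ _) _.
apply: (@le_trans _ _ (\sum_j nc (A i j s) * (M * w s))).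
  by apply: ler_sum => j _; rewrite ncM ler_wpM2l ?nc_ge0// xM.
rewrite -mulr_suml ler_wpM2r// /h -(pair_bigA _ (fun i j => nc (A i j s)))/= [leRHS](bigD1 i)//= lerDl.
by apply: sumr_ge0 => k _; apply: sumr_ge0 => l _; exact: nc_ge0.
Qed.

(** Integral form of x' = g + A x with x(a) = q, meaningful for coefficients that are only in
    L_p. *)
Definition volterra_sol q g x := (forall i, ccont (x i)) /\ forall i t, t \in `[a, b] ->
  x i t = q i + cint (fun s => g i s + \sum_j A i j s * x j s) a t.

Lemma cintD (f g : R -> R[i]) t : in_Lp f -> in_Lp g -> t \in `[a, b] ->
  cint (fun s => f s + g s) a t = cint f a t + cint g a t.
Proof.
move=> Lf Lg tab; have := cint_lin hab hp 1 Lf Lg tab; rewrite mul1r => <-.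
by under [in RHS]eq_fun do rewrite mul1r.
Qed.

Lemma cintB (f g : R -> R[i]) t : in_Lp f -> in_Lp g -> t \in `[a, b] ->
  cint (fun s => f s - g s) a t = cint f a t - cint g a t.
Proof.
move=> Lf Lg tab; have := cint_lin hab hp (-1) Lg Lf tab; rewrite mulN1r addrC => <-.
by congr cint; apply/funext => s; rewrite mulN1r addrC.
Qed.

Lemma ccontB (f g : R -> R[i]) : ccont f -> ccont g -> ccont (fun t => f t - g t).
Proof.
move=> [f1 f2] [g1 g2]; split.
  rewrite (_ : (fun t => _) = (fun t => complex.Re (f t)) \- (fun t => complex.Re (g t))).
    exact: within_continuousB.
  by apply/funext => t; rewrite ReB.
rewrite (_ : (fun t => _) = (fun t => complex.Im (f t)) \- (fun t => complex.Im (g t))).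
  exact: within_continuousB.
by apply/funext => t; rewrite ImB.
Qed.

Lemma ccont_family_bounded x : (forall j, ccont (x j)) ->
  exists2 M : R, 0 <= M & forall j t, t \in `[a, b] -> nc (x j t) <= M.
Proof.
move=> cx.
have [Mj HMj] := choice (fun j => let: ex_intro2 M h1 h2 := ccont_bounded hab (cx j) in
   ex_intro (fun M => 0 <= M /\ forall t, t \in `[a, b] -> nc (x j t) <= M) M (conj h1 h2)).
exists (\sum_j Mj j); first by apply: sumr_ge0 => j _; case: (HMj j).
move=> j s sab; have [_ /(_ s sab) h] := HMj j; apply: le_trans h _.
by rewrite (bigD1 j)//= lerDl; apply: sumr_ge0 => k _; case: (HMj k).
Qed.

(** An a priori bound N w on the solution improves to (Q + N / 2) w, a map with fixed point N = 2 Q.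
    Iteration therefore removes the initial bound [M], which depends on the solution. *)
Lemma volterra_bound : exists2 C : R, 0 <= C & forall q g x, (forall i, in_Lp (g i)) ->
  volterra_sol q g x -> forall i t, t \in `[a, b] ->
  nc (x i t) <= C * \sum_j (nc (q j) + Lpn (g j)).
Proof.
have [w [cw w1 Hw]] := volterra_weight.
have [W W0 HW] := within_continuous_bounded hab cw.
have [T T0 HT] := cint_sup hab hp.
exists (2 * (1 + T) * W); first by rewrite mulr_ge0// mulr_ge0// addr_ge0.
move=> q g x Lg [cx xE] i t tab.
pose Q := (1 + T) * \sum_j (nc (q j) + Lpn (g j)).
have S0 : 0 <= \sum_j (nc (q j) + Lpn (g j)).
  by apply: sumr_ge0 => j _; rewrite addr_ge0 ?nc_ge0 ?Lpn_ge0.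
have Q0 : 0 <= Q by rewrite mulr_ge0// addr_ge0.
have w0 s : s \in `[a, b] -> 0 <= w s by move=> /w1; apply: le_trans.
have [M M0 HM] := ccont_family_bounded cx.
have step n j s : s \in `[a, b] -> nc (x j s) <= (2 * Q + M * (2^-1) ^+ n) * w s.
  elim: n j s => [|n IH] j s sab.
    rewrite expr0 mulr1; apply: le_trans (HM j s sab) _.
    have := w1 s sab; clear -M0 Q0 => h; nra.
  have N0 : 0 <= 2 * Q + M * 2^-1 ^+ n by apply: addr_ge0; [exact: mulr_ge0|apply: mulr_ge0 => //; apply: exprn_ge0; rewrite invr_ge0].
  have h1 := Hw x _ N0 cx IH j s sab.
  rewrite xE// cintD//; last exact: Lp_row.
  rewrite addrA; apply: le_trans (ncD _ _) _.
  have h2 : nc (q j + cint (g j) a s) <= Q * w s.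
    apply: (@le_trans _ _ Q); last by rewrite ler_peMr// w1.
    apply: le_trans (ncD _ _) _; apply: (@le_trans _ _ ((1 + T) * (nc (q j) + Lpn (g j)))).
      have := HT _ (Lg j) s sab; have := nc_ge0 (q j); have := Lpn_ge0 a b p (g j).
      clear -T0 => h1 h2 h3; nra.
    rewrite ler_wpM2l ?addr_ge0// (bigD1 j)//= lerDl; apply: sumr_ge0 => k _.
    by rewrite addr_ge0 ?nc_ge0 ?Lpn_ge0.
  apply: le_trans (lerD h2 h1) _; rewrite -mulrDl ler_wpM2r ?w0//.
  rewrite exprSr; lra.
have h : nc (x i t) - 2 * Q * w t <= 0.
  apply: (@le0_geometric R 2^-1 _ (M * w t)) => [||n]; rewrite ?invr_gt0 ?invf_lt1 ?ltr1n//.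
  by rewrite lerBlDl [M * _ * _]mulrAC -mulrDl step.
rewrite subr_le0 in h; apply: le_trans h _.
rewrite [leRHS](_ : _ = 2 * Q * W); last by rewrite /Q; ring.
apply: ler_wpM2l; first exact: mulr_ge0.
by apply: le_trans (ler_norm _) _; exact: HW.
Qed.

Lemma ccont_limit (f : R -> R[i]) (f_ : nat -> R -> R[i]) (K : R) : (forall n, ccont (f_ n)) ->
  (forall n t, t \in `[a, b] -> nc (f t - f_ n t) <= K * 2^-1 ^+ n) -> ccont f.
Proof.
move=> cf fK.
suff H (r : R[i] -> R) : {morph r : x y / x - y} -> (forall z, `|r z| <= nc z) ->
    (forall n, {within `[a, b], continuous (fun t => r (f_ n t))}) ->
    {within `[a, b], continuous (fun t => r (f t))}.
  split; [apply: H; [exact: ReB|exact: Re_le_nc|by move=> n; case: (cf n)]|].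
  by apply: H; [exact: ImB|exact: Im_le_nc|move=> n; case: (cf n)].
move=> rB rle cr; apply/within_itv_continuousP => x xab e e0.
have e4 : 0 < e / 4 by rewrite divr_gt0.
have [n Hn] : exists n, K * 2^-1 ^+ n < e / 4.
  have [//|Hn] := pselect (exists n, K * 2^-1 ^+ n < e / 4).
  have H n : e / 4 <= K * 2^-1 ^+ n by rewrite leNgt; apply/negP => h; apply: Hn; exists n.
  have q0 : 0 < 2^-1 :> R by rewrite invr_gt0.
  have q1 : 2^-1 < 1 :> R by rewrite invf_lt1// ltr1n.
  by have := le0_geometric q0 q1 H; rewrite leNgt e4.
have /within_itv_continuousP/(_ x xab _ e4)[d d0 Hd] := cr n.
exists d => // y yab xy; have := Hd y yab xy.
have hx : `|r (f x) - r (f_ n x)| < e / 4.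
  by rewrite -rB; apply: le_lt_trans (rle _) _; apply: le_lt_trans (fK n x xab) Hn.
have hy : `|r (f y) - r (f_ n y)| < e / 4.
  by rewrite -rB; apply: le_lt_trans (rle _) _; apply: le_lt_trans (fK n y yab) Hn.
move: hx hy; rewrite !ltr_norml => /andP[h1 h2] /andP[h3 h4] /andP[h5 h6].
apply/andP; split; clear -h1 h2 h3 h4 h5 h6; lra.
Qed.

Lemma volterra_exists q g : (forall i, in_Lp (g i)) -> exists x, volterra_sol q g x.
Proof.
move=> Lg; have [w [cw w1 Hw]] := volterra_weight.
have [W W0 HW] := within_continuous_bounded hab cw.
pose F (x : J -> R -> R[i]) i t := q i + cint (fun s => g i s + \sum_j A i j s * x j s) a t.
have LF x i : (forall j, ccont (x j)) -> in_Lp (fun s => g i s + \sum_j A i j s * x j s).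
  by move=> cx; exact: (LpnD hab hp (Lg i) (Lp_row i cx)).1.
have cF x : (forall j, ccont (x j)) -> forall i, ccont (F x i).
  by move=> cx i; apply: (cint_ccont (z := q i) hab hp (LF x i cx)).
have FB x y i t : (forall j, ccont (x j)) -> (forall j, ccont (y j)) -> t \in `[a, b] ->
    F x i t - F y i t = cint (fun s => \sum_j A i j s * (x j s - y j s)) a t.
  move=> cx cy tab; rewrite /F opprD addrACA subrr add0r -cintB//; [|exact: LF|exact: LF].
  congr cint; apply/funext => s; rewrite opprD addrACA subrr add0r -sumrB.
  by apply: eq_bigr => j _; rewrite mulrBr.
pose x_ n := iter n F (fun _ _ => 0).
have cx n j : ccont (x_ n j).
  elim: n j => [|n IH] j; last exact: cF.
  by apply: (in_W_ccont (k := 0)); exact: (W_cst hab hp 1 0).1.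
have [M M0 HM] := ccont_family_bounded (cx 1%N).
have xM n j s : s \in `[a, b] -> nc (x_ n.+1 j s - x_ n j s) <= M * 2^-1 ^+ n * w s.
  elim: n j s => [|n IH] j s sab.
    rewrite expr0 mulr1 subr0; apply: le_trans (HM j s sab) _.
    by rewrite ler_peMr// w1.
  rewrite [x_ n.+2]/(F (x_ n.+1)) [X in _ - X j s]/(F (x_ n)) FB// exprSr mulrA.
  apply: (Hw (fun j s => x_ n.+1 j s - x_ n j s)) => //.
    by rewrite mulr_ge0// exprn_ge0// invr_ge0.
  by move=> k; exact: ccontB.
have q0 : 0 < 2^-1 :> R by rewrite invr_gt0.
have q1 : 2^-1 < 1 :> R by rewrite invf_lt1// ltr1n.
have xW n j s : s \in `[a, b] -> nc (x_ n.+1 j s - x_ n j s) <= M * W * 2^-1 ^+ n.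
  move=> sab; apply: le_trans (xM n j s sab) _; rewrite mulrAC ler_wpM2r ?exprn_ge0 ?invr_ge0//.
  by rewrite ler_wpM2l//; apply: le_trans (ler_norm _) _; exact: HW.
(* Indexing by pairs lets a single choice produce the limit function; off [[a, b]] its values are
   irrelevant. *)
have ex js : exists z, js.2 \in `[a, b] -> forall n,
    nc (z - x_ n js.1 js.2) <= 2 * (M * W / (1 - 2^-1)) * 2^-1 ^+ n.
  case: js => j s /=; have [sab|sab] := boolP (s \in `[a, b]); last by exists 0.
  by have [z Hz] := nc_geometric_cvg q0 q1 (mulr_ge0 M0 W0) (fun n => xW n j s sab); exists z.
have [x' Hx] := choice ex; pose x j s := x' (j, s).
pose K := 2 * (M * W / (1 - 2^-1)).
have xK j s : s \in `[a, b] -> forall n, nc (x j s - x_ n j s) <= K * 2^-1 ^+ n.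
  by move=> sab; exact: (Hx (j, s) sab).
have K0 : 0 <= K by rewrite !mulr_ge0// invr_ge0 subr_ge0 ltW.
have cx' j : ccont (x j) by apply: ccont_limit (cx ^~ j) _ => n t tab; exact: xK.
exists x; split=> // i t tab; apply/eqP; rewrite -subr_eq0; apply/eqP/nc_eq0.
apply/eqP; rewrite eq_le nc_ge0 andbT.
apply: (@le0_geometric R 2^-1 _ (K + K * W)) => // n.
have -> : x i t - (q i + cint (fun s => g i s + \sum_j A i j s * x j s) a t) =
  (x i t - x_ n.+1 i t) - (F x i t - F (x_ n) i t) by rewrite [x_ n.+1]/(F (x_ n)) opprB addrA subrK.
apply: le_trans (ncB _ _) _; rewrite mulrDl; apply: lerD.
  apply: le_trans (xK i t tab n.+1) _; rewrite ler_wpM2l// exprS ler_piMl ?exprn_ge0 ?invr_ge0//.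
  exact: ltW.
rewrite FB//; have := Hw (fun j s => x j s - x_ n j s) (K * 2^-1 ^+ n) _ _ _ i t tab.
move=> h; apply: le_trans (h _ _ _) _.
- by rewrite mulr_ge0// exprn_ge0// invr_ge0.
- by move=> j; exact: ccontB.
- move=> j s sab; apply: le_trans (xK j s sab n) _; rewrite ler_peMr ?w1//.
  by rewrite mulr_ge0// exprn_ge0// invr_ge0.
have wW : w t <= W by apply: le_trans (ler_norm _) _; exact: HW.
have e0 : 0 <= (2^-1 : R) ^+ n by rewrite exprn_ge0// invr_ge0.
have wt := w1 t tab.
rewrite -mulrA [leRHS]mulrAC; apply: ler_wpM2l; first exact: mulr_ge0.
by apply: le_trans wW; rewrite ler_piMl ?(le_trans ler01 wt)// ltW.
Qed.

End volterra.

Section volterra_regularity.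
Context {R : realType} (a b : R) (p : \bar R) (J : finType).
Hypothesis hab : a < b.
Hypothesis hp : (1 <= p)%E.
Notation nc := (@ComplexField.Normc.normc R).
Local Notation Lpn := (Lpn a b p).
Local Notation Wn := (Wn a b p).
Local Notation in_W k := (in_W a b k p).
Local Notation vsol := (volterra_sol a b).
Implicit Types (g x : J -> R -> R[i]) (q : J -> R[i]) (A : J -> J -> R -> R[i]).

Lemma volterra_lin A (z : R[i]) q g x q' g' x' : (forall i j, in_Lp a b p (A i j)) ->
  (forall i, in_Lp a b p (g i)) -> (forall i, in_Lp a b p (g' i)) ->
  vsol A q g x -> vsol A q' g' x' ->
  vsol A (fun i => z * q i + q' i) (fun i t => z * g i t + g' i t) (fun i t => z * x i t + x' i t).
Proof.
move=> LA Lg Lg' [cx xE] [cx' xE'].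
have L1 i := (LpnD hab hp (Lg i) (Lp_row hab hp LA i cx)).1.
have L2 i := (LpnD hab hp (Lg' i) (Lp_row hab hp LA i cx')).1.
have E i t : t \in `[a, b] -> z * x i t + x' i t =
  (z * q i + q' i) + cint (fun s => z * g i s + g' i s + \sum_j A i j s * (z * x j s + x' j s)) a t.
  move=> tab; have := cint_lin hab hp z (L1 i) (L2 i) tab.
  rewrite (_ : (fun _ => _) = fun s => z * g i s + g' i s + \sum_j A i j s * (z * x j s + x' j s)).
    by move=> ->; rewrite xE// xE'//; ring.
  apply/funext => s; rewrite mulrDr addrACA; congr (_ + _); rewrite mulr_sumr -big_split/=.
  by apply: eq_bigr => j _; ring.
split=> // i.
apply: (@cint_ccont R a b p hab hp _ (fun s => z * g i s + g' i s + \sum_j A i j s * (z * x j s + x' j s)) (z * q i + q' i)) (E i).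
have := (LpnD hab hp (LpnZ hab hp z (L1 i)).1 (L2 i)).1.
congr in_Lp; apply/funext => s; rewrite mulrDr addrACA; congr (_ + _); rewrite mulr_sumr -big_split/=.
by apply: eq_bigr => j _; ring.
Qed.

Lemma volterra_uniq A q g x x' : (forall i j, in_Lp a b p (A i j)) ->
  (forall i, in_Lp a b p (g i)) -> vsol A q g x -> vsol A q g x' ->
  forall i t, t \in `[a, b] -> x i t = x' i t.
Proof.
move=> LA Lg sx sx'; have H := volterra_lin (-1) LA Lg Lg sx sx'.
have [C _ HC] := volterra_bound hab hp LA.
move=> i t tab; apply/eqP; rewrite eq_sym -subr_eq0; apply/eqP/nc_eq0/eqP.
rewrite eq_le nc_ge0 andbT.
have := HC _ _ _ _ H i t tab; rewrite mulN1r addrC => h; apply: le_trans (h _) _.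
  move=> j; rewrite (_ : (fun _ => _) = fun=> 0); first exact: (W_cst hab hp 0 0).1.
  by apply/funext => s; rewrite mulN1r addrC subrr.
rewrite big1 ?mulr0// => j _; rewrite mulN1r [- _ + _]addrC subrr nc0 add0r.
rewrite (_ : (fun _ => _) = fun=> 0) ?(Lpn_zero hab hp)//.
by apply/funext => s; rewrite mulN1r addrC subrr.
Qed.

Lemma volterra_sum A (L : Type) (s : seq L) (c : L -> R[i]) (e : L -> J -> R[i]) Z q g x :
  (forall i j, in_Lp a b p (A i j)) -> (forall i, in_Lp a b p (g i)) ->
  (forall l, vsol A (e l) (fun _ _ => 0) (Z l)) -> vsol A q g x ->
  vsol A (fun i => \sum_(l <- s) c l * e l i + q i) g
    (fun i t => \sum_(l <- s) c l * Z l i t + x i t).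
Proof.
move=> LA Lg sZ sx; elim: s => [|l s IH].
  rewrite (_ : (fun i => _) = q); last by apply/funext => i; rewrite big_nil add0r.
  rewrite (_ : (fun i t => _) = x)//.
  by apply/funext => i; apply/funext => t; rewrite big_nil add0r.
have L0 (i : J) : in_Lp a b p (fun=> 0) := (W_cst hab hp 0 0).1.
have := volterra_lin (c l) LA L0 Lg (sZ l) IH.
rewrite (_ : (fun i t => c l * 0 + g i t) = g); last first.
  by apply/funext => i; apply/funext => t; rewrite mulr0 add0r.
congr vsol; first by apply/funext => i; rewrite big_cons addrA.
by apply/funext => i; apply/funext => t; rewrite big_cons addrA.
Qed.

(** Bootstrapping: a solution known to be bounded ([k = 0]) or, by induction, in W^(k+1) makes the
    integrand as regular as [g] and [A], and integration gains one order. The constant depends on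
    [A] alone. *)
Lemma volterra_regular k A : (forall i j, in_W k (A i j)) -> exists2 C : R, 0 <= C &
  forall q g x, (forall i, in_W k (g i)) -> vsol A q g x ->
    (forall i, in_W k.+1 (x i)) /\
    forall i, Wn k.+1 (x i) <= C * \sum_j (nc (q j) + Wn k (g j)).
Proof.
elim: k => [|k IH] WA.
  have [C C0 HC] := volterra_bound hab hp WA.
  pose D := \sum_i \sum_j Lpn (A i j).
  exists (C * Lpn1 a b p + 1 + C * D).
    by rewrite !addr_ge0 ?mulr_ge0 ?Lpn1_ge0 ?sumr_ge0// => i _; rewrite sumr_ge0// => j _; exact: Lpn_ge0.
  move=> q g x Lg sx; have [cx xE] := sx; set S := \sum_j _.
  have SE : S = \sum_j (nc (q j) + Lpn (g j)) by apply: eq_bigr => j _; rewrite Wn0.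
  have S0 : 0 <= S by rewrite SE sumr_ge0// => j _; rewrite addr_ge0 ?nc_ge0 ?Lpn_ge0.
  have xS i t : t \in `]a, b[ -> nc (x i t) <= C * S.
    by move=> /itv_oc tab; rewrite SE; exact: (HC q g x Lg sx).
  have P i j := LpnM hab hp (WA i j) (ccont_cmeas (cx j)) (mulr_ge0 C0 S0) (xS j).
  have key i : in_W 0 (fun t => g i t + \sum_j A i j t * x j t) /\
      Wn 0 (fun t => g i t + \sum_j A i j t * x j t) <= S + C * S * D.
    have [W1 N1] := @W_sum R a b p hab hp 0 J (index_enum J) (fun j t => A i j t * x j t) (fun j => (P i j).1).
    have [W2 N2] := WD hab hp (Lg i) W1; split=> //; apply: le_trans N2 _; apply: lerD.
      rewrite /S (bigD1 i)//= -addrA addrCA lerDl addr_ge0 ?nc_ge0// sumr_ge0// => j _.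
      by rewrite addr_ge0 ?nc_ge0 ?Wn_ge0.
    apply: le_trans N1 _; apply: (@le_trans _ _ (C * S * \sum_j Lpn (A i j))).
      by rewrite mulr_sumr; apply: ler_sum => j _; have [P1 P2] := P i j; rewrite Wn0.
    rewrite ler_wpM2l ?mulr_ge0// /D [leRHS](bigD1 i)//= lerDl sumr_ge0// => l _.
    by rewrite sumr_ge0// => j _; exact: Lpn_ge0.
  have W1 i := WnS hab hp (key i).1 (xE i).
  split=> i; first exact: (W1 i).1.
  rewrite (W1 i).2; have [_ N2] := key i.
  have := (Lpn_bounded hab hp (ccont_cmeas (cx i)) (mulr_ge0 C0 S0) (xS i)).2 => N1.
  by apply: le_trans (lerD N1 N2) _; rewrite le_eqVlt; apply/orP; left; apply/eqP; ring.
have WA' i j : in_W k (A i j) := (W_le hab hp (WA i j)).1.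
have [C C0 HC] := IH WA'.
have [C' C'0 HM] := WM hab hp k.+1.
pose D := \sum_i \sum_j Wn k.+1 (A i j).
have D0 i : 0 <= \sum_j Wn k.+1 (A i j) by rewrite sumr_ge0// => j _; exact: Wn_ge0.
exists (C + 1 + C' * D * C).
  by rewrite !addr_ge0 ?mulr_ge0 ?sumr_ge0.
move=> q g x Wg sx; have [cx xE] := sx; set S := \sum_j _.
have Wg' i : in_W k (g i) := (W_le hab hp (Wg i)).1.
have [Wx Nx] := HC q g x Wg' sx.
have Nx' i : Wn k.+1 (x i) <= C * S.
  apply: le_trans (Nx i) _; rewrite ler_wpM2l// /S; apply: ler_sum => j _.
  by rewrite lerD2l; exact: (W_le hab hp (Wg j)).2.
have S0 : 0 <= S by rewrite sumr_ge0// => j _; rewrite addr_ge0 ?nc_ge0 ?Wn_ge0.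
have P i j := HM (A i j) (x j) (WA i j) (Wx j).
have key i : in_W k.+1 (fun t => g i t + \sum_j A i j t * x j t) /\
    Wn k.+1 (fun t => g i t + \sum_j A i j t * x j t) <= S + C' * D * (C * S).
  have [W1 N1] := @W_sum R a b p hab hp k.+1 J (index_enum J) (fun j t => A i j t * x j t) (fun j => (P i j).1).
  have [W2 N2] := WD hab hp (Wg i) W1; split=> //; apply: le_trans N2 _; apply: lerD.
    rewrite /S (bigD1 i)//= -addrA addrCA lerDl addr_ge0 ?nc_ge0// sumr_ge0// => j _.
    by rewrite addr_ge0 ?nc_ge0 ?Wn_ge0.
  apply: le_trans N1 _; apply: (@le_trans _ _ (C' * (\sum_j Wn k.+1 (A i j)) * (C * S))).
    rewrite mulr_sumr mulr_suml; apply: ler_sum => j _; have [_ P2] := P i j.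
    apply: le_trans P2 _; rewrite -mulrA ler_wpM2l// ler_wpM2l ?Wn_ge0//.
  by rewrite ler_wpM2r ?mulr_ge0// ler_wpM2l// /D [leRHS](bigD1 i)//= lerDl sumr_ge0.
have W1 i := WnS hab hp (key i).1 (xE i).
split=> i; first exact: (W1 i).1.
rewrite (W1 i).2; have [_ N2] := key i.
have Lx : Lpn (x i) <= C * S.
  apply: le_trans (Nx' i); rewrite -(Wn0 hab hp (W_Lp hab hp (Wx i) : in_W 0 (x i))).
  by have [] := W_leq hab hp (leq0n k.+1) (Wx i).
by apply: le_trans (lerD Lx N2) _; rewrite le_eqVlt; apply/orP; left; apply/eqP; ring.
Qed.

End volterra_regularity.

(** * Equivalence of the differential equation with a first-order system *)

Section linear_systems.
Context {R : realType} (a b : R) (p : \bar R).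
Hypothesis hab : a < b.
Hypothesis hp : (1 <= p)%E.
Notation leb := (@lebesgue_measure R).
Local Notation Lpn := (Lpn a b p).
Local Notation Wn := (Wn a b p).
Local Notation in_W k := (in_W a b k p).
Local Notation vsol := (volterra_sol a b).

Lemma cint_ae_eq (f g : R -> R[i]) t : cmeas a b f -> cmeas a b g ->
  {ae leb, forall s, s \in `]a, b[ -> f s = g s} -> t \in `[a, b] -> cint f a t = cint g a t.
Proof.
move=> [fr fi] [gr gi] fg; rewrite in_itv/= => /andP[at_ tb].
have sub s : s \in `]a, t[ -> s \in `]a, b[.
  by rewrite !in_itv/= => /andP[-> st]; exact: lt_le_trans tb.
have mS (u : R -> R) : measurable_fun (`]a, b[%classic : set (measurableTypeR R)) u ->
    measurable_fun (`]a, t[%classic : set (measurableTypeR R)) u.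
  by move=> mu; apply: measurable_funS mu => // s /sub.
by apply: complexP; rewrite /cint/=; apply: integ_ae_eq;
  [exact: mS|exact: mS|apply: leb_aeS fg => s fgs /sub/fgs ->
  |exact: mS|exact: mS|apply: leb_aeS fg => s fgs /sub/fgs ->].
Qed.

(** The classical derivatives are uncontrolled at the endpoints, so [Y s] is a representative of the
    s-th derivative that belongs to W^(n+r-s) and is linked to [Y s.+1] by integration on all of
    [[a, b]]. *)
Lemma W_chain_elim n r (f : R -> R[i]) : in_W (n + r) f -> exists Y : nat -> R -> R[i],
  [/\ Y 0%N = f,
   forall s, (s <= r)%N -> in_W (n + (r - s)) (Y s) /\ Wn (n + (r - s)) (Y s) <= Wn (n + r) f,
   forall s, (s < r)%N -> forall t, t \in `[a, b] -> Y s t = Y s a + cint (Y s.+1) a t &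
   forall s t, (s <= r)%N -> t \in `]a, b[ -> cderiv s f t = Y s t].
Proof.
elim: r f => [|r IH] f Wf.
  exists (fun=> f); split=> //.
  by move=> s t; rewrite leqn0 => /eqP -> _; rewrite cderiv0.
rewrite addnS in Wf *; have [g [Wg fE fD fN]] := W_elimN hab hp Wf.
have [Y [Y0 YW YE YD]] := IH g Wg.
exists (fun s => if s is s'.+1 then Y s' else f); split=> //.
- move=> [|s] sr; first by rewrite subn0 addnS.
  rewrite subSS; have [? H] := YW s sr; split=> //; apply: le_trans H _.
  by rewrite fN lerDr Lpn_ge0.
- by move=> [|s] sr t tab; [rewrite Y0; exact: fE|exact: YE].
- by move=> [|s] t sr tab; [rewrite cderiv0|rewrite fD// YD].
Qed.

(** Converse construction. The separate clauses for order [r] match the two meanings of the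
    differential equation, everywhere for [n >= 1] and almost everywhere for [n = 0]. *)
Lemma W_chain_intro n r (Y : nat -> R -> R[i]) (z : nat -> R[i]) : in_W n (Y r) ->
  (forall s, (s < r)%N -> forall t, t \in `[a, b] -> Y s t = z s + cint (Y s.+1) a t) ->
  [/\ in_W (n + r) (Y 0%N), Wn (n + r) (Y 0%N) = \sum_(s < r) Lpn (Y s) + Wn n (Y r),
   forall s t, (s < r)%N -> t \in `]a, b[ -> cderiv s (Y 0%N) t = Y s t,
   (0 < n)%N -> forall t, t \in `]a, b[ -> cderiv r (Y 0%N) t = Y r t &
   {ae leb, forall t, t \in `]a, b[ -> cderiv r (Y 0%N) t = Y r t}].
Proof.
elim: r Y z => [|r IH] Y z WY YE.
  rewrite addn0; split=> //; first by rewrite big_ord0 add0r.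
  - by move=> _ t _; rewrite cderiv0.
  - by apply: aeW => t _; rewrite cderiv0.
have [||W1 N1 D1 D2 D3] := IH (fun s => Y s.+1) (fun s => z s.+1) => //.
  by move=> s sr; exact: YE.
have YE0 := YE 0%N isT; have [W2 N2] := WnS hab hp W1 YE0.
have [_ E1 E2] := W_intro hab hp W1 YE0.
rewrite addnS; split=> //.
- by rewrite N2 N1 big_ord_recl/= addrA.
- move=> [|s] t sr tab; first by rewrite cderiv0.
  by rewrite E1 ?D1//; apply: (leq_trans (sr : (s < r)%N)); exact: leq_addl.
- move=> n0 t tab; rewrite E1 ?D2//; last by rewrite -[X in (X < _)%N]add0n ltn_add2r.
- have [n0|n0] := posnP n.
    by rewrite n0 add0n in E2 D3; apply: leb_aeS (leb_aeI E2 D3) => t [h1 h2] tab; rewrite h1// h2.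
  by apply: aeW => t tab; rewrite E1 ?D2// -[X in (X < _)%N]add0n ltn_add2r.
Qed.

Context (n m r : nat) (hr : (0 < r)%N).

(* The unknown with index e = (j, i) stands for the j-th derivative of y_i. *)
Definition companion (A : 'I_r -> R -> 'M[R[i]]_m) (e e' : 'I_r * 'I_m) (t : R) : R[i] :=
  if (e.1.+1 < r)%N then ((e'.1 == e.1.+1 :> nat) && (e'.2 == e.2))%:R
  else - A e'.1 t e.2 e'.2.

Definition companion_rhs (f : R -> 'cV[R[i]]_m) (e : 'I_r * 'I_m) (t : R) : R[i] :=
  if (e.1.+1 < r)%N then 0 else f t e.2 0.

Lemma companion_W (A : 'I_r -> R -> 'M[R[i]]_m) k : (forall j, mx_in_W a b k p (A j)) -> forall e e', in_W k (companion A e e').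
Proof.
move=> WA e e'; rewrite /companion; case: (e.1.+1 < r)%N; first exact: (W_cst hab hp k _).1.
have := (WZ hab hp (-1) (WA e'.1 e.2 e'.2)).1.
by under eq_fun do rewrite mulN1r.
Qed.

Lemma companion_rhs_W (f : R -> 'cV[R[i]]_m) k : mx_in_W a b k p f -> forall e, in_W k (companion_rhs f e).
Proof.
move=> Wf e; rewrite /companion_rhs; case: (e.1.+1 < r)%N; first exact: (W_cst hab hp k _).1.
exact: Wf.
Qed.

Lemma companion_sum A x (e : 'I_r * 'I_m) t (h : (e.1.+1 < r)%N) :
  \sum_e' companion A e e' t * x e' t = x (Ordinal h, e.2) t :> R[i].
Proof.
rewrite (bigD1 (Ordinal h, e.2))//= big1 => [|e' ne].
  by rewrite addr0 /companion h/= !eqxx mul1r.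
rewrite /companion h; case: eqP => [e1|]; last by rewrite mul0r.
case: eqP => [e2|]; last by rewrite mul0r.
case: e' e1 e2 ne => [j i]/= e1 e2; rewrite e2.
by rewrite (_ : j = Ordinal h) ?eqxx//; exact: val_inj.
Qed.

Lemma diff_opE (A : 'I_r -> R -> 'M[R[i]]_m) (y : R -> 'cV[R[i]]_m) t i : diff_op A y t i 0 =
  cderiv r (fun u => y u i 0) t +
  \sum_(e : 'I_r * 'I_m) A e.1 t i e.2 * cderiv e.1 (fun u => y u e.2 0) t.
Proof.
rewrite /diff_op mxE summxE /mx_deriv mxE; congr (_ + _).
rewrite -(pair_bigA _ (fun j l => A j t i l * cderiv j (fun u => y u l 0) t))/=.
by apply: eq_bigr => j _; rewrite mxE; apply: eq_bigr => l _; rewrite mxE.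
Qed.

Lemma diff_eq_ae (A : 'I_r -> R -> 'M[R[i]]_m) (f y : R -> 'cV[R[i]]_m) : diff_eq a b n A f y ->
  {ae leb, forall t, t \in `]a, b[ -> diff_op A y t = f t}.
Proof. by rewrite /diff_eq; case: n => [//|k] H; exact: aeW. Qed.

Lemma ode_to_system (A : 'I_r -> R -> 'M[R[i]]_m) (f y : R -> 'cV[R[i]]_m) : (forall j, mx_in_W a b n p (A j)) -> mx_in_W a b n p f ->
  mx_in_W a b (n + r) p y -> diff_eq a b n A f y ->
  exists q x, vsol (companion A) q (companion_rhs f) x /\
    forall i t, x (Ordinal hr, i) t = y t i 0.
Proof.
move=> WA Wf Wy /diff_eq_ae Ly.
have [Y HY] := choice (fun i => W_chain_elim (Wy i 0)).
have YW i s : (s <= r)%N -> in_W (n + (r - s)) (Y i s) by move=> sr; case: (HY i) => _ /(_ s sr)[].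
pose x (e : 'I_r * 'I_m) := Y e.2 e.1.
have cx e : ccont a b (x e).
  apply: (@in_W_ccont R a b p (n + (r - e.1)).-1); rewrite prednK.
    by apply: YW; exact: ltnW.
  by rewrite addn_gt0 subn_gt0 ltn_ord orbT.
exists (fun e => x e a), x; split; last by move=> i t; rewrite /x/=; case: (HY i) => ->.
split=> // e t tab; have [_ _ YE _] := HY e.2.
rewrite /x YE//; congr (_ + _); have [h|h] := boolP (e.1.+1 < r)%N.
  congr cint; apply/funext => s; rewrite /companion_rhs h add0r.
  by rewrite (companion_sum A x _ h).
have er : e.1.+1 = r by apply/eqP; rewrite eqn_leq ltn_ord leqNgt.
have mA e1 e2 : in_Lp a b p (companion A e1 e2) := W_Lp hab hp (companion_W WA e1 e2).
(* Only the last row uses the differential equation; it stands under an integral, so that almost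
   everywhere is enough even for [n = 0]. *)
rewrite er; apply: cint_ae_eq => //.
- exact: (in_Lp_cmeas (W_Lp hab hp (YW e.2 r (leqnn r)))).
- apply: in_Lp_cmeas; apply: (LpnD hab hp (W_Lp hab hp (companion_rhs_W Wf e)) _).1.
  exact: Lp_row.
apply: leb_aeS Ly => s Ly sab; have := congr1 (fun M : 'cV_m => M e.2 0) (Ly sab).
rewrite diff_opE /companion_rhs (negPf h) => <-; case: (HY e.2) => _ _ _ ->//.
rewrite -addrA -big_split/= big1 ?addr0// => e' _.
rewrite /companion (negPf h) mulNr; case: (HY e'.2) => _ _ _ ->; rewrite ?subrr//.
exact: ltnW.
Qed.

Lemma system_to_ode (A : 'I_r -> R -> 'M[R[i]]_m) (f : R -> 'cV[R[i]]_m) q x : (forall j, mx_in_W a b n p (A j)) -> mx_in_W a b n p f ->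
  vsol (companion A) q (companion_rhs f) x -> (forall e, in_W n.+1 (x e)) ->
  let y t := \col_i x (Ordinal hr, i) t in
  [/\ mx_in_W a b (n + r) p y, diff_eq a b n A f y &
    forall i, Wn (n + r) (fun t => y t i 0) <= 2 * \sum_e Wn n.+1 (x e)].
Proof.
move=> WA Wf [cx xE] Wx y.
have yE i : (fun t => y t i 0) = x (Ordinal hr, i) by apply/funext => t; rewrite /y mxE.
have rp : (r.-1 < r)%N by rewrite prednK.
pose G e t := companion_rhs f e t + \sum_e' companion A e e' t * x e' t.
(* Below [r] the derivatives of [y_i] are unknowns of the system; the r-th one is the right-hand
   side of the last row. *)
pose Y i s t := if insub s is Some j then x (j, i) t else G (Ordinal rp, i) t.
have YN i (j : 'I_r) : Y i j = x (j, i) by apply/funext => t; rewrite /Y valK.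
have Y0 i : Y i 0%N = x (Ordinal hr, i) by rewrite -YN.
have Yr i : Y i r = G (Ordinal rp, i) by apply/funext => t; rewrite /Y insubF// ltnn.
pose z i s := if insub s is Some j then q (j, i) else 0.
have YE i s : (s < r)%N -> forall t, t \in `[a, b] -> Y i s t = z i s + cint (Y i s.+1) a t.
  move=> sr t tab; rewrite /z insubT -[s]/(val (Ordinal sr)) YN xE//; congr (_ + cint _ _ _).
  have [h|h] := boolP (s.+1 < r)%N.
    rewrite -[(val _).+1]/(val (Ordinal h)) YN; apply/funext => u.
    by rewrite (companion_sum A x u (h : ((Ordinal sr, i).1.+1 < r)%N)) /companion_rhs/= h add0r.
  have er : s.+1 = r by apply/eqP; rewrite eqn_leq sr leqNgt.
  rewrite /= er Yr; apply/funext => u; rewrite /G.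
  by rewrite (_ : Ordinal sr = Ordinal rp)//; apply/val_inj; rewrite /= -er.
have [C _ HM] := WM hab hp n.
have WG e : in_W n (G e).
  apply: (WD hab hp (companion_rhs_W Wf e) _).1.
  apply: (W_sum hab hp _ _).1 => e'.
  apply: (HM _ _ (companion_W WA e e') _).1.
  by have [] := @W_leq R a b p hab hp (maxn n 1) n.+1 _ _ (Wx e'); rewrite // geq_max leqnSn.
have GW i : in_W n (Y i r) by rewrite Yr.
have I i := W_chain_intro (GW i) (YE i).
have yD i s t : (s < r)%N -> t \in `]a, b[ -> cderiv s (fun u => y u i 0) t = Y i s t.
  by move=> sr tab; rewrite yE -Y0; have [_ _ H _ _] := I i; rewrite H.
have Leq t : t \in `]a, b[ -> (forall i, cderiv r (Y i 0%N) t = Y i r t) -> diff_op A y t = f t.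
  move=> tab HD; apply/matrixP => i j; rewrite (ord1 j) diff_opE yE -Y0 HD Yr /G /companion_rhs/=.
  rewrite prednK// ltnn -addrA -big_split/= big1 ?addr0// => e _.
  rewrite yD// YN /companion/= prednK// ltnn mulNr addrC.
  by case: e => e1 e2 /=; rewrite subrr.
split.
- by move=> i j; rewrite (ord1 j) yE -Y0; case: (I i).
- rewrite /diff_eq; have [n0|n0] := posnP n.
    (* The exceptional null sets are united over the naturals, hence the detour through [insub] for
       a finite index. *)
    rewrite n0; have /ae_foralln H : forall i : nat, {ae leb, forall t, t \in `]a, b[ ->
        if insub i is Some i' then cderiv r (Y i' 0%N) t = Y i' r t else True}.
      move=> i; case: insubP => [i' _ _|_]; last by apply: aeW.
      by have [_ _ _ _] := I i'.
    apply: leb_aeS H => t H tab; apply: Leq => // i.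
    by have := H (val i) tab; rewrite valK.
  rewrite -(prednK n0) => t tab; apply: Leq => // i; have [_ _ _ + _] := I i.
  by apply.
- move=> i; rewrite yE -Y0; have [_ -> _ _ _] := I i; rewrite mulr_natl mulr2n; apply: lerD.
    apply: (@le_trans _ _ (\sum_(s < r) Wn n.+1 (x (s, i)))).
      apply: ler_sum => s _; rewrite YN -(Wn0 hab hp (W_Lp hab hp (Wx (s, i)) : in_W 0 _)).
      by have [] := W_leq hab hp (leq0n n.+1) (Wx (s, i)).
    have -> : \sum_e Wn n.+1 (x e) = \sum_s \sum_l Wn n.+1 (x (s, l)).
      by rewrite pair_bigA; apply: eq_bigr => -[].
    by apply: ler_sum => s _; rewrite [leRHS](bigD1 i)//= lerDl sumr_ge0// => l _; exact: Wn_ge0.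
  rewrite Yr; have := (WnS hab hp (WG (Ordinal rp, i)) (xE (Ordinal rp, i))).2 => N1.
  apply: (@le_trans _ _ (Wn n.+1 (x (Ordinal rp, i)))); first by rewrite N1 lerDr Lpn_ge0.
  by rewrite (bigD1 (Ordinal rp, i))//= lerDl sumr_ge0// => e _; exact: Wn_ge0.
Qed.

(** If the block of order j vanishes, so does its norm, which dominates that of the block of order j
    + 1. All blocks are thus zero, in particular at [a]; this gives the independence of the
    fundamental solutions. *)
Lemma system_first_eq0 A q x : (forall e, in_W n.+1 (x e)) ->
  vsol (companion A) q (companion_rhs (fun=> 0)) x ->
  (forall i t, t \in `[a, b] -> x (Ordinal hr, i) t = 0) -> forall e, q e = 0.
Proof.
move=> Wx [cx xE] x0; have [C C0 HC] := W_sup hab hp.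
have xz j i (jr : (j < r)%N) t : t \in `[a, b] -> x (Ordinal jr, i) t = 0.
  elim: j jr t => [|j IH] jr t tab; first by rewrite (_ : Ordinal jr = Ordinal hr) ?x0//; exact: val_inj.
  have jr' : (j < r)%N by apply: leq_trans jr.
  have E1 s : s \in `[a, b] -> x (Ordinal jr', i) s = q (Ordinal jr', i) + cint (x (Ordinal jr, i)) a s.
    move=> sab; rewrite xE//; congr (_ + cint _ _ _); apply/funext => u.
    by rewrite (companion_sum A x u (jr : ((Ordinal jr', i).1.+1 < r)%N)) /companion_rhs/= jr add0r.
  have [W2 N2] := WnS hab hp (Wx (Ordinal jr, i)) E1.
  have [|_ N0] := @W_congr R a b p hab hp n.+2 _ (fun=> 0) _ W2.
    by move=> s sab; exact: IH.
  rewrite (W_cst hab hp n.+2 0).2 N2 in N0.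
  have N1 : Wn n.+1 (x (Ordinal jr, i)) <= 0 by rewrite N0 lerDr Lpn_ge0.
  apply/nc_eq0/eqP; rewrite eq_le nc_ge0 andbT.
  by apply: le_trans (HC n _ (Wx _) t tab) _; rewrite -(mulr0 C) ler_wpM2l.
move=> [[j jr] i]; have aab : a \in `[a, b] by rewrite in_itv/= lexx ltW.
by have := xE (Ordinal jr, i) a aab; rewrite xz// cint0 addr0.
Qed.

End linear_systems.

Section fundamental_solutions.
Context {R : realType} (a b : R) (p : \bar R).
Hypothesis hab : a < b.
Hypothesis hp : (1 <= p)%E.
Notation nc := (@ComplexField.Normc.normc R).
Local Notation Wn := (Wn a b p).
Local Notation in_W k := (in_W a b k p).
Local Notation vsol := (volterra_sol a b).
Context (n m r : nat) (hr : (0 < r)%N).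
Local Notation V k := (mx_in_W a b k p).
Local Notation E := ('I_r * 'I_m)%type.

Definition mxN {q1 q2 : nat} k (F : R -> 'M[R[i]]_(q1, q2)) : R :=
  \sum_i \sum_j Wn k (fun t => F t i j).

(* Solutions with zero Cauchy data at a depend boundedly on f, and the solutions of the
   homogeneous equation form a space of dimension r m. *)
Lemma fundamental_solutions (A : 'I_r -> R -> 'M[R[i]]_m) : (forall j, V n (A j)) ->
  exists (Z : E -> R -> 'cV[R[i]]_m) (C : R), [/\ 0 <= C,
    forall e, V (n + r) (Z e) /\ diff_eq a b n A (fun=> 0) (Z e),
    forall c : E -> R[i], (forall t, t \in `[a, b] -> \sum_e c e *: Z e t = 0) -> forall e, c e = 0 &
    forall f, V n f -> exists s, [/\ V (n + r) s, diff_eq a b n A f s, mxN (n + r) s <= C * mxN n f &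
      forall y, V (n + r) y -> diff_eq a b n A f y ->
      exists c : E -> R[i], forall t, t \in `[a, b] -> y t = s t + \sum_e c e *: Z e t]].
Proof.
move=> WA; have WC := companion_W hab hp WA.
have LC e e' : in_Lp a b p (companion A e e') := W_Lp hab hp (WC e e').
have [C C0 HC] := volterra_regular hab hp WC.
have V0 : V n (fun=> 0 : 'cV[R[i]]_m).
  by move=> i j; under eq_fun do rewrite mxE; exact: (W_cst hab hp n 0).1.
have g0 : companion_rhs (r := r) (fun=> 0 : 'cV[R[i]]_m) = fun _ _ => 0.
  by apply/funext => e; apply/funext => t; rewrite /companion_rhs mxE; case: ifP.
have solve f q : V n f -> exists x, [/\ vsol (companion A) q (companion_rhs f) x,
    forall e, in_W n.+1 (x e) & forall e, Wn n.+1 (x e) <= C * \sum_e' (nc (q e') + Wn n (companion_rhs f e'))].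
  move=> Wf; have Wg := companion_rhs_W (r := r) hab hp Wf.
  have Lg (e : E) : in_Lp a b p (companion_rhs f e) by exact: (W_Lp hab hp (Wg e)).
  have [x sx] := volterra_exists hab hp LC q Lg.
  by have [W1 N1] := HC q _ x Wg sx; exists x.
(* The homogeneous solution whose Cauchy data at [a] are the unit vector of index [e]. *)
have [x_ Hx] := choice (fun e : E => solve (fun=> 0) (fun e' => (e' == e)%:R) V0).
pose o0 := Ordinal hr.
exists (fun e t => \col_i x_ e (o0, i) t), (m%:R * (2 * (#|{: E}|%:R * (C * r%:R)))).
split; first by rewrite !mulr_ge0.
  by move=> e; have [S1 S2 _] := Hx e; have [] := system_to_ode hab hp hr WA V0 S1 S2.
  move=> c c0; have L0 (e : E) : in_Lp a b p (fun=> 0) := (W_cst hab hp 0 0).1.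
  have Z0 e : vsol (companion A) (fun e' => (e' == e)%:R) (fun _ _ => 0) (x_ e).
    by rewrite -g0; case: (Hx e).
  have z0 : vsol (companion A) (fun=> 0) (fun _ _ => 0) (fun _ _ => 0).
    split=> [e|e t tab]; first by apply: (in_W_ccont (k := 0)); exact: (W_cst hab hp 1 0).1.
    rewrite add0r (_ : (fun s => _) = fun=> 0).
      by rewrite cint_zero//; move: tab; rewrite in_itv/= => /andP[].
    by apply/funext => s; rewrite add0r big1// => e' _; rewrite mulr0.
  have := volterra_sum hab hp (index_enum _) c LC L0 Z0 z0.
  rewrite (_ : (fun i => _ + 0) = c); last first.
    apply/funext => e; rewrite addr0 (bigD1 e)//= eqxx mulr1 big1 ?addr0// => e' ne.
    by rewrite eq_sym (negPf ne) mulr0.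
  rewrite -g0 => S; apply: (system_first_eq0 hab hp (n := n) (hr := hr)) S _ => [e|i t tab].
    have W0 : in_W n.+1 (fun=> 0) := (W_cst hab hp n.+1 0).1.
    apply: (WD hab hp _ W0).1; apply: (W_sum hab hp _ _).1 => e'; apply: (WZ hab hp _ _).1.
    by have [_ Wx _] := Hx e'; exact: Wx.
  have := congr1 (fun M : 'cV_m => M i 0) (c0 t tab); rewrite summxE [RHS]mxE addr0 => h; apply: etrans h.
  by apply: eq_bigr => e _; rewrite !mxE.
move=> f Wf; have [x [S1 S2 S3]] := solve f (fun=> 0) Wf.
have [T1 T2 T3] := system_to_ode hab hp hr WA Wf S1 S2.
exists (fun t => \col_i x (o0, i) t); split=> //.
  apply: (@le_trans _ _ (\sum_(i < m) 2 * \sum_e Wn n.+1 (x e))).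
    by apply: ler_sum => i _; rewrite big_ord1.
  rewrite sumr_const card_ord -[_ *+ m]mulr_natl -!mulrA ler_wpM2l// ler_wpM2l//.
  have G : \sum_(e' : E) (nc 0 + Wn n (companion_rhs f e')) <= r%:R * mxN n f.
    have -> : \sum_(e' : E) (nc 0 + Wn n (companion_rhs f e')) =
        \sum_(j < r) \sum_(i < m) (nc 0 + Wn n (companion_rhs f (j, i))).
      by rewrite pair_bigA; apply: eq_bigr => -[].
    apply: (@le_trans _ _ (\sum_(j < r) mxN n f)); last by rewrite sumr_const card_ord mulr_natl.
    apply: ler_sum => j _; apply: ler_sum => i _; rewrite big_ord1 nc0 add0r /companion_rhs/=.
    by case: (j.+1 < r)%N => //; rewrite (W_cst hab hp n 0).2 Wn_ge0.
  apply: (@le_trans _ _ (\sum_(e : E) C * (r%:R * mxN n f))); last first.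
    by rewrite sumr_const -[_ *+ _]mulr_natl.
  by apply: ler_sum => e _; apply: le_trans (S3 e) _; rewrite ler_wpM2l.
(* The coefficients are the Cauchy data [q] of [y]: the given solution and the combination solve the
   same system with the same data. *)
move=> y Wy Ly; have [q [x' [S4 yE]]] := ode_to_system hab hp hr WA Wf Wy Ly.
exists q => t tab; apply/matrixP => i j; rewrite (ord1 j) -yE !mxE summxE.
have Z0 e : vsol (companion A) (fun e' => (e' == e)%:R) (fun _ _ => 0) (x_ e).
  by rewrite -g0; case: (Hx e).
have Lg (e : E) : in_Lp a b p (companion_rhs f e) by exact: (W_Lp hab hp (companion_rhs_W (r := r) hab hp Wf e)).
have := volterra_sum hab hp (index_enum _) q LC Lg Z0 S1.
rewrite (_ : (fun i => _ + 0) = q); last first.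
  apply/funext => e; rewrite addr0 (bigD1 e)//= eqxx mulr1 big1 ?addr0// => e' ne.
  by rewrite eq_sym (negPf ne) mulr0.
move=> S5; rewrite (volterra_uniq hab hp LC Lg S4 S5 (o0, i) tab) addrC; congr (_ + _).
by apply: eq_bigr => e _; rewrite !mxE.
Qed.

End fundamental_solutions.

(** * Boundary-value problems *)

Section vector_sobolev.
Context {R : realType} (a b : R) (p : \bar R).
Hypothesis hab : a < b.
Hypothesis hp : (1 <= p)%E.
Notation nc := (@ComplexField.Normc.normc R).
Local Notation Wn := (Wn a b p).
Local Notation mxN := (mxN a b p).
Local Notation in_W k := (in_W a b k p).

Lemma mx_W_normE q1 q2 k (F : R -> 'M[R[i]]_(q1, q2)) : mx_in_W a b k p F ->
  mx_W_norm a b k p F = (mxN k F)%:E.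
Proof.
move=> WF; rewrite /mx_W_norm -sumEFin; apply: eq_bigr => i _.
by rewrite -sumEFin; apply: eq_bigr => j _; rewrite (WnE hab hp (WF i j)).
Qed.

Lemma mxN_ge0 q1 q2 k (F : R -> 'M[R[i]]_(q1, q2)) : 0 <= mxN k F.
Proof. by apply: sumr_ge0 => i _; apply: sumr_ge0 => j _; exact: Wn_ge0. Qed.

Lemma mxN_entry q1 q2 k (F : R -> 'M[R[i]]_(q1, q2)) i j : Wn k (fun t => F t i j) <= mxN k F.
Proof.
rewrite [leRHS](bigD1 i)//= (bigD1 j)//= -addrA lerDl addr_ge0//.
  by apply: sumr_ge0 => l _; exact: Wn_ge0.
by apply: sumr_ge0 => l _; apply: sumr_ge0 => l' _; exact: Wn_ge0.
Qed.

Lemma mx_lin q1 q2 k (x : R[i]) (F G : R -> 'M[R[i]]_(q1, q2)) :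
  mx_in_W a b k p F -> mx_in_W a b k p G ->
  mx_in_W a b k p (x *: F + G) /\ mxN k (x *: F + G) <= nc x * mxN k F + mxN k G.
Proof.
move=> WF WG.
have E i j : (fun t => (x *: F + G) t i j) = (fun t => x * F t i j + G t i j).
  by apply/funext => t; rewrite !mxE.
have H i j := W_lin hab hp x (WF i j) (WG i j).
split; first by move=> i j; rewrite E; case: (H i j).
rewrite mulr_sumr -big_split/=; apply: ler_sum => i _.
by rewrite mulr_sumr -big_split/=; apply: ler_sum => j _; rewrite E; case: (H i j).
Qed.

Lemma mxB q1 q2 k (F G : R -> 'M[R[i]]_(q1, q2)) :
  mx_in_W a b k p F -> mx_in_W a b k p G ->
  mx_in_W a b k p (F - G) /\ mxN k (F - G) <= mxN k F + mxN k G.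
Proof.
move=> WF WG; have := mx_lin (-1) WG WF.
by rewrite ncN nc1 mul1r [leRHS]addrC scaleN1r [- G + F]addrC.
Qed.

Lemma mx0 q1 q2 k : mx_in_W a b k p (0 : R -> 'M[R[i]]_(q1, q2)) /\
  mxN k (0 : R -> 'M[R[i]]_(q1, q2)) = 0.
Proof.
have E i j : (fun t : R => (0 : R -> 'M[R[i]]_(q1, q2)) t i j) = fun=> 0.
  by apply/funext => t; rewrite mxE.
split; first by move=> i j; rewrite E; exact: (W_cst hab hp k 0).1.
by apply: big1 => i _; apply: big1 => j _; rewrite E; exact: (W_cst hab hp k 0).2.
Qed.

Lemma mx_sum q1 q2 k (J : Type) (s : seq J) (c : J -> R[i]) (F : J -> R -> 'M[R[i]]_(q1, q2)) :
  (forall e, mx_in_W a b k p (F e)) -> mx_in_W a b k p (\sum_(e <- s) c e *: F e) /\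
  mxN k (\sum_(e <- s) c e *: F e) <= \sum_(e <- s) nc (c e) * mxN k (F e).
Proof.
move=> WF; elim: s => [|e s [IH1 IH2]].
  by have [W0 N0] := mx0 q1 q2 k; rewrite !big_nil N0.
have [h1 h2] := mx_lin (c e) (WF e) IH1; rewrite !big_cons; split=> //.
by apply: le_trans h2 _; rewrite lerD2l.
Qed.

Lemma mx_congr q1 q2 k (F G : R -> 'M[R[i]]_(q1, q2)) : (forall t, t \in `[a, b] -> F t = G t) ->
  mx_in_W a b k p F -> mx_in_W a b k p G /\ mxN k G = mxN k F.
Proof.
move=> FG WF; have H i j : in_W k (fun t => G t i j) /\ Wn k (fun t => G t i j) = Wn k (fun t => F t i j).
  by apply: (W_congr hab hp) => // t tab; rewrite FG.
split; first by move=> i j; case: (H i j).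
by apply: eq_bigr => i _; apply: eq_bigr => j _; case: (H i j).
Qed.

Lemma mxN_eq0 q1 q2 k (F : R -> 'M[R[i]]_(q1, q2)) : mx_in_W a b k.+1 p F -> mxN k.+1 F <= 0 ->
  forall t, t \in `[a, b] -> F t = 0.
Proof.
move=> WF N0 t tab; have [C C0 HC] := W_sup hab hp.
apply/matrixP => i j; rewrite mxE; apply/nc_eq0/eqP; rewrite eq_le nc_ge0 andbT.
apply: le_trans (HC k _ (WF i j) t tab) _; rewrite -(mulr0 C) ler_wpM2l//.
by apply: le_trans N0; exact: (mxN_entry k.+1 F i j).
Qed.

Lemma mxN_dist k q1 q2 (F G H : R -> 'M[R[i]]_(q1, q2)) :
  mx_in_W a b k p F -> mx_in_W a b k p G -> mx_in_W a b k p H ->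
  mxN k (F - H) <= mxN k (F - G) + mxN k (G - H).
Proof.
move=> WF WG WH; have := (mx_lin 1 (mxB WF WG).1 (mxB WG WH).1).2.
by rewrite scale1r nc1 mul1r addrA subrK.
Qed.

Lemma mxNN k q1 q2 (F G : R -> 'M[R[i]]_(q1, q2)) :
  mx_in_W a b k p F -> mx_in_W a b k p G -> mxN k (F - G) = mxN k (G - F).
Proof.
move=> WF WG; have [W0 N0] := mx0 q1 q2 k.
have H (X Y : R -> 'M[R[i]]_(q1, q2)) : mx_in_W a b k p X -> mx_in_W a b k p Y -> mxN k (X - Y) <= mxN k (Y - X).
  move=> WX WY; have := (mx_lin (-1) (mxB WY WX).1 W0).2.
  by rewrite ncN nc1 mul1r N0 !addr0 scaleN1r opprB.
by apply/eqP; rewrite eq_le !H.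
Qed.

Lemma mx_complete k q1 q2 (F_ : nat -> R -> 'M[R[i]]_(q1, q2)) (K q : R) : 0 < q -> q < 1 ->
  (forall n, mx_in_W a b k p (F_ n)) -> (forall n, mxN k (F_ n.+1 - F_ n) <= K * q ^+ n) ->
  exists2 F, mx_in_W a b k p F & forall n, mxN k (F - F_ n) <= (q1 * q2)%:R * (K / (1 - q) * q ^+ n).
Proof.
move=> q0 q1' WF FK.
have H ij : exists f, in_W k f /\
    forall n, Wn k (fun t => f t - F_ n t ij.1 ij.2) <= K / (1 - q) * q ^+ n.
  have [|n|f Wf Hf] := @W_complete R a b p hab hp k (fun n t => F_ n t ij.1 ij.2) K q q0 q1'.
  - by move=> n; exact: WF.
  - apply: le_trans (FK n); apply: le_trans (mxN_entry _ _ ij.1 ij.2).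
    by rewrite (_ : (fun t => _) = fun t => (F_ n.+1 - F_ n) t ij.1 ij.2)//; apply/funext => t; rewrite !mxE.
  by exists f.
have [f Hf] := choice H.
exists (fun t => \matrix_(i, j) f (i, j) t).
  by move=> i j; under eq_fun do rewrite mxE; case: (Hf (i, j)).
move=> n; rewrite natrM -mulrA; set X := K / (1 - q) * q ^+ n.
apply: (@le_trans _ _ (\sum_(i < q1) \sum_(j < q2) X)); last first.
  by rewrite !sumr_const !card_ord [leRHS]mulr_natl [q2%:R * X]mulr_natl.
apply: ler_sum => i _; apply: ler_sum => j _; have [_ /(_ n)] := Hf (i, j).
by congr (Wn _ _ <= _); apply/funext => t; rewrite !mxE.
Qed.

End vector_sobolev.

Section column_norm.
Context {R : realType} {q : nat}.
Notation nc := (@ComplexField.Normc.normc R).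
Implicit Types c d : 'cV[R[i]]_q.

Lemma cv_norm_ge0 c : 0 <= cv_norm c.
Proof. by apply: sumr_ge0 => i _; exact: nc_ge0. Qed.

Lemma cv_normD c d : cv_norm (c + d) <= cv_norm c + cv_norm d.
Proof. by rewrite /cv_norm -big_split/=; apply: ler_sum => i _; rewrite mxE; exact: ncD. Qed.

Lemma cv_normZ x c : cv_norm (x *: c) = nc x * cv_norm c.
Proof. by rewrite /cv_norm mulr_sumr; apply: eq_bigr => i _; rewrite mxE ncM. Qed.

Lemma cv_normN c : cv_norm (- c) = cv_norm c.
Proof. by rewrite -scaleN1r cv_normZ ncN nc1 mul1r. Qed.

Lemma cv_normB c d : cv_norm (c - d) <= cv_norm c + cv_norm d.
Proof. by rewrite -(cv_normN d); exact: cv_normD. Qed.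

Lemma cv_norm_dist c d e : cv_norm (c - e) <= cv_norm (c - d) + cv_norm (d - e).
Proof. by have := cv_normD (c - d) (d - e); rewrite addrA subrK. Qed.

Lemma cv_norm0 : cv_norm (0 : 'cV[R[i]]_q) = 0.
Proof. by rewrite /cv_norm big1// => i _; rewrite mxE nc0. Qed.

Lemma cv_norm_eq0 c : cv_norm c <= 0 -> c = 0.
Proof.
move=> c0; apply/matrixP => i j; rewrite (ord1 j) mxE; apply/nc_eq0/eqP.
rewrite eq_le nc_ge0 andbT; apply: le_trans c0.
by rewrite /cv_norm (bigD1 i)//= lerDl sumr_ge0// => l _; exact: nc_ge0.
Qed.

Lemma cv_norm_sum (J : Type) (s : seq J) (F : J -> 'cV[R[i]]_q) :
  cv_norm (\sum_(e <- s) F e) <= \sum_(e <- s) cv_norm (F e).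
Proof.
elim: s => [|e s IH]; first by rewrite !big_nil cv_norm0.
by rewrite !big_cons; apply: le_trans (cv_normD _ _) _; rewrite lerD2l.
Qed.

Lemma cv_norm_entry c i : nc (c i 0) <= cv_norm c.
Proof. by rewrite /cv_norm (bigD1 i)//= lerDl sumr_ge0// => l _; exact: nc_ge0. Qed.

End column_norm.

(** * Continuous linear operators on Sobolev spaces *)

Section bounded_operators.
Context {R : realType} (a b : R) (p : \bar R) (k m q : nat).
Hypothesis hab : a < b.
Hypothesis hp : (1 <= p)%E.
Notation nc := (@ComplexField.Normc.normc R).
Local Notation V := (@mx_in_W R m 1 a b k p).
Local Notation N := (@mxN R a b p m 1 k).
Variable B : (R -> 'cV[R[i]]_m) -> 'cV[R[i]]_q.
Hypothesis hB : continuous_linear_on_W a b k p B.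

Lemma op_lin x y z : V y -> V z -> B (x *: y + z) = x *: B y + B z.
Proof. by case: hB => H _; exact: H. Qed.

Lemma op0 : B 0 = 0.
Proof.
have [V0 _] := mx0 hab hp m 1 k.
have := op_lin 1 V0 V0; rewrite !scale1r addr0 => h.
by apply: (addrI (B 0)); rewrite addr0.
Qed.

Lemma opB y z : V y -> V z -> B (y - z) = B y - B z.
Proof.
by move=> Vy Vz; have := op_lin (-1) Vz Vy; rewrite !scaleN1r [- z + y]addrC [- B z + B y]addrC.
Qed.

Lemma op_sum (J : Type) (s : seq J) (c : J -> R[i]) F : (forall e, V (F e)) ->
  B (\sum_(e <- s) c e *: F e) = \sum_(e <- s) c e *: B (F e).
Proof.
move=> VF; elim: s => [|e s IH]; first by rewrite !big_nil op0.
by rewrite !big_cons op_lin ?IH//; exact: (mx_sum hab hp s c VF).1.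
Qed.

(** If the bound failed for [y], division of [y] by the norm of its image would give a vector in the
    ball of radius [d] with image of norm 1. Scaling by the image rather than by [N y] also treats
    functions of norm 0. *)
Lemma op_bounded : exists2 K : R, 0 <= K & forall y, V y -> cv_norm (B y) <= K * N y.
Proof.
have [V0 N0] := mx0 hab hp m 1 k.
have [_ /(_ 0 V0 1 ltr01)[d d0 H]] := hB.
exists d^-1; first by rewrite invr_ge0 ltW.
move=> y Vy; rewrite leNgt; apply/negP => h; set s := cv_norm (B y) in h.
have s0 : 0 < s by apply: le_lt_trans h; rewrite mulr_ge0 ?invr_ge0 ?mxN_ge0// ltW.
have [Vz Nz] := mx_lin hab hp (s^-1)%:C%C Vy V0.
have E : B ((s^-1)%:C%C *: y + 0) - B 0 = (s^-1)%:C%C *: B y.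
  by rewrite (op_lin _ Vy V0) op0 addr0 subr0.
have := H _ Vz; rewrite subr0 (mx_W_normE hab hp Vz) lte_fin E cv_normZ.
have sE : nc (s^-1)%:C%C = s^-1 by rewrite nc_real ger0_norm// invr_ge0 ltW.
rewrite sE -/s mulVf ?gt_eqF// ltxx => /(_ _)/negP; apply => //.
apply: le_lt_trans Nz _; rewrite N0 addr0 sE.
by rewrite mulrC ltr_pdivrMr// mulrC -ltr_pdivrMr// mulrC.
Qed.

(** Uniqueness yields equality on [[a, b]] only; this carries it over to boundary values. *)
Lemma op_congr y z : V y -> (forall t, t \in `[a, b] -> y t = z t) -> B y = B z.
Proof.
move=> Vy yz; have [Vz _] := mx_congr hab hp yz Vy.
apply/eqP; rewrite -subr_eq0; apply/eqP/cv_norm_eq0; rewrite -opB//.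
have [K K0 HK] := op_bounded; apply: le_trans (HK _ (mxB hab hp Vy Vz).1) _.
have [V0 N0] := mx0 hab hp m 1 k.
have [|_ ->] := mx_congr hab hp (_ : forall t, t \in `[a, b] -> (0 : R -> 'cV[R[i]]_m) t = (y - z) t) V0.
  by move=> t tab; rewrite /= !fctE yz// subrr.
by rewrite N0 mulr0.
Qed.

End bounded_operators.

(** * Estimates for the differential operator *)

Section differential_operator.
Context {R : realType} (a b : R) (p : \bar R).
Hypothesis hab : a < b.
Hypothesis hp : (1 <= p)%E.
Notation leb := (@lebesgue_measure R).
Local Notation Wn := (Wn a b p).
Local Notation in_W k := (in_W a b k p).
Context (n m r : nat).
Local Notation V k := (@mx_in_W R m 1 a b k p).
Local Notation VM := (@mx_in_W R m m a b n p).
Local Notation N := (mxN a b p).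
Implicit Types (A : 'I_r -> R -> 'M[R[i]]_m) (f y : R -> 'cV[R[i]]_m).

(** The componentwise form of the two readings of [diff_eq]. *)
Definition eqW (u v : R -> R[i]) : Prop :=
  if n is 0 then {ae leb, forall t, t \in `]a, b[ -> u t = v t}
  else forall t, t \in `]a, b[ -> u t = v t.

Lemma eqW_Wn u v : in_W n u -> in_W n v -> eqW u v -> Wn n u = Wn n v.
Proof.
rewrite /eqW; case: n => [|k] Wu Wv uv.
  rewrite !Wn0//; congr fine; exact: (Lpn_ae_eq hab hp (in_Lp_cmeas Wu) (in_Lp_cmeas Wv) uv).
rewrite !Wn_sum//; apply: eq_bigr => s _; congr fine; apply/esym.
apply: (Lpn_local hab hp); last by apply: W_cderiv_Lp Wu _ => //; rewrite -ltnS.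
by apply: cderiv_local => t; exact: uv.
Qed.

Lemma diff_eqP A f y : diff_eq a b n A f y <->
  forall i, eqW (fun t => diff_op A y t i 0) (fun t => f t i 0).
Proof.
split=> [|H].
  rewrite /diff_eq /eqW; case: n => [H i|k H i t tab]; last by rewrite H.
  by apply: leb_aeS H => t h tab; rewrite h.
rewrite /diff_eq; move: H; rewrite /eqW; case: n => [H|k H t tab]; last first.
  by apply/matrixP => i j; rewrite (ord1 j) H.
have /ae_foralln H' : forall j : nat, {ae leb, forall t, t \in `]a, b[ ->
    forall i : 'I_m, i = j :> nat -> diff_op A y t i 0 = f t i 0}.
  move=> j; have [jm|jm] := ltnP j m; last first.
    by apply: aeW => t _ i ij; move: (ltn_ord i); rewrite ij ltnNge jm.
  apply: leb_aeS (H (Ordinal jm)) => t h tab i ij.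
  by rewrite (_ : i = Ordinal jm) ?h//; exact: val_inj.
by apply: leb_aeS H' => t h tab; apply/matrixP => i j; rewrite (ord1 j) (h _ tab i erefl).
Qed.

Definition lower_order A (Y : 'I_m -> nat -> R -> R[i]) i t : R[i] :=
  \sum_(e : 'I_r * 'I_m) A e.1 t i e.2 * Y e.2 e.1 t.

(** The representatives depend on [y] alone, so one choice serves for different coefficients and
    right-hand sides, and both sides of the equation become elements of W^n whose norms can be
    compared. *)
Lemma diff_repr y : V (n + r) y -> exists Y : 'I_m -> nat -> R -> R[i],
  (forall i s, (s <= r)%N -> in_W (n + (r - s)) (Y i s) /\ Wn (n + (r - s)) (Y i s) <= N (n + r) y) /\
  forall A f, diff_eq a b n A f y <->
    forall i, eqW (fun t => Y i r t + lower_order A Y i t) (fun t => f t i 0).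
Proof.
move=> Vy; have [Y HY] := choice (fun i => W_chain_elim hab hp (Vy i 0)).
exists Y; split.
  move=> i s sr; have [_ /(_ s sr)[W1 N1] _ _] := HY i; split=> //.
  by apply: le_trans N1 _; exact: (mxN_entry a b p (n + r) y i 0).
move=> A f; rewrite diff_eqP.
have E i t : t \in `]a, b[ -> diff_op A y t i 0 = Y i r t + lower_order A Y i t.
  move=> tab; rewrite diff_opE; have [_ _ _ ->//] := HY i; congr (_ + _).
  by apply: eq_bigr => e _; have [_ _ _ ->//] := HY e.2; exact: ltnW.
have H u v w : (forall t, t \in `]a, b[ -> u t = v t) -> eqW u w -> eqW v w.
  rewrite /eqW => uv; case: n => [h|k h t tab]; last by rewrite -uv// h.
  by apply: leb_aeS h => t h tab; rewrite -uv// h.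
split=> h i; apply: H (h i) => t tab; first exact: E.
by rewrite E.
Qed.

Lemma lower_order_W : exists2 C : R, 0 <= C & forall A Y (K : R), (forall j, VM (A j)) ->
  (forall i s, (s < r)%N -> in_W (n + (r - s)) (Y i s) /\ Wn (n + (r - s)) (Y i s) <= K) ->
  0 <= K -> forall i, in_W n (lower_order A Y i) /\ Wn n (lower_order A Y i) <= C * (\sum_j N n (A j)) * K.
Proof.
have [C C0 HC] := WM hab hp n; exists C => // A Y K VA HY K0 i.
have P (e : 'I_r * 'I_m) : in_W n (fun t => A e.1 t i e.2 * Y e.2 e.1 t) /\
    Wn n (fun t => A e.1 t i e.2 * Y e.2 e.1 t) <= C * Wn n (fun t => A e.1 t i e.2) * K.
  have [W1 N1] := HY e.2 e.1 (ltn_ord _).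
  have le1 : (maxn n 1 <= n + (r - e.1))%N.
    by rewrite geq_max leq_addr addn_gt0 subn_gt0 ltn_ord orbT.
  have [W2 N2] := W_leq hab hp le1 W1.
  have [W3 N3] := HC _ _ (VA e.1 i e.2) W2; split=> //; apply: le_trans N3 _.
  by rewrite -mulrA ler_wpM2l// ler_wpM2l ?Wn_ge0//; exact: le_trans N1.
have [W1 N1] := W_sum hab hp (index_enum _) (fun e => (P e).1).
split=> //; apply: le_trans N1 _.
apply: (@le_trans _ _ (\sum_(e : 'I_r * 'I_m) C * Wn n (fun t => A e.1 t i e.2) * K)).
  by apply: ler_sum => e _; case: (P e).
rewrite -mulr_suml ler_wpM2r// -mulr_sumr ler_wpM2l//.
rewrite -(pair_bigA _ (fun j l => Wn n (fun t => A j t i l)))/=; apply: ler_sum => j _.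
rewrite /mxN [leRHS](bigD1 i)//= lerDl; apply: sumr_ge0 => l _; apply: sumr_ge0 => l' _.
exact: Wn_ge0.
Qed.

(** [diff_op A y] itself need not be continuous up to the endpoints, where it involves dummy values;
    [f] is its representative in W^n. *)
Lemma diff_op_exists A y : (forall j, VM (A j)) -> V (n + r) y -> exists2 f, V n f & diff_eq a b n A f y.
Proof.
move=> VA Vy; have [Y [WY HY]] := diff_repr Vy; have [C C0 HC] := lower_order_W.
have W1 i := (HC A Y _ VA (fun i s h => WY i s (ltnW h)) (mxN_ge0 a b p (n + r) y) i).1.
have W2 i : in_W n (Y i r) by have [] := WY i r (leqnn r); rewrite subnn addn0.
exists (fun t => \col_i (Y i r t + lower_order A Y i t)).
  by move=> i j; under eq_fun do rewrite mxE; exact: (WD hab hp (W2 i) (W1 i)).1.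
apply/HY => i; under [X in eqW _ X]eq_fun do rewrite mxE.
by rewrite /eqW; case: n => [|//]; apply: aeW.
Qed.

(** The constant is uniform in the coefficients, which will vary with mu. *)
Lemma diff_op_bound : exists2 C : R, 0 <= C & forall A f y, (forall j, VM (A j)) -> V n f ->
  V (n + r) y -> diff_eq a b n A f y -> N n f <= C * (1 + \sum_j N n (A j)) * N (n + r) y.
Proof.
have [C C0 HC] := lower_order_W; exists (m%:R * (1 + C)); first by rewrite mulr_ge0// addr_ge0.
move=> A f y VA Vf Vy; have [Y [WY HY]] := diff_repr Vy => /HY fE.
have N0 := mxN_ge0 a b p (n + r) y.
have H1 i := HC A Y _ VA (fun i s h => WY i s (ltnW h)) N0 i.
have H2 i : in_W n (Y i r) /\ Wn n (Y i r) <= N (n + r) y.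
  by have := WY i r (leqnn r); rewrite subnn addn0.
have S0 : 0 <= \sum_j N n (A j) by apply: sumr_ge0 => j _; exact: mxN_ge0.
rewrite /(N n f) /mxN; apply: (@le_trans _ _ (\sum_(i < m) (1 + C * (\sum_j N n (A j))) * N (n + r) y)).
  apply: ler_sum => i _; rewrite big_ord1.
  have [W3 N3] := WD hab hp (H2 i).1 (H1 i).1; rewrite -(eqW_Wn W3 (Vf i 0) (fE i)).
  by apply: le_trans N3 _; rewrite mulrDl mul1r; apply: lerD; [case: (H2 i)|case: (H1 i)].
rewrite sumr_const card_ord -[_ *+ m]mulr_natl -!mulrA ler_wpM2l// mulrA ler_wpM2r//.
rewrite mulrDr mulr1 mulrDl mul1r; clear -C0 S0; lra.
Qed.

(** The r-th derivative cancels, so the difference is the lower-order part with coefficients A -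
    A'. *)
Lemma diff_op_diff : exists2 C : R, 0 <= C & forall A A' f f' y,
  (forall j, VM (A j)) -> (forall j, VM (A' j)) -> V n f -> V n f' ->
  V (n + r) y -> diff_eq a b n A f y -> diff_eq a b n A' f' y ->
  N n (f - f') <= C * (\sum_j N n (A j - A' j)) * N (n + r) y.
Proof.
have [C C0 HC] := lower_order_W; exists (m%:R * C); first by rewrite mulr_ge0.
move=> A A' f f' y VA VA' Vf Vf' Vy; have [Y [WY HY]] := diff_repr Vy => /HY fE /HY fE'.
have N0 := mxN_ge0 a b p (n + r) y.
have VB j : VM (A j - A' j) := (mxB hab hp (VA j) (VA' j)).1.
have H1 i := HC (fun j => A j - A' j) Y _ VB (fun i s h => WY i s (ltnW h)) N0 i.
have Vff := (mxB hab hp Vf Vf').1.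
have E i t : Y i r t + lower_order A Y i t = f t i 0 -> Y i r t + lower_order A' Y i t = f' t i 0 ->
    lower_order (fun j => A j - A' j) Y i t = (f - f') t i 0.
  move=> h1 h2; rewrite !mxE -h1 -h2 opprD addrACA subrr add0r /lower_order -sumrB.
  by apply: eq_bigr => e _; rewrite !mxE mulrBl.
have H2 i : eqW (lower_order (fun j => A j - A' j) Y i) (fun t => (f - f') t i 0).
  move: (fE i) (fE' i); rewrite /eqW; case: n => [h h'|k h h' t tab]; last by apply: E; [exact: h|exact: h'].
  by apply: leb_aeS (leb_aeI h h') => t [h1 h2] tab; apply: E; [exact: h1|exact: h2].
apply: (@le_trans _ _ (\sum_(i < m) C * (\sum_j N n (A j - A' j)) * N (n + r) y)).
  apply: ler_sum => i _; rewrite big_ord1 -(eqW_Wn (H1 i).1 (Vff i 0) (H2 i)).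
  by case: (H1 i).
by rewrite sumr_const card_ord -[_ *+ m]mulr_natl -!mulrA.
Qed.

Lemma diff_eq_lin A x f g y z : V (n + r) y -> V (n + r) z ->
  diff_eq a b n A f y -> diff_eq a b n A g z -> diff_eq a b n A (x *: f + g) (x *: y + z).
Proof.
move=> Vy Vz /diff_eqP Hf /diff_eqP Hg; apply/diff_eqP => i.
have E l : (fun u => (x *: y + z) u l 0) = fun u => x * y u l 0 + z u l 0.
  by apply/funext => u; rewrite !mxE.
have L l := W_lin hab hp x (Vy l 0) (Vz l 0).
have D t : t \in `]a, b[ ->
    cderiv r (fun u => x * y u i 0 + z u i 0) t = x * cderiv r (fun u => y u i 0) t + cderiv r (fun u => z u i 0) t ->
    diff_op A y t i 0 = f t i 0 -> diff_op A z t i 0 = g t i 0 ->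
    diff_op A (x *: y + z) t i 0 = (x *: f + g) t i 0.
  move=> tab h h1 h2; have -> : (x *: f + g) t i 0 = x * f t i 0 + g t i 0 by rewrite !mxE.
  rewrite -h1 -h2 !diff_opE E h mulrDr mulr_sumr [RHS]addrACA; congr (_ + _); rewrite -big_split/=; apply: eq_bigr => e _.
  have [_ _ Le _] := L e.2; rewrite E Le//; first by ring.
  by rewrite (leq_trans (ltn_ord e.1))// leq_addl.
have [_ _ L1 L2] := L i; move: (Hf i) (Hg i) L1 L2; rewrite /eqW; case: n => [hf hg L1 L2|k hf hg L1 _ t tab].
  apply: leb_aeS (leb_aeI L2 (leb_aeI hf hg)) => t [h1 [h2 h3]] tab; apply: D => //.
  - exact: h1.
  - exact: h2.
  - exact: h3.
apply: D => //; [|exact: hf|exact: hg].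
by apply: L1 => //; rewrite addSn ltnS leq_addl.
Qed.

End differential_operator.

Section boundary_value_problem.
Context {R : realType} (a b : R) (p : \bar R).
Hypothesis hab : a < b.
Hypothesis hp : (1 <= p)%E.
Notation nc := (@ComplexField.Normc.normc R).
Context (n m r : nat) (hr : (0 < r)%N).
Local Notation V k := (@mx_in_W R m 1 a b k p).
Local Notation VM := (@mx_in_W R m m a b n p).
Local Notation N := (mxN a b p).
Variables (A : 'I_r -> R -> 'M[R[i]]_m) (B : (R -> 'cV[R[i]]_m) -> 'cV[R[i]]_(r * m)).
Hypothesis VA : forall j, VM (A j).
Hypothesis hB : continuous_linear_on_W a b (n + r) p B.
Local Notation sol := (bvp_solution a b n p A B).

Lemma bvp_lin x f c y g d z : sol f c y -> sol g d z -> sol (x *: f + g) (x *: c + d) (x *: y + z).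
Proof.
move=> [Vy Ly By] [Vz Lz Bz]; split; first exact: (mx_lin hab hp x Vy Vz).1.
  exact: (diff_eq_lin hab hp).
by rewrite (op_lin hB)// By Bz.
Qed.

Lemma bvp0 : sol 0 0 0.
Proof.
have [V0 _] := mx0 hab hp m 1 (n + r); split=> //; last exact: (op0 hab hp hB).
have [f Vf Lf] := diff_op_exists hab hp VA V0.
have := diff_eq_lin hab hp (-1) V0 V0 Lf Lf.
by rewrite scaleN1r addNr scaler0 add0r.
Qed.

Lemma bvp_sum (J : Type) (s : seq J) (x : J -> R[i]) F c Y : (forall e, sol (F e) (c e) (Y e)) ->
  sol (\sum_(e <- s) x e *: F e) (\sum_(e <- s) x e *: c e) (\sum_(e <- s) x e *: Y e).
Proof.
move=> H; elim: s => [|e s IH]; first by rewrite !big_nil; exact: bvp0.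
by rewrite !big_cons; exact: bvp_lin.
Qed.

Hypothesis inj : forall y, sol (fun=> 0) 0 y -> forall t, t \in `[a, b] -> y t = 0.

Lemma bvp_unique f c y z : sol f c y -> sol f c z -> forall t, t \in `[a, b] -> y t = z t.
Proof.
move=> sy sz t tab; have := bvp_lin (-1) sy sz; rewrite !scaleN1r !addNr.
by move=> /inj/(_ t tab)/eqP; rewrite !fctE addrC subr_eq0 => /eqP.
Qed.

(** The boundary values of the r m fundamental solutions form a square matrix. A vector in its
    kernel gives a solution of the homogeneous problem, hence is 0 by injectivity and independence.
    The inverse matrix then corrects the boundary values of any solution of the equation. *)
Lemma bvp_solvable : exists2 C : R, 0 <= C & forall f c, V n f ->
  exists2 y, sol f c y & N (n + r) y <= C * (N n f + cv_norm c).
Proof.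
have [Z [C [C0 HZ indep HC]]] := fundamental_solutions hab hp hr VA.
have [K K0 HK] := op_bounded hab hp hB.
(* Fundamental solutions are indexed by pairs, boundary values by ['I_(r * m)]; [g] identifies the
   two index sets. *)
have [g h1 h2] := @curry_mxvec_bij r m.
pose M := \matrix_(k, i) B (Z (g k)) i 0.
have sumE (F : 'I_r * 'I_m -> 'cV[R[i]]_(r * m)) : \sum_e F e = \sum_k F (g k).
  by rewrite (reindex g)//; exists (uncurry (@mxvec_index r m)) => e _; [exact: h2|exact: h1].
have ME (v : 'rV_(r * m)) : (v *m M)^T = \sum_e v 0 (uncurry (@mxvec_index r m) e) *: B (Z e).
  rewrite sumE; apply/matrixP => i j; rewrite (ord1 j) mxE mxE summxE.
  by apply: eq_bigr => k _; rewrite !mxE h2.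
have sumZ (c : 'I_r * 'I_m -> R[i]) : sol 0 (\sum_e c e *: B (Z e)) (\sum_e c e *: Z e).
  have SZ e : sol 0 (B (Z e)) (Z e) by have [VZ LZ] := HZ e; split.
  have := bvp_sum (index_enum _) c SZ.
  by rewrite [X in sol X]big1// => e _; rewrite scaler0.
have Mu : M \in unitmx.
  rewrite -row_free_unit; apply: inj_row_free => v vM.
  pose c e := v 0 (uncurry (@mxvec_index r m) e).
  have c0 e : c e = 0.
    apply: indep => t tab; have := sumZ c; rewrite -ME vM trmx0 => /inj/(_ t tab).
    by rewrite fct_sumE.
  by apply/rowP => k; have := c0 (g k); rewrite /c h2// => ->; rewrite mxE.
pose D := \sum_i \sum_k nc (invmx M i k).
have D0 : 0 <= D by apply: sumr_ge0 => i _; apply: sumr_ge0 => k _; exact: nc_ge0.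
pose NZ := \sum_e N (n + r) (Z e).
have NZ0 : 0 <= NZ by apply: sumr_ge0 => e _; exact: mxN_ge0.
(* [C] bounds the particular solution [s]. The correction has coefficients at most [D] times the
   norm of [d - B s], where [B s] costs [K * C], and [NZ] adds up the norms of the fundamental
   solutions. *)
exists (C + D * NZ * (1 + K * C)).
  by rewrite addr_ge0// !mulr_ge0// addr_ge0// mulr_ge0.
move=> f d Vf; have [s [Vs Ls Ns _]] := HC f Vf.
pose v := (d - B s)^T *m invmx M.
pose c e := v 0 (uncurry (@mxvec_index r m) e).
have S := bvp_lin 1 (sumZ c) (And3 Vs Ls erefl).
exists (1 *: (\sum_e c e *: Z e) + s).
  by move: S; rewrite scaler0 add0r -ME mulmxKV// trmxK scale1r subrK.
have cD e : nc (c e) <= cv_norm (d - B s) * D.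
  rewrite /c /v mxE; apply: le_trans (nc_sum _ _ _) _; rewrite /cv_norm mulr_suml.
  apply: ler_sum => i _; rewrite ncM mxE ler_wpM2l ?nc_ge0//.
  rewrite /D (bigD1 i)//= (bigD1 (uncurry (@mxvec_index r m) e))//= -addrA lerDl addr_ge0//.
    by apply: sumr_ge0 => *; exact: nc_ge0.
  by apply: sumr_ge0 => *; apply: sumr_ge0 => *; exact: nc_ge0.
have [VZ1 NZ1] := mx_sum hab hp (index_enum _) c (fun e => (HZ e).1).
have [_ NS] := mx_lin hab hp 1 VZ1 Vs; apply: le_trans NS _; rewrite nc1 mul1r.
have Bs : cv_norm (d - B s) <= cv_norm d + K * C * N n f.
  apply: le_trans (cv_normB _ _) _; rewrite lerD2l; apply: le_trans (HK _ Vs) _.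
  by rewrite -mulrA ler_wpM2l.
have NZ2 : N (n + r) (\sum_e c e *: Z e) <= cv_norm (d - B s) * D * NZ.
  apply: le_trans NZ1 _; rewrite /NZ mulr_sumr; apply: ler_sum => e _.
  by rewrite ler_wpM2r ?mxN_ge0.
apply: le_trans (lerD NZ2 Ns) _.
have f0 := mxN_ge0 a b p n f; have d0 := cv_norm_ge0 d.
apply: (@le_trans _ _ ((cv_norm d + K * C * N n f) * (D * NZ) + C * N n f)).
  by rewrite lerD2r -mulrA ler_wpM2r// mulr_ge0.
have X0 : 0 <= D * NZ by exact: mulr_ge0.
rewrite -subr_ge0; have -> : (C + D * NZ * (1 + K * C)) * (N n f + cv_norm d) -
   ((cv_norm d + K * C * N n f) * (D * NZ) + C * N n f) =
   C * cv_norm d + D * NZ * (N n f + K * C * cv_norm d) by ring.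
by rewrite addr_ge0 ?mulr_ge0// addr_ge0// !mulr_ge0.
Qed.

End boundary_value_problem.

(** * Uniform boundedness of pointwise bounded operators *)

Section uniform_boundedness.
Context {R : realType} (a b : R) (p : \bar R) (k m d : nat).
Hypothesis hab : a < b.
Hypothesis hp : (1 <= p)%E.
Notation nc := (@ComplexField.Normc.normc R).
Local Notation V := (@mx_in_W R m 1 a b k p).
Local Notation N := (@mxN R a b p m 1 k).
Implicit Types (B : (R -> 'cV[R[i]]_m) -> 'cV[R[i]]_d) (x y : R -> 'cV[R[i]]_m).

Lemma operator_norm B : continuous_linear_on_W a b k p B -> exists2 c : R, 0 <= c &
  (forall y, V y -> cv_norm (B y) <= c * N y) /\
  (forall s, s < c -> exists y, [/\ V y, N y <= 1 & s < cv_norm (B y)]).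
Proof.
move=> hB; have [K K0 HK] := op_bounded hab hp hB; have [V0 N0] := mx0 hab hp m 1 k.
pose S := [set s | exists y, [/\ V y, N y <= 1 & s = cv_norm (B y)]].
have S0 : S 0 by exists 0; rewrite N0 (op0 hab hp hB) cv_norm0; split.
have Sub : has_ubound S.
  exists K => _ [y [Vy Ny ->]]; apply: le_trans (HK y Vy) _.
  by rewrite -[leRHS]mulr1 ler_wpM2l.
exists (sup S); first exact: ub_le_sup.
split=> [y Vy|s sS].
  (* [N] is only a seminorm on total functions; where it vanishes no normalization is possible, but
     [B] vanishes too by [op_bounded]. *)
  have [Ny|Ny] := leP (N y) 0.
    have Ny0 : N y = 0 by apply/eqP; rewrite eq_le Ny mxN_ge0.
    by have := HK y Vy; rewrite Ny0 !mulr0.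
  have [Vz Nz] := mx_lin hab hp ((N y)^-1)%:C%C Vy V0.
  have sE : nc ((N y)^-1)%:C%C = (N y)^-1 by rewrite nc_real ger0_norm// invr_ge0 ltW.
  rewrite -ler_pdivrMr// mulrC; apply: ub_le_sup => //.
  exists (((N y)^-1)%:C%C *: y + 0); split=> //.
    by apply: le_trans Nz _; rewrite N0 addr0 sE mulVf// gt_eqF.
  by rewrite (op_lin hB _ Vy V0) (op0 hab hp hB) addr0 cv_normZ sE.
have [|_ [y [Vy Ny ->]] h] := sup_gt _ sS; first by exists 0.
by exists y.
Qed.

(** The images of c y + x and - c y + x differ by 2 c B y, so one of them has at least half of that
    norm. *)
Lemma op_sign B x y (c : R) : continuous_linear_on_W a b k p B -> V x -> V y -> 0 <= c ->
  exists e : R, `|e| = c /\ c * cv_norm (B y) <= cv_norm (B (e%:C%C *: y + x)).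
Proof.
move=> hB Vx Vy c0; set u := B x; set v := B y.
have BE (e : R) : B (e%:C%C *: y + x) = e%:C%C *: v + u by exact: (op_lin hB _ Vy Vx).
have [h|h] := leP (c * cv_norm v) (cv_norm (c%:C%C *: v + u)).
  by exists c; rewrite ger0_norm// BE.
exists (- c); rewrite normrN ger0_norm// BE; split=> //.
have := cv_normB (c%:C%C *: v + u) ((- c)%:C%C *: v + u).
rewrite opprD addrACA subrr addr0 -scalerBl -rmorphB opprK.
rewrite cv_normZ nc_real ger0_norm ?addr_ge0// mulrDl => h'.
by rewrite -(lerD2l (c * cv_norm v)); apply: le_trans h' _; rewrite lerD2r ltW.
Qed.

(* The gliding hump: x is a series of multiples of nearly norming vectors with geometric
   weights, and the signs are chosen so that the partial sums do not cancel. *)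
Lemma gliding_hump (B : nat -> (R -> 'cV[R[i]]_m) -> 'cV[R[i]]_d) : (0 < m)%N ->
  (forall j, continuous_linear_on_W a b k p (B j)) ->
  (forall j, exists2 y, V y & 4 * j.+1%:R * (m.*2.+1)%:R ^+ j * N y < cv_norm (B j y)) ->
  exists2 x, V x & forall j, j.+1%:R <= cv_norm (B j x).
Proof.
(* A near-norming vector keeps 3/4 of the operator norm and the tail of the series takes away at
   most 1/2; the remaining 1/4 accounts for the 4 in the growth assumption. *)
have gap (u w z : R) : 4 * u < w -> 3 / 4 * w <= z + w / 2 -> u <= z by lra.
(* With Q = 2 m + 1 one has 1 - q = 2 m / Q. The error bound of [mx_complete], which carries a
   factor m from the entries, then makes the tail after step j at most [q ^+ j / 2]. *)
move=> m0 hB hump; pose Q : R := (m.*2.+1)%:R; pose q := Q^-1.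
have Q0 : 0 < Q by rewrite ltr0n.
have Q1 : 1 < Q by rewrite ltr1n ltnS double_gt0.
have q0 : 0 < q by rewrite invr_gt0.
have q1 : q < 1 by rewrite invf_lt1.
have H j : exists c y, [/\ forall z, V z -> cv_norm (B j z) <= c * N z, V y, N y <= 1,
    3 / 4 * c < cv_norm (B j y) & 4 * j.+1%:R * Q ^+ j < c].
  have [c c0 [Hc Hs]] := operator_norm (hB j); have [y Vy hy] := hump j.
  have cQ : 4 * j.+1%:R * Q ^+ j < c.
    rewrite ltNge; apply/negP => h; have := lt_le_trans hy (Hc y Vy).
    by rewrite ltNge => /negP; apply; rewrite ler_wpM2r ?mxN_ge0.
  have cp : 0 < c by apply: le_lt_trans cQ; rewrite mulr_ge0 ?exprn_ge0 ?mulr_ge0// ltW.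
  have [|z [Vz Nz hz]] := Hs (3 / 4 * c); first by rewrite gtr_pMl// ltr_pdivrMr// mul1r ltr_nat.
  by exists c, z.
have [c Hc'] := choice H; have [y_ Hy] := choice Hc'.
have S jx : exists x', V jx.2 -> [/\ V x', N (x' - jx.2) <= q ^+ jx.1 &
    q ^+ jx.1 * cv_norm (B jx.1 (y_ jx.1)) <= cv_norm (B jx.1 x')].
  case: jx => j x /=; have [Vx|nVx] := pselect (V x); last by exists 0.
  have [_ Vy Ny _ _] := Hy j.
  have qj : 0 <= q ^+ j by rewrite exprn_ge0// ltW.
  have [e [e1 e2]] := op_sign (hB j) Vx Vy qj.
  have [Vx' _] := mx_lin hab hp e%:C%C Vy Vx.
  exists (e%:C%C *: y_ j + x) => _; split=> //; rewrite addrK.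
  have [V0 N0] := mx0 hab hp m 1 k.
  have := (mx_lin hab hp e%:C%C Vy V0).2; rewrite addr0 N0 addr0 nc_real e1 => h.
  by apply: le_trans h _; rewrite -[leRHS]mulr1 ler_wpM2l.
have [nx Hnx] := choice S.
pose x_ := nat_rect (fun=> R -> 'cV[R[i]]_m) 0 (fun j x => nx (j, x)).
have Vx_ j : V (x_ j).
  elim: j => [|j IH]; first exact: (mx0 hab hp m 1 k).1.
  by have [] := Hnx (j, x_ j) IH.
have [|x Vx Hx] := @mx_complete R a b p hab hp k m 1 x_ 1 q q0 q1 Vx_.
  by move=> j; rewrite mul1r; have [] := Hnx (j, x_ j) (Vx_ j).
exists x => // j; have [_ _ Bx] := Hnx (j, x_ j) (Vx_ j).
have [Hn Vy _ By cQ] := Hy j.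
have qj : 0 < q ^+ j by rewrite exprn_gt0.
have mr : 0 < m%:R :> R by rewrite ltr0n.
have QE : Q = 1 + m%:R * 2 by rewrite /Q -addn1 natrD addrC -muln2 natrM.
have N2 : N (x - x_ j.+1) <= q ^+ j / 2.
  apply: le_trans (Hx j.+1) _; rewrite muln1 div1r exprS.
  have -> : 1 - q = m%:R * 2 / Q.
    apply: (mulIf (lt0r_neq0 Q0)); rewrite mulrBl mul1r mulVf ?gt_eqF// divfK ?gt_eqF// QE.
    by rewrite addrAC subrr add0r.
  rewrite invf_div.
  have -> : m%:R * (Q / (m%:R * 2) * (q * q ^+ j)) = (m%:R / m%:R) * (Q * q) * (q ^+ j / 2).
    by rewrite invfM; ring.
  by rewrite divff ?gt_eqF// mul1r /q divff ?gt_eqF// mul1r.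
have B2 : cv_norm (B j (x_ j.+1)) <= cv_norm (B j x) + c j * (q ^+ j / 2).
  have -> : B j (x_ j.+1) = B j x - B j (x - x_ j.+1).
    by rewrite (opB (hB j) Vx (Vx_ j.+1)) opprB addrCA subrr addr0.
  apply: le_trans (cv_normB _ _) _; rewrite lerD2l.
  apply: le_trans (Hn _ (mxB hab hp Vx (Vx_ j.+1)).1) _.
  rewrite ler_wpM2l//; apply: ltW; apply: le_lt_trans cQ.
  by rewrite mulr_ge0 ?exprn_ge0 ?mulr_ge0// ltW.
have cq : 4 * j.+1%:R < c j * q ^+ j.
  by rewrite /q exprVn ltr_pdivlMr ?exprn_gt0.
have B3 : q ^+ j * (3 / 4 * c j) <= cv_norm (B j (x_ j.+1)).
  apply: le_trans Bx; rewrite ler_pM2l//; exact: ltW.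
have := le_trans B3 B2.
have -> : q ^+ j * (3 / 4 * c j) = 3 / 4 * (c j * q ^+ j) by ring.
rewrite [c j * (_ / 2)]mulrA; exact: gap.
Qed.

End uniform_boundedness.

(** * Continuity in the parameter *)

Section vanishing_functions.
Context {R : realType} (a b : R) (p : \bar R).
Hypothesis hab : a < b.
Hypothesis hp : (1 <= p)%E.
Context {M : metricType R} (mu0 : M).
Implicit Types g h : M -> R.

(** One-sided, but applied to nonnegative functions only, for which it is convergence to 0. *)
Definition tend0 g : Prop := forall e : R, 0 < e -> \forall mu \near mu0, g mu < e.

Lemma tend0_le g h : (\forall mu \near mu0, g mu <= h mu) -> tend0 h -> tend0 g.
Proof.
by move=> gh h0 e e0; apply: filterS2 gh (h0 e e0) => mu; exact: le_lt_trans.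
Qed.

Lemma tend0D g h : tend0 g -> tend0 h -> tend0 (fun mu => g mu + h mu).
Proof.
move=> g0 h0 e e0; have e2 : 0 < e / 2 by rewrite divr_gt0.
by apply: filterS2 (g0 _ e2) (h0 _ e2) => mu h1 h2; rewrite (splitr e) ltrD.
Qed.

Lemma tend0Z (K : R) g : 0 <= K -> (forall mu, 0 <= g mu) -> tend0 g -> tend0 (fun mu => K * g mu).
Proof.
move=> K0 gp g0 e e0; have K1 : 0 < K + 1 by rewrite ltr_wpDl.
apply: filterS (g0 _ (divr_gt0 e0 K1)) => mu; rewrite ltr_pdivlMr//; apply: le_lt_trans.
by rewrite mulrDr mulr1 mulrC lerDl.
Qed.

Lemma tend0_cst0 : tend0 (fun=> 0).
Proof. by move=> e e0; apply: nearW. Qed.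

Lemma tend0_sum (J : Type) (s : seq J) (F : J -> M -> R) : (forall j, tend0 (F j)) ->
  tend0 (fun mu => \sum_(j <- s) F j mu).
Proof.
move=> F0; elim: s => [|j s IH].
  by under eq_fun do rewrite big_nil; exact: tend0_cst0.
by under eq_fun do rewrite big_cons; exact: tend0D.
Qed.

(** Near mu0 the factor [h2] is below one half, so [g] is at most twice [h1]. No prior boundedness
    of [g] is required, which matters because in both uses [g] is the very quantity to be
    controlled. *)
Lemma tend0_absorb g h1 h2 : (forall mu, 0 <= g mu) ->
  (\forall mu \near mu0, g mu <= h1 mu + g mu * h2 mu) -> tend0 h1 -> tend0 h2 -> tend0 g.
Proof.
move=> g0 gh h10 h20 e e0; have e2 : 0 < e / 2 by rewrite divr_gt0.
have half0 : 0 < 2^-1 :> R by rewrite invr_gt0.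
apply: filterS3 gh (h10 _ e2) (h20 _ half0) => mu G H1 H2.
have : g mu * h2 mu <= g mu * 2^-1 by rewrite ler_wpM2l// ltW.
clear -G H1; lra.
Qed.

Lemma W_cvgP q1 q2 k (F : M -> R -> 'M[R[i]]_(q1, q2)) :
  (\forall mu \near mu0, mx_in_W a b k p (F mu)) ->
  W_cvg a b p k F mu0 <-> tend0 (fun mu => mxN a b p k (F mu - F mu0)).
Proof.
move=> WF; have WF0 := nbhs_singleton WF; rewrite /W_cvg.
have E : \forall mu \near mu0, mx_W_norm a b k p (F mu - F mu0) = (mxN a b p k (F mu - F mu0))%:E.
  by apply: filterS WF => mu Wmu; rewrite (mx_W_normE hab hp)//; exact: (mxB hab hp Wmu WF0).1.
split=> [/fine_cvgP[_ /cvgrPdist_lt H] e e0|H].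
  apply: filterS2 E (H e e0) => mu /= -> /=; rewrite sub0r normrN; exact: le_lt_trans (ler_norm _).
apply/fine_cvgP; split; first by apply: filterS E => mu ->.
apply/cvgrPdist_lt => e e0; apply: filterS2 E (H e e0) => mu /= -> /=.
by rewrite sub0r normrN ger0_norm// mxN_ge0.
Qed.

Lemma cv_cvgP q (c : M -> 'cV[R[i]]_q) : cv_cvg c mu0 <-> tend0 (fun mu => cv_norm (c mu - c mu0)).
Proof.
split=> [/cvgrPdist_lt H e e0|H].
  by apply: filterS (H e e0) => mu; rewrite sub0r normrN; exact: le_lt_trans (ler_norm _).
by apply/cvgrPdist_lt => e e0; apply: filterS (H e e0) => mu; rewrite sub0r normrN ger0_norm ?cv_norm_ge0.
Qed.

End vanishing_functions.

(** * Recovering the coefficients from monomials *)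

Section monomials.
Context {R : realType} (a b : R) (p : \bar R).
Hypothesis hab : a < b.
Hypothesis hp : (1 <= p)%E.
Local Notation Wn := (Wn a b p).
Local Notation in_W k := (in_W a b k p).
Context (n m r : nat).
Local Notation V k := (@mx_in_W R m 1 a b k p).
Local Notation VM := (@mx_in_W R m m a b n p).
Local Notation N := (mxN a b p).

(* (t - a)^s / s! *)
Fixpoint mono (s : nat) : R -> R[i] := if s is s'.+1 then cint (mono s') a else fun=> 1.

Lemma mono_W k s : in_W k (mono s).
Proof.
elim: s k => [|s IH] k; first exact: (W_cst hab hp k 1).1.
have E t : t \in `[a, b] -> mono s.+1 t = 0 + cint (mono s) a t by rewrite add0r.
by case: k => [|k]; [exact: (W_Lp hab hp (WnS hab hp (IH 0%N) E).1)|exact: (WnS hab hp (IH k) E).1].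
Qed.

Definition mono_col (s : nat) (l : 'I_m) (t : R) : 'cV[R[i]]_m :=
  \col_i ((i == l)%:R * mono s t).

(** For s < r this is L applied to [mono_col s l]: the j-th derivative of [mono s] is [mono (s - j)]
    for j <= s and 0 beyond, in particular for j = r. It is therefore linear in the coefficients. *)
Definition mono_image (A : 'I_r -> R -> 'M[R[i]]_m) (s : nat) (l : 'I_m) (t : R) : 'cV[R[i]]_m :=
  \col_i \sum_(j < r | (j <= s)%N) A j t i l * mono (s - j) t.

Lemma mono_col_W k s l : V k (mono_col s l).
Proof.
move=> i j; under eq_fun do rewrite mxE.
exact: (WZ hab hp _ (mono_W k s)).1.
Qed.

Lemma mono_image_W A s l : (forall j, VM (A j)) -> V n (mono_image A s l).
Proof.
move=> VA i j; under eq_fun do rewrite mxE.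
have [C _ HC] := WM hab hp n.
have P j' : in_W n (fun t => (if (nat_of_ord j' <= s)%N then A j' t i l * mono (s - j') t else 0)).
  case: (nat_of_ord j' <= s)%N; last exact: (W_cst hab hp n 0).1.
  exact: (HC _ _ (VA j' i l) (mono_W _ _)).1.
have := (W_sum hab hp (index_enum _) P).1.
rewrite (_ : (fun t => _) = fun t => \sum_(j < r | (j <= s)%N) A j t i l * mono (s - j) t)//.
by apply/funext => t; rewrite [RHS]big_mkcond.
Qed.

Lemma mono_diff_eq A s l : (s < r)%N -> diff_eq a b n A (mono_image A s l) (mono_col s l).
Proof.
move=> sr.
pose Y (i : 'I_m) j : R -> R[i] := if (j <= s)%N && (i == l) then mono (s - j) else fun=> 0.
have WY i : in_W n (Y i r) by rewrite /Y leqNgt sr; exact: (W_cst hab hp n 0).1.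
have YE i j : (j < r)%N -> forall t, t \in `[a, b] ->
    Y i j t = ((j == s) && (i == l))%:R + cint (Y i j.+1) a t.
  move=> jr t; rewrite in_itv/= => /andP[at_ tb]; rewrite /Y; have [_|_] := eqVneq i l; last first.
    by rewrite !andbF cint_zero// addr0.
  rewrite !andbT; have [js|sj|->] := ltngtP j s.
  - by rewrite -(subnSK js)/= add0r.
  - by rewrite cint_zero ?addr0.
  - by rewrite subnn/= cint_zero// addr0.
have Y0 i : (fun t => mono_col s l t i 0) = Y i 0%N.
  apply/funext => t; rewrite mxE /Y subn0; have [_|_] := eqVneq i l; first by rewrite mul1r.
  by rewrite mul0r.
apply/diff_eqP => i; have [_ _ _ D2 D3] := W_chain_intro hab hp (WY i) (YE i).
have E t : t \in `]a, b[ -> cderiv r (Y i 0%N) t = Y i r t ->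
    diff_op A (mono_col s l) t i 0 = mono_image A s l t i 0.
  move=> tab h; rewrite diff_opE Y0 h {1}/Y leqNgt sr/= add0r mxE.
  rewrite -(pair_bigA _ (fun j i' => A j t i i' * cderiv j (fun u => mono_col s l u i' 0) t))/=.
  rewrite [RHS]big_mkcond/=; apply: eq_bigr => j _.
  rewrite (bigD1 l)//= big1 ?addr0 => [|i' il]; last first.
    have [_ _ D1 _ _] := W_chain_intro hab hp (WY i') (YE i').
    by rewrite Y0 D1// /Y (negPf il) andbF mulr0.
  have [_ _ D1 _ _] := W_chain_intro hab hp (WY l) (YE l).
  by rewrite Y0 D1// /Y eqxx andbT; case: ifP => // _; rewrite mulr0.
rewrite /eqW; move: D2 D3; case: n => [_ D3|k D2 _ t tab].
  by apply: leb_aeS D3 => t h tab; apply: E => //; exact: h.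
by apply: E => //; exact: D2.
Qed.

(** The system is triangular: the image for (s, l) is the l-th column of A_s, as [mono 0 = 1], plus
    products of the A_j with j < s and fixed monomials. Induction on s solves for the coefficients
    one after the other. *)
Lemma mono_recover : exists2 C : R, 0 <= C & forall A : 'I_r -> R -> 'M[R[i]]_m,
  (forall j, VM (A j)) ->
  \sum_j N n (A j) <= C * \sum_(s < r) \sum_l N n (mono_image A s l).
Proof.
have [Cm Cm0 HCm] := WM hab hp n.
pose S A := \sum_(s < r) \sum_l N n (mono_image A s l).
pose Mo := \sum_(s < r.+1) Wn (maxn n 1) (mono s).
have Mo0 : 0 <= Mo by apply: sumr_ge0 => *; exact: Wn_ge0.
have S0 A : 0 <= S A by apply: sumr_ge0 => s _; apply: sumr_ge0 => l _; exact: mxN_ge0.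
have H s : exists2 C : R, 0 <= C & forall A : 'I_r -> R -> 'M[R[i]]_m, (forall j, VM (A j)) ->
    forall (j : 'I_r) i l, (j < s)%N -> Wn n (fun t => A j t i l) <= C * S A.
  elim: s => [|s [C C0 IH]]; first by exists 0.
  exists (C + 1 + r%:R * (Cm * C * Mo)).
    by rewrite !addr_ge0// !mulr_ge0.
  move=> A VA j i l; have SC : C * S A <= (C + 1 + r%:R * (Cm * C * Mo)) * S A.
    by rewrite ler_wpM2r// -addrA lerDl addr_ge0// !mulr_ge0.
  rewrite ltnS leq_eqVlt => /predU1P[js|js]; last by apply: le_trans SC; exact: IH.
  pose F t := mono_image A s l t i 0.
  pose G (j' : 'I_r) t := if (j' < s)%N then A j' t i l * mono (s - j') t else 0.
  have WF : in_W n F := mono_image_W s l VA i 0.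
  have WG j' : in_W n (G j') /\ Wn n (G j') <= Cm * C * Mo * S A.
    rewrite /G; have [j's|j's] := boolP (j' < s)%N; last first.
      have [? ->] := W_cst hab hp n 0; split=> //; rewrite !mulr_ge0//.
    have [W1 N1] := HCm _ _ (VA j' i l) (mono_W _ (s - j')); split=> //; apply: le_trans N1 _.
    have sr : (s - j' < r.+1)%N by rewrite ltnS (leq_trans (leq_subr _ _))// -js ltnW.
    have Mo1 : Wn (maxn n 1) (mono (s - j')) <= Mo.
      rewrite /Mo (bigD1 (Ordinal sr))//= lerDl; apply: sumr_ge0 => *; exact: Wn_ge0.
    have -> : Cm * C * Mo * S A = Cm * ((C * S A) * Mo) by ring.
    by rewrite ler_wpM2l//; apply: ler_pM; rewrite ?Wn_ge0//; exact: IH.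
  have [WG' NG] := W_sum hab hp (index_enum _) (fun j' => (WG j').1).
  have -> : (fun t => A j t i l) = (fun t => F t - \sum_j' G j' t).
    apply/funext => t; rewrite /F mxE (bigD1 j)/=; last by rewrite js.
    rewrite js subnn mulr1 -[LHS]addr0 -addrA; congr (_ + _).
    rewrite /G -big_mkcond/= (eq_bigl (fun j' : 'I_r => (j' < s)%N)) ?subrr// => j'.
    rewrite ltn_neqAle -js andbC; congr (_ && _); by rewrite -val_eqE.
  have [_ N2] := WB hab hp WF WG'; apply: le_trans N2 _.
  rewrite mulrDl mulrDl mul1r -addrA; apply: (@le_trans _ _ (S A + r%:R * (Cm * C * Mo) * S A)); last first.
    by rewrite lerDr mulr_ge0.
  apply: lerD.
    have sr : (s < r)%N by rewrite -js.
    apply: le_trans (mxN_entry a b p n (mono_image A s l) i 0) _.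
    rewrite /S (bigD1 (Ordinal sr))//= (bigD1 l)//= -addrA lerDl addr_ge0//.
      by apply: sumr_ge0 => *; exact: mxN_ge0.
    by apply: sumr_ge0 => *; apply: sumr_ge0 => *; exact: mxN_ge0.
  apply: le_trans NG _; apply: (@le_trans _ _ (\sum_(j' < r) Cm * C * Mo * S A)).
    by apply: ler_sum => j' _; case: (WG j').
  by rewrite sumr_const card_ord -[_ *+ r]mulr_natl !mulrA.
have [C C0 HC] := H r; exists (r%:R * (m%:R * (m%:R * C))); first by rewrite !mulr_ge0.
move=> A VA; apply: (@le_trans _ _ (\sum_(j < r) \sum_(i < m) \sum_(l < m) C * S A)).
  by apply: ler_sum => j _; apply: ler_sum => i _; apply: ler_sum => l _; exact: HC.
set X := C * S A; rewrite !sumr_const !card_ord -!mulrA -/X.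
by rewrite -[_ *+ m *+ m *+ r]mulr_natl -[_ *+ m *+ m]mulr_natl -[X *+ m]mulr_natl.
Qed.

End monomials.

(** * From continuous dependence to the limit conditions *)

Section necessity.
Context {R : realType} (a b : R) (p : \bar R).
Hypothesis hab : a < b.
Hypothesis hp : (1 <= p)%E.
Context (n m r : nat) (hr : (0 < r)%N) (M : metricType R).
Variables (A : 'I_r -> M -> R -> 'M[R[i]]_m) (mu0 : M).
Variable B : M -> (R -> 'cV[R[i]]_m) -> 'cV[R[i]]_(r * m).
Local Notation V k := (@mx_in_W R m 1 a b k p).
Local Notation N := (mxN a b p).
Local Notation sol mu := (bvp_solution a b n p (fun j => A j mu) (B mu)).
Local Notation tend0 := (tend0 mu0).
Hypothesis hA : forall j mu, mx_in_W a b n p (A j mu).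
Hypothesis hB : forall mu, continuous_linear_on_W a b (n + r) p (B mu).

Lemma mxN_triangle q1 q2 k (F G : R -> 'M[R[i]]_(q1, q2)) :
  mx_in_W a b k p F -> mx_in_W a b k p G -> N k F <= N k (F - G) + N k G.
Proof.
move=> WF WG; have := (mx_lin hab hp 1 (mxB hab hp WF WG).1 WG).2.
by rewrite scale1r subrK nc1 mul1r.
Qed.

Lemma mxN_eqB k (y z : R -> 'cV[R[i]]_m) : (forall t, t \in `[a, b] -> y t = z t) -> N k (y - z) = 0.
Proof.
move=> yz; have [V0 N0] := mx0 hab hp m 1 k.
have [|_ ->] := mx_congr hab hp (_ : forall t, t \in `[a, b] -> (0 : R -> 'cV[R[i]]_m) t = (y - z) t) V0.
  by move=> t tab; rewrite /= !fctE yz// subrr.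
exact: N0.
Qed.

Lemma column_delta (d : 'cV[R[i]]_(r * m)) : d = \sum_i d i 0 *: delta_mx i 0.
Proof.
apply/matrixP => i j; rewrite (ord1 j) summxE (bigD1 i)//= !mxE !eqxx mulr1 big1 ?addr0// => k ki.
by rewrite !mxE eq_sym (negPf ki) mulr0.
Qed.

Lemma coeff_norm_le mu : \sum_j N n (A j mu) <=
  \sum_j N n (A j mu - A j mu0) + \sum_j N n (A j mu0).
Proof. by rewrite -big_split/=; apply: ler_sum => j _; exact: mxN_triangle. Qed.

Hypothesis hsol : solution_continuous_at a b n p A B mu0.

Lemma limit_problem_unique y : sol mu0 (fun=> 0) 0 y -> forall t, t \in `[a, b] -> y t = 0.
Proof.
have [eps [e0 H _]] := hsol; have [V0 _] := mx0 hab hp m 1 n.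
have [_ U] := H mu0 (ballxx _ e0) 0 0 V0.
by move=> sy t tab; have := U _ _ sy (bvp0 hab hp (hA ^~ mu0) (hB mu0)) t tab.
Qed.

Lemma near_unique : \forall mu \near mu0, forall f c y z, V n f -> sol mu f c y -> sol mu f c z ->
  forall t, t \in `[a, b] -> y t = z t.
Proof.
have [eps [e0 H _]] := hsol; apply: filterS (nbhsx_ballx mu0 eps e0) => mu mub f c y z Vf sy sz.
by have [_ U] := H mu mub f c Vf; exact: U.
Qed.

(** The convergence of solutions enters the proof only through this lemma. Outside the ball of
    unique solvability [y] is arbitrary. *)
Lemma near_solve f c : (forall mu, V n (f mu)) -> tend0 (fun mu => N n (f mu - f mu0)) ->
  tend0 (fun mu => cv_norm (c mu - c mu0)) -> exists y,
  (\forall mu \near mu0, sol mu (f mu) (c mu) (y mu)) /\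
  tend0 (fun mu => N (n + r) (y mu - y mu0)).
Proof.
move=> Vf f0 c0; have [eps [e0 H HC]] := hsol.
have H1 mu : exists y, ball mu0 eps mu -> sol mu (f mu) (c mu) y.
  have [mub|nmub] := pselect (ball mu0 eps mu); last by exists 0.
  by have [[y sy] _] := H mu mub (f mu) (c mu) (Vf mu); exists y.
have [y Hy] := choice H1.
have Hy' : \forall mu \near mu0, sol mu (f mu) (c mu) (y mu).
  by apply: filterS (nbhsx_ballx mu0 eps e0) => mu; exact: Hy.
exists y; split=> //.
have Vy : \forall mu \near mu0, V (n + r) (y mu) by apply: filterS Hy' => mu [].
apply/(W_cvgP hab hp Vy); apply: (HC f c) => //.
  by apply/(W_cvgP hab hp); [exact: nearW|].
exact/cv_cvgP.
Qed.

(** The chosen [y mu0] agrees with the given [z] on [[a, b]] only, so the distance of [z] to [y mu]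
    is stated separately. *)
Lemma near_solve_cst f c z : V n f -> sol mu0 f c z -> exists y : M -> R -> 'cV[R[i]]_m,
  [/\ \forall mu \near mu0, sol mu f c (y mu), tend0 (fun mu => N (n + r) (y mu - y mu0)),
   forall t, t \in `[a, b] -> y mu0 t = z t &
   \forall mu \near mu0, N (n + r) (z - y mu) <= N (n + r) (y mu - y mu0)].
Proof.
move=> Vf sz; have [V0 N0] := mx0 hab hp m 1 n.
have [||y [Hy y0]] := @near_solve (fun=> f) (fun=> c) (fun=> Vf).
- by under eq_fun do rewrite subrr N0; exact: tend0_cst0.
- by under eq_fun do rewrite subrr cv_norm0; exact: tend0_cst0.
exists y; have sy0 := nbhs_singleton Hy.
have yz := bvp_unique hab hp (hB mu0) limit_problem_unique sy0 sz.
split=> //; have [Vz _ _] := sz; have [Vy0 _ _] := sy0.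
apply: filterS Hy => mu [Vy _ _].
have h := mxN_dist hab hp Vz Vy0 Vy; apply: le_trans h _.
rewrite mxN_eqB ?add0r; last by move=> t tab; rewrite yz.
by rewrite (mxNN hab hp Vy0 Vy).
Qed.

Lemma coefficients_converge : tend0 (fun mu => \sum_j N n (A j mu - A j mu0)).
Proof.
have [C1 C10 HC1] := diff_op_bound hab hp n m r.
have [C2 C20 HC2] := mono_recover hab hp n m r.
pose S mu := \sum_j N n (A j mu - A j mu0); pose S0 := \sum_j N n (A j mu0).
have Sp mu : 0 <= S mu by apply: sumr_ge0 => *; exact: mxN_ge0.
have S0p : 0 <= S0 by apply: sumr_ge0 => *; exact: mxN_ge0.
have H (sl : 'I_r * 'I_m) : exists eta : M -> R, [/\ forall mu, 0 <= eta mu, tend0 eta &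
   \forall mu \near mu0, N n (mono_image a (fun j => A j mu - A j mu0) sl.1 sl.2) <=
      C1 * (1 + S0 + S mu) * eta mu].
  case: sl => s l /=; pose z := mono_col a s l; pose f mu := mono_image a (fun j => A j mu) s l.
  have Vz : V (n + r) z := mono_col_W hab hp _ _ _.
  have Vf mu : V n (f mu) := mono_image_W hab hp s l (hA ^~ mu).
  have Lz mu : diff_eq a b n (fun j => A j mu) (f mu) z := mono_diff_eq hab hp n _ l (ltn_ord s).
  have sz : sol mu0 (f mu0) (B mu0 z) z by split.
  have [y [Hy y0 _ Hz]] := near_solve_cst (Vf mu0) sz.
  exists (fun mu => N (n + r) (y mu - y mu0)); split=> //; first by move=> mu; exact: mxN_ge0.
  apply: filterS2 Hy Hz => mu [Vy Ly _] hz.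
  have := diff_eq_lin hab hp (-1) Vy Vz Ly (Lz mu).
  rewrite !scaleN1r [- y mu + z]addrC [- f mu0 + _]addrC => Lw.
  have := HC1 _ _ _ (hA ^~ mu) (mxB hab hp (Vf mu) (Vf mu0)).1 (mxB hab hp Vz Vy).1 Lw.
  (* The term of order r vanishes on these monomials, so the right-hand side of the equation for z -
     y(mu) involves differences of coefficients only. *)
  have -> : f mu - f mu0 = mono_image a (fun j => A j mu - A j mu0) s l.
    apply/funext => t; apply/matrixP => i j; rewrite !mxE -sumrB.
    by apply: eq_bigr => k _; rewrite !mxE mulrBl.
  move=> h; apply: le_trans h _; apply: ler_pM => //.
  - by rewrite mulr_ge0// addr_ge0// sumr_ge0// => j _; exact: mxN_ge0.
  - exact: mxN_ge0.
  - by rewrite ler_wpM2l// -addrA lerD2l [leRHS]addrC; exact: coeff_norm_le.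
have [eta Heta] := choice H.
pose E mu := \sum_sl eta sl mu.
have Ep mu : 0 <= E mu by apply: sumr_ge0 => sl _; have [] := Heta sl.
have E0 : tend0 E by apply: tend0_sum => sl; have [] := Heta sl.
(* The bound contains [S mu] itself, because the norm of L(mu) depends on the coefficients at mu; it
   is multiplied by the vanishing [E mu]. *)
apply: (@tend0_absorb _ _ mu0 S (fun mu => C2 * C1 * (1 + S0) * E mu) (fun mu => C2 * C1 * E mu)) => //.
- have /filter_forall : forall sl : 'I_r * 'I_m, \forall mu \near mu0,
      N n (mono_image a (fun j => A j mu - A j mu0) sl.1 sl.2) <= C1 * (1 + S0 + S mu) * eta sl mu.
    by move=> sl; have [] := Heta sl.
  apply: filterS => mu h.
  apply: le_trans (HC2 _ (fun j => (mxB hab hp (hA j mu) (hA j mu0)).1)) _.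
  rewrite pair_bigA/=; apply: (@le_trans _ _ (C2 * \sum_sl C1 * (1 + S0 + S mu) * eta sl mu)).
    by rewrite ler_wpM2l//; apply: ler_sum => sl _; exact: h.
  by rewrite -mulr_sumr -/(E mu) le_eqVlt; apply/orP; left; apply/eqP; ring.
- by apply: tend0Z => //; rewrite !mulr_ge0// addr_ge0.
- by apply: tend0Z => //; rewrite mulr_ge0.
Qed.

(** Although w(mu) tends to 0, B(mu) w(mu) cannot be estimated directly, as no bound on B(mu) is
    known. The detour through u(mu) and the e_i(mu) expresses it by B(mu0), whose bound does not
    depend on mu. *)
Lemma boundary_converge y : V (n + r) y -> tend0 (fun mu => cv_norm (B mu y - B mu0 y)).
Proof.
move=> Vy; have [C1 C10 HC1] := diff_op_bound hab hp n m r.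
have [V0 N0] := mx0 hab hp m 1 n.
pose S mu := \sum_j N n (A j mu - A j mu0); pose S0 := \sum_j N n (A j mu0).
have S0p : 0 <= S0 by apply: sumr_ge0 => *; exact: mxN_ge0.
pose d mu := B mu y - B mu0 y.
have [f0 Vf0 Lf0] := diff_op_exists hab hp (hA ^~ mu0) Vy.
have sy : sol mu0 f0 (B mu0 y) y by split.
have [v [Hv v0 _ Hvy]] := near_solve_cst Vf0 sy.
pose eta mu := N (n + r) (v mu - v mu0); pose w mu := y - v mu.
have etap mu : 0 <= eta mu by exact: mxN_ge0.
have eta0 : eta mu0 = 0 by rewrite /eta mxN_eqB.
have Hw : \forall mu \near mu0, [/\ V (n + r) (w mu), N (n + r) (w mu) <= eta mu & B mu (w mu) = d mu].
  apply: filterS2 Hv Hvy => mu [Vv _ Bv] h; split=> //; first exact: (mxB hab hp Vy Vv).1.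
  by rewrite /w (opB (hB mu) Vy Vv) Bv.
(* [g mu] represents L(mu) w(mu); it must be defined for every mu to serve as a right-hand side,
   although w(mu) is regular only near mu0. *)
have Hg mu : exists g, V n g /\ (V (n + r) (w mu) -> diff_eq a b n (fun j => A j mu) g (w mu)).
  have [Vw|nVw] := pselect (V (n + r) (w mu)); last by exists 0.
  by have [g Vg Lg] := diff_op_exists hab hp (hA ^~ mu) Vw; exists g.
have [g Hg'] := choice Hg.
(* Convergence of the coefficients is used here: near mu0 their norms add up to at most 1 + S0. *)
have gle : \forall mu \near mu0, N n (g mu) <= C1 * (2 + S0) * eta mu.
  apply: filterS2 Hw (coefficients_converge ltr01) => mu [Vw Nw _] S1.
  have [Vg Lg] := Hg' mu; apply: le_trans (HC1 _ _ _ (hA ^~ mu) Vg Vw (Lg Vw)) _.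
  apply: ler_pM => //; last 1 first.
  - rewrite ler_wpM2l//; apply: le_trans (_ : 1 + (1 + S0) <= _); last by rewrite addrA.
    by rewrite lerD2l; apply: le_trans (coeff_norm_le mu) _; rewrite lerD2r ltW.
  - by rewrite mulr_ge0// addr_ge0// sumr_ge0// => j _; exact: mxN_ge0.
  - exact: mxN_ge0.
have Ng0 : tend0 (fun mu => N n (g mu)).
  by apply: tend0_le gle _; apply: tend0Z => //; rewrite mulr_ge0// addr_ge0.
have gmu0 : N n (g mu0) = 0.
  by apply/eqP; rewrite eq_le mxN_ge0 andbT; have := nbhs_singleton gle; rewrite eta0 mulr0.
have [||u [Hu u0]] := @near_solve g (fun=> 0) (fun mu => (Hg' mu).1).
- apply: tend0_le Ng0; apply: nearW => mu.
  by have := (mxB hab hp (Hg' mu).1 (Hg' mu0).1).2; rewrite gmu0 addr0.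
- by under eq_fun do rewrite subrr cv_norm0; exact: tend0_cst0.
have [Vw0 Nw0 Bw0] := nbhs_singleton Hw.
have su0 := nbhs_singleton Hu; have [Vu0 _ _] := su0.
have sw0 : sol mu0 (g mu0) 0 (w mu0).
  by split=> //; [exact: (Hg' mu0).2|rewrite Bw0 /d subrr].
(* [w mu0] has norm 0 and solves the same problem as [u mu0]; convergence of u(mu) to u(mu0) thus
   means convergence to 0. *)
have Nu0 : N (n + r) (u mu0) = 0.
  have [_ ->] := mx_congr hab hp (bvp_unique hab hp (hB mu0) limit_problem_unique sw0 su0) Vw0.
  by apply/eqP; rewrite eq_le mxN_ge0 andbT -eta0.
have Nu : tend0 (fun mu => N (n + r) (u mu)).
  apply: tend0_le u0; apply: filterS Hu => mu [Vu _ _].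
  by apply: le_trans (mxN_triangle Vu Vu0) _; rewrite Nu0 addr0.
have He (i : 'I_(r * m)) : exists e : M -> R -> 'cV[R[i]]_m,
    (\forall mu \near mu0, sol mu 0 (delta_mx i 0) (e mu)) /\ tend0 (fun mu => N (n + r) (e mu - e mu0)).
  apply: (@near_solve (fun=> 0) (fun=> delta_mx i 0) (fun=> V0)).
  - by under eq_fun do rewrite subrr N0; exact: tend0_cst0.
  - by under eq_fun do rewrite subrr cv_norm0; exact: tend0_cst0.
have [e He'] := choice He.
have se : \forall mu \near mu0, forall i, sol mu 0 (delta_mx i 0) (e i mu).
  by apply: filter_forall => i; case: (He' i).
have se0 := nbhs_singleton se; have Ve0 i : V (n + r) (e i mu0) by case: (se0 i).
have [K K0 HK] := op_bounded hab hp (hB mu0).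
pose Z mu := \sum_i N (n + r) (e i mu - e i mu0).
apply: (@tend0_absorb _ _ mu0 _ (fun mu => K * (eta mu + N (n + r) (u mu))) (fun mu => K * Z mu)).
- by move=> mu; exact: cv_norm_ge0.
- apply: filterS3 (filterI near_unique Hw) Hu se => mu [U [Vw Nw Bw]] [Vu Lu Bu] sem.
  rewrite -/(d mu).
  have Ve i : V (n + r) (e i mu) by case: (sem i).
  have s1 : sol mu 0 (d mu) (\sum_i d mu i 0 *: e i mu).
    have := bvp_sum hab hp (hA ^~ mu) (hB mu) (index_enum _) (fun i => d mu i 0) sem.
    by rewrite -column_delta [X in bvp_solution _ _ _ _ _ _ X]big1// => i _; rewrite scaler0.
  have s2 : sol mu 0 (d mu) (w mu - u mu).
    have := bvp_lin hab hp (hB mu) (-1) (And3 Vu Lu Bu) (And3 Vw ((Hg' mu).2 Vw) Bw).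
    by rewrite !scaleN1r addNr oppr0 add0r [- u mu + _]addrC.
  have [Vd _ _] := s1; have [Vx _ _] := s2.
  have Nd : N (n + r) (\sum_i d mu i 0 *: e i mu) <= eta mu + N (n + r) (u mu).
    have [_ ->] := mx_congr hab hp (U _ _ _ _ V0 s2 s1) Vx.
    by apply: le_trans (mxB hab hp Vw Vu).2 _; rewrite lerD2r.
  have [Vd0 _] := mx_sum hab hp (index_enum _) (fun i => d mu i 0) Ve0.
  (* The combination of the e_i(mu) equals w - u on [[a, b]] and is small. Replacing it by that of
     the e_i(mu0) costs at most [Z mu] times the norm of [d mu], which is absorbed. *)
  have dE : d mu = B mu0 (\sum_i d mu i 0 *: e i mu0).
    rewrite (op_sum hab hp (hB mu0))// [LHS]column_delta; apply: eq_bigr => i _.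
    by case: (se0 i) => _ _ ->.
  have hd := HK _ Vd0; rewrite -dE in hd; apply: le_trans hd _; rewrite [X in _ + X]mulrCA -mulrDr ler_wpM2l//.
  apply: le_trans (mxN_triangle Vd0 Vd) _; rewrite addrC; apply: lerD => //.
  rewrite (mxNN hab hp Vd0 Vd) -sumrB.
  under eq_bigr do rewrite -scalerBr.
  have [_ h] := mx_sum hab hp (index_enum _) (fun i => d mu i 0) (fun i => (mxB hab hp (Ve i) (Ve0 i)).1).
  apply: le_trans h _; rewrite /Z mulr_sumr; apply: ler_sum => i _.
  by rewrite ler_wpM2r ?mxN_ge0// cv_norm_entry.
- apply: tend0Z => //; first by move=> mu; rewrite addr_ge0 ?mxN_ge0.
  exact: tend0D.
- apply: tend0Z => //; first by move=> mu; apply: sumr_ge0 => *; exact: mxN_ge0.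
  by apply: tend0_sum => i; case: (He' i).
Qed.

End necessity.

(** * From the limit conditions to continuous dependence *)

Section sufficiency.
Context {R : realType} (a b : R) (p : \bar R).
Hypothesis hab : a < b.
Hypothesis hp : (1 <= p)%E.
Context (n m r : nat) (hm : (0 < m)%N) (hr : (0 < r)%N) (M : metricType R).
Variables (A : 'I_r -> M -> R -> 'M[R[i]]_m) (mu0 : M).
Variable B : M -> (R -> 'cV[R[i]]_m) -> 'cV[R[i]]_(r * m).
Local Notation V k := (@mx_in_W R m 1 a b k p).
Local Notation N := (mxN a b p).
Local Notation sol mu := (bvp_solution a b n p (fun j => A j mu) (B mu)).
Local Notation tend0 := (tend0 mu0).
Hypothesis hA : forall j mu, mx_in_W a b n p (A j mu).
Hypothesis hB : forall mu, continuous_linear_on_W a b (n + r) p (B mu).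
Hypothesis inj0 : forall y, sol mu0 (fun=> 0) 0 y -> forall t, t \in `[a, b] -> y t = 0.
Hypothesis cvgA : tend0 (fun mu => \sum_j N n (A j mu - A j mu0)).
Hypothesis cvgB : forall y, V (n + r) y -> tend0 (fun mu => cv_norm (B mu y - B mu0 y)).

Lemma near_bounded : exists2 K : R, 0 <= K & \forall mu \near mu0,
  forall y, V (n + r) y -> cv_norm (B mu y) <= K * N (n + r) y.
Proof.
have [//|unb] := pselect (exists2 K : R, 0 <= K & \forall mu \near mu0,
  forall y, V (n + r) y -> cv_norm (B mu y) <= K * N (n + r) y).
have H j : exists mu, ball mu0 (j.+1%:R^-1) mu /\
    exists2 y, V (n + r) y & 4 * j.+1%:R * (m.*2.+1)%:R ^+ j * N (n + r) y < cv_norm (B mu y).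
  have [//|nex] := pselect (exists mu, ball mu0 (j.+1%:R^-1) mu /\
    exists2 y, V (n + r) y & 4 * j.+1%:R * (m.*2.+1)%:R ^+ j * N (n + r) y < cv_norm (B mu y)).
  exfalso; apply: unb; exists (4 * j.+1%:R * (m.*2.+1)%:R ^+ j).
    by rewrite !mulr_ge0// exprn_ge0.
  have j0 : 0 < j.+1%:R^-1 :> R by rewrite invr_gt0 ltr0n.
  apply: filterS (nbhsx_ballx mu0 _ j0) => mu mub y Vy; rewrite leNgt; apply/negP => h.
  by apply: nex; exists mu; split=> //; exists y.
have [mu_ Hmu] := choice H.
have [x Vx Hx] := gliding_hump hab hp hm (fun j => hB (mu_ j)) (fun j => (Hmu j).2).
have /nbhs_ballP[d /= d0 Hd] := cvgB Vx ltr01.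
(* Large enough that [mu_ j] lies in the ball where B(mu) x is within 1 of B(mu0) x, and that j + 1
   exceeds the resulting bound on B(mu_j) x. *)
pose j := maxn (Num.trunc d^-1) (Num.trunc (1 + cv_norm (B mu0 x))).
have jd : j.+1%:R^-1 <= d.
  rewrite invf_ple ?posrE ?ltr0n//; apply: ltW; apply: lt_le_trans (truncnS_gt _) _.
  by rewrite ler_nat ltnS leq_maxl.
have jB : 1 + cv_norm (B mu0 x) < j.+1%:R.
  by apply: lt_le_trans (truncnS_gt _) _; rewrite ler_nat ltnS leq_maxr.
have h1 := Hd _ (le_ball jd (Hmu j).1).
have h2 : cv_norm (B (mu_ j) x) <= cv_norm (B (mu_ j) x - B mu0 x) + cv_norm (B mu0 x).
  by have := cv_normD (B (mu_ j) x - B mu0 x) (B mu0 x); rewrite subrK.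
have := le_lt_trans (le_trans (Hx j) h2) (lt_trans (ltr_leD h1 (lexx _)) jB).
by rewrite ltxx.
Qed.

(** At mu0 the bound is [bvp_solvable]; the data L(mu0) w and B(mu0) w have to be exchanged for
    those at mu. For the operator L the error is a small multiple of the norm of w. For the boundary
    values, w is split into a part u with B(mu0) u = 0, handled by the uniform bound on B(mu), and a
    combination of the fixed e_i, on which B(mu) converges. *)
Lemma near_lower_bound : exists2 C : R, 0 <= C & \forall mu \near mu0, forall f w, V n f ->
  V (n + r) w -> diff_eq a b n (fun j => A j mu) f w ->
  N (n + r) w <= C * (N n f + cv_norm (B mu w)).
Proof.
have [K K0 HK] := near_bounded.
have [C1 C10 HC1] := diff_op_diff hab hp n m r.
have [C0 C00 HC0] := bvp_solvable hab hp hr (hA ^~ mu0) (hB mu0) inj0.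
have [V0 N0] := mx0 hab hp m 1 n.
have He (i : 'I_(r * m)) : exists e, sol mu0 0 (delta_mx i 0) e.
  by have [e se _] := HC0 0 (delta_mx i 0) V0; exists e.
have [e se] := choice He; have Ve i : V (n + r) (e i) by case: (se i).
(* The coefficient of the norm of f0 = L(mu0) w after the bound [dle] on B(mu0) w is inserted into
   that of [bvp_solvable]. *)
pose D := C0 * (1 + 2 * K * C0).
have D0 : 0 <= D by rewrite mulr_ge0// addr_ge0// !mulr_ge0.
pose S mu := \sum_j N n (A j mu - A j mu0).
have Sp mu : 0 <= S mu by apply: sumr_ge0 => *; exact: mxN_ge0.
have zeta0 : tend0 (fun mu => \sum_i cv_norm (B mu (e i) - B mu0 (e i))).
  by apply: tend0_sum => i; exact: cvgB.
have half0 : 0 < 2^-1 :> R by rewrite invr_gt0.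
have arith (x g f c v : R) : x <= g + v -> g <= f + c -> c <= x / 2 -> x <= 2 * (f + v) by lra.
have arith2 (x y : R) : x <= y + x / 2 -> x <= 2 * y by lra.
exists (2 * D + 4 * C0); first by rewrite addr_ge0// mulr_ge0.
apply: filterS3 HK (zeta0 _ half0) (tend0Z (mulr_ge0 D0 C10) Sp cvgA half0).
move=> mu HKmu zmu Smu f w Vf Vw Lw.
have [f0 Vf0 Lf0] := diff_op_exists hab hp (hA ^~ mu0) Vw.
pose d := B mu0 w; have sw : sol mu0 f0 d w by split.
have Nf0 : N n f0 <= N n f + C1 * S mu * N (n + r) w.
  rewrite addrC; apply: le_trans (mxN_triangle hab hp Vf0 Vf) _; rewrite lerD2r.
  rewrite (mxNN hab hp Vf0 Vf); exact: HC1 (hA ^~ mu) (hA ^~ mu0) Vf Vf0 Vw Lw Lf0.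
have [u su Nu] := HC0 f0 0 Vf0; have [Vu _ _] := su; rewrite cv_norm0 addr0 in Nu.
have sD := bvp_sum hab hp (hA ^~ mu0) (hB mu0) (index_enum _) (fun i => d i 0) se.
rewrite -column_delta [X in bvp_solution _ _ _ _ _ _ X]big1 in sD; last by move=> i _; rewrite scaler0.
have [VD _ _] := sD.
have sE := bvp_lin hab hp (hB mu0) 1 su sD; rewrite !scale1r addr0 add0r in sE.
have wE := bvp_unique hab hp (hB mu0) inj0 sw sE.
(* The last sum is at most half the norm of [d] by the choice of the neighbourhood, so it is
   absorbed on the left. *)
have dE : d = B mu w - B mu u - \sum_i d i 0 *: (B mu (e i) - B mu0 (e i)).
  have -> : B mu w = B mu u + \sum_i d i 0 *: B mu (e i).
    rewrite (op_congr hab hp (hB mu) Vw wE) -(op_sum hab hp (hB mu))//.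
    by have := op_lin (hB mu) 1 Vu VD; rewrite !scale1r.
  rewrite [_ + _ - B mu u]addrAC subrr add0r; under [X in _ = _ - X]eq_bigr do rewrite scalerBr.
  rewrite sumrB opprB addrC subrK [LHS]column_delta; apply: eq_bigr => i _.
  by case: (se i) => _ _ ->.
have dle : cv_norm d <= 2 * (cv_norm (B mu w) + K * C0 * N n f0).
  have h1 : cv_norm d <= cv_norm (B mu w) + K * C0 * N n f0 + cv_norm d * 2^-1.
    rewrite {1}dE; apply: le_trans (cv_normB _ _) _; apply: lerD.
      apply: le_trans (cv_normB _ _) _; rewrite lerD2l; apply: le_trans (HKmu _ Vu) _.
      by rewrite -mulrA ler_wpM2l.
    apply: le_trans (cv_norm_sum _ _) _.
    apply: (@le_trans _ _ (cv_norm d * \sum_i cv_norm (B mu (e i) - B mu0 (e i)))).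
      rewrite mulr_sumr; apply: ler_sum => i _; rewrite cv_normZ.
      by rewrite ler_wpM2r ?cv_norm_ge0// cv_norm_entry.
    by rewrite ler_wpM2l ?cv_norm_ge0// ltW.
  exact: arith2.
have [y sy Ny] := HC0 f0 d Vf0.
have [Vy _ _] := sy.
have [_ NwE] := mx_congr hab hp (bvp_unique hab hp (hB mu0) inj0 sy sw) Vy.
have F0 := mxN_ge0 a b p n f; have B0 := cv_norm_ge0 (B mu w); have W0 := mxN_ge0 a b p (n + r) w.
apply: (@le_trans _ _ (2 * (D * N n f + 2 * C0 * cv_norm (B mu w)))).
  apply: (@arith _ (D * N n f0) _ (D * (C1 * S mu * N (n + r) w))).
  - rewrite {1}NwE; apply: le_trans Ny _.
    have -> : D * N n f0 + 2 * C0 * cv_norm (B mu w) =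
        C0 * (N n f0 + 2 * (cv_norm (B mu w) + K * C0 * N n f0)) by rewrite /D; ring.
    by rewrite ler_wpM2l// lerD2l.
  - by rewrite -mulrDr ler_wpM2l.
  - by rewrite !mulrA [_ / 2]mulrC ler_wpM2r// ltW.
rewrite -subr_ge0.
have -> : (2 * D + 4 * C0) * (N n f + cv_norm (B mu w)) - 2 * (D * N n f + 2 * C0 * cv_norm (B mu w))
   = 2 * D * cv_norm (B mu w) + 4 * C0 * N n f by ring.
by apply: addr_ge0; apply: mulr_ge0 => //; apply: mulr_ge0.
Qed.

Lemma solution_continuous : solution_continuous_at a b n p A B mu0.
Proof.
have [C C0 HC] := near_lower_bound.
have /nbhs_ballP[eps /= eps0 Heps] := HC.
(* The lower bound gives injectivity on a whole ball, and injectivity implies solvability there. *)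
have injmu mu : ball mu0 eps mu -> forall y, sol mu (fun=> 0) 0 y ->
    forall t, t \in `[a, b] -> y t = 0.
  move=> mub y [Vy Ly By]; have [V0 N0] := mx0 hab hp m 1 n.
  have nr : (n + r = (n + r).-1.+1)%N by rewrite prednK// addn_gt0 hr orbT.
  have := Heps mu mub _ _ V0 Vy Ly; rewrite By cv_norm0 N0 addr0 mulr0.
  by move: Vy; rewrite nr; exact: mxN_eq0.
exists eps; split=> //.
  move=> mu mub f c Vf; have [C' _ HC'] := bvp_solvable hab hp hr (hA ^~ mu) (hB mu) (injmu mu mub).
  split; first by have [y sy _] := HC' f c Vf; exists y.
  by move=> y z; exact: (bvp_unique hab hp (hB mu) (injmu mu mub)).
move=> f c y Vf sy /W_cvgP cf /cv_cvgP cc.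
have {}cf := cf hab hp (nearW _ Vf).
have ball_near := nbhsx_ballx mu0 _ eps0.
apply/(W_cvgP hab hp); first by apply: filterS ball_near => mu /sy[].
have [C1 C10 HC1] := diff_op_diff hab hp n m r.
have [Vy0 Ly0 By0] := sy mu0 (ballxx _ eps0).
pose S mu := \sum_j N n (A j mu - A j mu0).
have Sp mu : 0 <= S mu by apply: sumr_ge0 => *; exact: mxN_ge0.
(* Bounds the data of y(mu) - y(mu0) in the problem at mu: the changes of f and c, and the effect of
   changing the coefficients and the boundary operator on the fixed function y(mu0). *)
pose h mu := N n (f mu - f mu0) + C1 * N (n + r) (y mu0) * S mu +
   (cv_norm (c mu - c mu0) + cv_norm (B mu (y mu0) - B mu0 (y mu0))).
have hp0 mu : 0 <= h mu.
  by rewrite !addr_ge0 ?mulr_ge0 ?cv_norm_ge0 ?mxN_ge0.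
have h0 : tend0 h.
  apply: tend0D; apply: tend0D => //; [exact: cf| |exact: cvgB].
  by apply: tend0Z => //; rewrite mulr_ge0// mxN_ge0.
apply: tend0_le (tend0Z C0 hp0 h0).
apply: filterS2 ball_near HC => mu mub HCmu.
have [Vy Ly By] := sy mu mub.
have [g Vg Lg] := diff_op_exists hab hp (hA ^~ mu) Vy0.
have := diff_eq_lin hab hp (-1) Vy0 Vy Lg Ly.
rewrite !scaleN1r [- _ + y mu]addrC [- g + _]addrC => Lw.
have [Vw _] := mxB hab hp Vy Vy0; have [Vfg _] := mxB hab hp (Vf mu) Vg.
apply: le_trans (HCmu _ _ Vfg Vw Lw) _; rewrite ler_wpM2l//; apply: lerD.
  apply: le_trans (mxN_dist hab hp (Vf mu) (Vf mu0) Vg) _; rewrite lerD2l.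
  rewrite (mxNN hab hp (Vf mu0) Vg) [leRHS]mulrAC.
  exact: HC1 (hA ^~ mu) (hA ^~ mu0) Vg (Vf mu0) Vy0 Lg Ly0.
rewrite (opB (hB mu) Vy Vy0) By By0.
apply: le_trans (cv_norm_dist _ (c mu0) _) _; rewrite lerD2l.
by rewrite -cv_normN opprB.
Qed.

End sufficiency.

Theorem theorem2p2 (R : realType) (a b : R) (hab : a < b)
    (n m r : nat) (hm : (0 < m)%N) (hr : (0 < r)%N)
    (p : \bar R) (hp : (1 <= p)%E)
    (M : metricType R)
    (A : 'I_r -> M -> R -> 'M[R[i]]_m)
    (hA : forall (j : 'I_r) (mu : M), mx_in_W a b n p (A j mu))
    (B : M -> (R -> 'cV[R[i]]_m) -> 'cV[R[i]]_(r * m))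
    (hB : forall mu : M, continuous_linear_on_W a b (n + r) p (B mu))
    (mu0 : M) (hmu0 : limit_point [set: M] mu0) :
  solution_continuous_at a b n p A B mu0 <->
  [/\ (* Condition (0) *)
      (forall y : R -> 'cV[R[i]]_m,
         bvp_solution a b n p (fun j => A j mu0) (B mu0) (fun _ => 0) 0 y ->
         forall t : R, t \in `[a, b] -> y t = 0),
      (* Limit Condition (I) *)
      (forall j : 'I_r, W_cvg a b p n (A j) mu0) &
      (* Limit Condition (II) *)
      (forall y : R -> 'cV[R[i]]_m, mx_in_W a b (n + r) p y ->
         cv_cvg (fun mu => B mu y) mu0)].
Proof.
split=> [hs|[h0 hI hII]].
  split; first exact: (limit_problem_unique hab hp hA hB hs).
    move=> j; apply/(W_cvgP hab hp (nearW _ (hA j))).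
    apply: (tend0_le _ (coefficients_converge hab hp hA hB hs)); apply: nearW => mu.
    rewrite [leRHS](bigD1 j)//= lerDl; apply: sumr_ge0 => *; exact: mxN_ge0.
  move=> y Vy; apply/cv_cvgP; exact: (boundary_converge hab hp hA hB hs).
apply: (solution_continuous hab hp hm hr hA hB h0) => [|y Vy]; last exact/cv_cvgP/hII.
by apply: tend0_sum => j; apply/(W_cvgP hab hp (nearW _ (hA j))); exact: hI.
Qed.
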